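(* Consider the algorithm DGDA-VR described in the context. Assume: every $f_i$ is $L$-smooth, where $L>0$; every $f_i(\mathbf{x},\cdot)$ is $\mu$-strongly concave for each fixed $\mathbf{x}$, where $\mu>0$; $\inf_{\mathbf{x}}\Phi(\mathbf{x})>-\infty$; the stochastic oracles are unbiased with variance at most $\sigma^2$ and are mean-squared $L$-Lipschitz; and $W$ is a mixing matrix with $\rho=\|W-\Pi\|_2\in[0,1)$. Let $\epsilon>0$ and let the parameters be chosen (with suitable constants in the $\Theta(\cdot)$'s) such that $$\eta_y=\Theta\Big(\frac1L\min\Big\{(1-\rho)^2,\frac1\kappa\Big\}\Big),\qquad \eta_x=\Theta\Big(\frac{\eta_y}{\kappa^2}\Big),\qquad S_1=\Theta\Big(\frac{\kappa^2\sigma^2}{\epsilon^2}\Big),\qquad S_2\ge q,\qquad q\ge 1 .$$ Then there exists $T_\epsilon\in\mathbb{N}$ such that $$T_\epsilon=\mathcal{O}\Big(\max\Big\{\frac1{\eta_x},\ \frac{L\kappa}{\eta_y},\ \frac{L^2\kappa^2}{(1-\rho)M}\Big\}\,\epsilon^{-2}\Big)$$ and the iterates $\{X^t\}$ generated by the algorithm satisfy $$\frac1T\sum_{t=0}^{T-1}\mathbf{E}\big[\|\nabla\Phi(\bar{\mathbf{x}}^t)\|\big]\le\epsilon\qquad\text{for all }T\ge T_\epsilon .$$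
   Context: Problem. $M,d,m\in\mathbb{N}^+$; $f_i:\mathbb{R}^d\times\mathbb{R}^m\to\mathbb{R}$ for $i\in[M]=\{1,\dots,M\}$ are differentiable, and $f=\frac1M\sum_{i=1}^M f_i$. Write $\mathbf{z}=(\mathbf{x},\mathbf{y})\in\mathbb{R}^{d+m}$. ''$f_i$ is $L$-smooth'' means $\|\nabla f_i(\mathbf{z})-\nabla f_i(\mathbf{z}')\|\le L\|\mathbf{z}-\mathbf{z}'\|$ for all $\mathbf{z},\mathbf{z}'$. $\kappa=L/\mu$, $\Phi(\mathbf{x})=\max_{\mathbf{y}}f(\mathbf{x},\mathbf{y})$. Stochastic oracles. For a random sample $\xi$, $\tilde\nabla f_i(\mathbf{z};\xi)$ is a random estimate of $\nabla f_i(\mathbf{z})$. ''Unbiased with variance at most $\sigma^2$'': $\mathbf{E}[\tilde\nabla f_i(\mathbf{z};\xi)\mid\mathbf{z}]=\nabla f_i(\mathbf{z})$ and $\mathbf{E}[\|\tilde\nabla f_i(\mathbf{z};\xi)-\nabla f_i(\mathbf{z})\|^2\mid\mathbf{z}]\le\sigma^2$ ($\sigma>0$), for all $i$ and $\mathbf{z}$. ''Mean-squared $L$-Lipschitz'': $\mathbf{E}[\|\tilde\nabla f_i(\mathbf{z};\xi)-\tilde\nabla f_i(\mathbf{z}';\xi)\|^2]\le L^2\,\mathbf{E}[\|\mathbf{z}-\mathbf{z}'\|^2]$ for all $\mathbf{z},\mathbf{z}'$. Mixing matrix. $\mathcal{G}=([M],\mathcal{E})$ is a connected network; $W=(w_{ij})\in\mathbb{R}^{M\times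 M}$ has nonnegative entries, $w_{ij}=0$ if $(i,j)\notin\mathcal{E}$, $W\mathbf{1}=\mathbf{1}$, $W^\top\mathbf{1}=\mathbf{1}$, and $\rho=\|W-\Pi\|_2\in[0,1)$ (spectral norm), where $\Pi=\frac1M\mathbf{1}\mathbf{1}^\top$. $W$ need not be symmetric. Algorithm DGDA-VR. Inputs: $Z^0=(X^0,Y^0)$ with $X^0\in\mathbb{R}^{M\times d}$, $Y^0\in\mathbb{R}^{M\times m}$, stepsizes $\eta_x,\eta_y>0$, positive integers $S_1,S_2,q$. The $i$-th rows of $X^t,Y^t$ are $\mathbf{x}_i^t,\mathbf{y}_i^t$ (agent $i$), and $\mathbf{z}_i^t=(\mathbf{x}_i^t,\mathbf{y}_i^t)$. $V^t=(V_x^t,V_y^t)\in\mathbb{R}^{M\times(d+m)}$ has rows $\mathbf{v}_i^t$ (gradient estimates) and $D^t=(D_x^t,D_y^t)\in\mathbb{R}^{M\times(d+m)}$ is the gradient-tracking matrix. For $t=0,1,2,\dots$: (1) $X^{t+1}=WX^t-\eta_xD_x^t$ and $Y^{t+1}=WY^t+\eta_yD_y^t$; (2) if $\mathrm{mod}(t,q)=0$, draw random samples $\mathcal{C}_i^{t+1}$ with $|\mathcal{C}_i^{t+1}|=S_1$ and set $\mathbf{v}_i^{t+1}=\frac1{S_1}\sum_{\xi\in\mathcal{C}_i^{t+1}}\tilde\nabla f_i(\mathbf{z}_i^{t+1};\xi)$ for all $i$; otherwise draw random samples $\mathcal{B}_i^{t+1}$ with $|\mathcal{B}_i^{t+1}|=S_2$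 and set $\mathbf{v}_i^{t+1}=\mathbf{v}_i^t+\frac1{S_2}\sum_{\xi\in\mathcal{B}_i^{t+1}}\big(\tilde\nabla f_i(\mathbf{z}_i^{t+1};\xi)-\tilde\nabla f_i(\mathbf{z}_i^{t};\xi)\big)$ for all $i$; (3) $D^{t+1}=W(D^t+V^{t+1}-V^t)$. All samples are drawn independently. Initialization: $\mathbf{v}_i^0$ is an average of $S_1$ stochastic gradients at $\mathbf{z}_i^0$, and $D^0$ satisfies $\Pi D^0=\Pi V^0$ (the average of the rows of $D^0$ equals that of $V^0$). Average: $\bar{\mathbf{x}}^t=\frac1M\sum_{i=1}^M\mathbf{x}_i^t$. Order notation. $\Theta(\cdot)$ hides absolute constants ($S_1$ being rounded to an integer). In $T_\epsilon=\mathcal{O}(\cdot)$ the hidden constant depends only on the initial quantities $\Phi(\bar{\mathbf{x}}^0)-\inf\Phi$, $\|\mathbf{y}^*(\bar{\mathbf{x}}^0)-\bar{\mathbf{y}}^0\|^2$, $\|Z^0-\Pi Z^0\|_F^2$ and $\|D^0-\Pi D^0\|_F^2$, where $\bar{\mathbf{y}}^0=\frac1M\sum_i\mathbf{y}_i^0$, $\mathbf{y}^*(\mathbf{x})=\arg\max_{\mathbf{y}}f(\mathbf{x},\mathbf{y})$ and $\|\cdot\|_F$ is the Frobenius norm.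
   Formalization: In the hidden constant, the initial quantity ‖D⁰−ΠD⁰‖_F² is replaced by its expectation (assumed finite) divided by min{1,L²}; without this normalization the bound fails as L→0. For L≥1 or D⁰=ΠD⁰ the division changes nothing. *)

(* Defs.v *)
From HB Require Import structures.
From mathcomp Require Import all_boot all_order all_algebra.
From mathcomp Require Import all_classical all_reals all_analysis.

Set Implicit Arguments.
Unset Strict Implicit.
Unset Printing Implicit Defensive.
Import Order.TTheory GRing.Theory Num.Theory.
Import numFieldNormedType.Exports.
Local Open Scope classical_set_scope.
Local Open Scope ring_scope.

(* Frobenius norm; on row and column vectors it is the Euclidean norm (the
   library norm `|A| on matrices is the max norm). *)
Definition fnorm (R : realType) (m n : nat) (A : 'M[R]_(m, n)) : R :=
  Num.sqrt (\sum_(i < m) \sum_(j < n) A i j ^+ 2).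

Definition spectral_norm (R : realType) (n : nat) (A : 'M[R]_n) : R :=
  sup [set fnorm (A *m v) | v in [set v : 'cV[R]_n | fnorm v <= 1]].

Definition grad (R : realType) (n : nat) (h : 'rV[R]_n -> R) (z : 'rV[R]_n) :
  'rV[R]_n := \row_j 'D_(delta_mx 0 j) h z.

Definition row_mean (R : realType) (M n : nat) (A : 'M[R]_(M, n)) : 'rV[R]_n :=
  M%:R^-1 *: \sum_(i < M) row i A.

(* The matrix (1/M) 1 1^T: every row of [avg_mx R M *m A] is [row_mean A]. *)
Definition avg_mx (R : realType) (M : nat) : 'M[R]_M := const_mx M%:R^-1.

(** The minimax problem; a point z = (x, y) is [row_mx x y]. *)

Definition smooth (R : realType) (n : nat) (L : R) (h : 'rV[R]_n -> R) : Prop :=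
  forall z z', fnorm (grad h z - grad h z') <= L * fnorm (z - z').

Definition strongly_concave (R : realType) (n : nat) (mu : R)
    (h : 'rV[R]_n -> R) : Prop :=
  forall (y y' : 'rV[R]_n) (a : R), 0 <= a <= 1 ->
    a * h y + (1 - a) * h y' + mu / 2 * (a * (1 - a)) * fnorm (y - y') ^+ 2
      <= h (a *: y + (1 - a) *: y').

Definition avg_fun (R : realType) (M n : nat) (f : 'I_M -> 'rV[R]_n -> R)
    (z : 'rV[R]_n) : R := M%:R^-1 * \sum_(i < M) f i z.

Definition Phi (R : realType) (d m : nat) (F : 'rV[R]_(d + m) -> R)
    (x : 'rV[R]_d) : R := sup (range (fun y : 'rV[R]_m => F (row_mx x y))).

Definition ystar (R : realType) (d m : nat) (F : 'rV[R]_(d + m) -> R)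
    (x : 'rV[R]_d) : 'rV[R]_m :=
  get [set y | forall y', F (row_mx x y') <= F (row_mx x y)].

(** Stochastic oracles: [G i z s] is the estimate by agent i of the gradient at
    z from the sample s, and agent i draws its samples from the law [Q i]. *)

(* Joint measurability in (z, s); 'rV[R]_n carries no sigma-algebra in the
   library, so z is passed as an n-tuple. *)
Definition measurable_oracle (R : realType) (M n : nat) (dX : measure_display)
    (Xi : measurableType dX) (G : 'I_M -> 'rV[R]_n -> Xi -> 'rV[R]_n) : Prop :=
  forall (i : 'I_M) (k : 'I_n),
    measurable_fun setT
      (fun p : n.-tuple R * Xi => G i (\row_j tnth p.1 j) p.2 0 k).

Definition unbiased_oracle (R : realType) (M n : nat) (dX : measure_display)
    (Xi : measurableType dX) (Q : 'I_M -> probability Xi R)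
    (f : 'I_M -> 'rV[R]_n -> R) (G : 'I_M -> 'rV[R]_n -> Xi -> 'rV[R]_n) : Prop :=
  forall (i : 'I_M) (z : 'rV[R]_n) (k : 'I_n),
    (Q i).-integrable setT (fun s => (G i z s ord0 k)%:E) /\
    'E_(Q i)[fun s => G i z s ord0 k]%E = (grad (f i) z ord0 k)%:E.

Definition oracle_variance_le (R : realType) (M n : nat) (dX : measure_display)
    (Xi : measurableType dX) (Q : 'I_M -> probability Xi R) (sigma : R)
    (f : 'I_M -> 'rV[R]_n -> R) (G : 'I_M -> 'rV[R]_n -> Xi -> 'rV[R]_n) : Prop :=
  forall (i : 'I_M) (z : 'rV[R]_n),
    ('E_(Q i)[fun s => (fnorm (G i z s - grad (f i) z) ^+ 2)%R]
       <= (sigma ^+ 2)%:E)%E.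

Definition mean_squared_lipschitz (R : realType) (M n : nat)
    (dX : measure_display) (Xi : measurableType dX)
    (Q : 'I_M -> probability Xi R) (L : R)
    (G : 'I_M -> 'rV[R]_n -> Xi -> 'rV[R]_n) : Prop :=
  forall (i : 'I_M) (z z' : 'rV[R]_n),
    ('E_(Q i)[fun s => (fnorm (G i z s - G i z' s) ^+ 2)%R]
       <= (L ^+ 2 * fnorm (z - z') ^+ 2)%:E)%E.

(** Networks and mixing matrices *)

(* Whether (i, i) is an edge is left free: a diagonal entry of W may be nonzero
   only where the network has a self-loop. *)
Definition connected_network (M : nat) (e : rel 'I_M) : Prop :=
  symmetric e /\ forall i j : 'I_M, connect e i j.

Record mixing_matrix (R : realType) (M : nat) (e : rel 'I_M) (rho : R)
    (W : 'M[R]_M) : Prop := MixingMatrix {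
  mixing_ge0 : forall i j, 0 <= W i j ;
  mixing_edge : forall i j, ~~ e i j -> W i j = 0 ;
  mixing_row : W *m (const_mx 1 : 'cV[R]_M) = const_mx 1 ;
  mixing_col : W^T *m (const_mx 1 : 'cV[R]_M) = const_mx 1 ;
  mixing_rho : rho = spectral_norm (W - avg_mx R M) ;
  mixing_rho01 : 0 <= rho < 1
}.

(** Independence of a family of set systems indexed by K *)

Definition mutually_independent (R : realType) (dO : measure_display)
    (Omega : measurableType dO) (P : probability Omega R) (I : eqType)
    (K : set I) (E : I -> set (set Omega)) : Prop :=
  forall (s : seq I) (A : I -> set Omega), uniq s ->
    (forall k, k \in s -> K k /\ E k (A k)) ->
    fine (P (\bigcap_(k in [set` s]) A k)) = \prod_(k <- s) fine (P (A k)).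

Definition sigma_of (dO dX : measure_display) (Omega : measurableType dO)
    (Xi : measurableType dX) (X : Omega -> Xi) : set (set Omega) :=
  preimage_set_system setT X measurable.

(** DGDA-VR *)

Definition batch_size (S1 S2 q t : nat) : nat :=
  if t is s.+1 then (if (s %% q == 0)%N then S1 else S2) else S1.

(* [xi t i j], for j < batch_size S1 S2 q t, is the j-th sample drawn by agent i
   for the estimate v_i^t; the other [xi t i j] are never used. *)
Definition used_sample (M : nat) (S1 S2 q : nat) (k : nat * 'I_M * nat) : bool :=
  (k.2 < batch_size S1 S2 q k.1.1)%N.

(* The information available once v_i^0 and D^0 have been computed. *)
Definition sigma_init (R : realType) (M n : nat) (dO dX : measure_display)
    (Omega : measurableType dO) (Xi : measurableType dX) (S1 : nat)
    (xi : nat -> 'I_M -> nat -> Omega -> Xi) (D0 : Omega -> 'M[R]_(M, n)) :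
    set (set Omega) :=
  <<s (\bigcup_i \bigcup_(j in [set j | (j < S1)%N]) sigma_of (xi 0%N i j))
      `|` (\bigcup_i \bigcup_k sigma_of (fun w => D0 w i k)) >>.

(* D^0 may depend on the samples used for V^0 and on extra randomness, but not
   on the samples drawn at later iterations; [None] is the index of [sigma_init]. *)
Record dgda_vr_sampling (R : realType) (M n : nat) (dO dX : measure_display)
    (Omega : measurableType dO) (P : probability Omega R)
    (Xi : measurableType dX) (Q : 'I_M -> probability Xi R) (S1 S2 q : nat)
    (xi : nat -> 'I_M -> nat -> Omega -> Xi) (D0 : Omega -> 'M[R]_(M, n)) :
    Prop := DgdaVrSampling {
  sampling_measurable : forall t i j, (j < batch_size S1 S2 q t)%N ->
    measurable_fun setT (xi t i j) ;
  sampling_law : forall t i j, (j < batch_size S1 S2 q t)%N ->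
    forall B, measurable B -> P (xi t i j @^-1` B) = Q i B ;
  sampling_independent :
    mutually_independent P [set k | used_sample S1 S2 q k]
      (fun k => sigma_of (xi k.1.1 k.1.2 k.2)) ;
  sampling_D0_measurable : forall i k,
    measurable_fun setT (fun w => D0 w i k) ;
  sampling_D0_independent :
    mutually_independent P
      [set o | if o is Some k then (0 < k.1.1)%N && used_sample S1 S2 q k
               else true]
      (fun o => if o is Some k then sigma_of (xi k.1.1 k.1.2 k.2)
                else sigma_init S1 xi D0)
}.

(* The (d + m)-column matrices V = (V_x, V_y) and D = (D_x, D_y) are kept whole;
   [lsubmx] and [rsubmx] are their x- and y-parts. *)
Record dgda_vr_iterates (R : realType) (M d m : nat) (dO dX : measure_display)
    (Omega : measurableType dO) (Xi : measurableType dX)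
    (G : 'I_M -> 'rV[R]_(d + m) -> Xi -> 'rV[R]_(d + m)) (W : 'M[R]_M)
    (eta_x eta_y : R) (S1 S2 q : nat)
    (X0 : 'M[R]_(M, d)) (Y0 : 'M[R]_(M, m))
    (xi : nat -> 'I_M -> nat -> Omega -> Xi)
    (X : nat -> Omega -> 'M[R]_(M, d)) (Y : nat -> Omega -> 'M[R]_(M, m))
    (V D : nat -> Omega -> 'M[R]_(M, d + m)) : Prop := DgdaVrIterates {
  iter_X0 : forall w, X 0%N w = X0 ;
  iter_Y0 : forall w, Y 0%N w = Y0 ;
  iter_V0 : forall w i, row i (V 0%N w) =
    S1%:R^-1 *: \sum_(j < S1) G i (row i (row_mx X0 Y0)) (xi 0%N i j w) ;
  iter_D0 : forall w, avg_mx R M *m D 0%N w = avg_mx R M *m V 0%N w ;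
  iter_X : forall t w, X t.+1 w = W *m X t w - eta_x *: lsubmx (D t w) ;
  iter_Y : forall t w, Y t.+1 w = W *m Y t w + eta_y *: rsubmx (D t w) ;
  iter_V_full : forall t w i, (t %% q = 0)%N ->
    row i (V t.+1 w) =
      S1%:R^-1 *: \sum_(j < S1)
        G i (row i (row_mx (X t.+1 w) (Y t.+1 w))) (xi t.+1 i j w) ;
  iter_V_vr : forall t w i, (t %% q <> 0)%N ->
    row i (V t.+1 w) =
      row i (V t w) +
      S2%:R^-1 *: \sum_(j < S2)
        (G i (row i (row_mx (X t.+1 w) (Y t.+1 w))) (xi t.+1 i j w)
         - G i (row i (row_mx (X t w) (Y t w))) (xi t.+1 i j w)) ;
  iter_D : forall t w, D t.+1 w = W *m (D t w + V t.+1 w - V t w)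
}.

(** Order notation *)

Definition theta (R : realType) (a b g x : R) : Prop := a * g <= x <= b * g.

(* [n] is a rounding, in either direction, of some real number of order g. *)
Definition theta_rounded (R : realType) (a b g : R) (n : nat) : Prop :=
  exists s : R, theta a b g s /\ `|n%:R - s| < 1.

(* Main.v *)
(** Write r = 1 - rho and let a, b, ep, dz be the averages over the agents of
    ||Z - Pi Z||^2, ||D - Pi D||^2, ||V - grad f(Z)||^2 and ||Z^(t+1) - Z^t||^2, and
    dl = ||y*(xbar) - ybar||^2.  Along every trajectory, up to coupling terms, a and b
    contract with rate 1 - r, dl contracts with rate 1 - mu eta_y / 4, and Phi(xbar)
    decreases by eta_x/2 (||grad Phi||^2 + ||v_x||^2), where v is the mean of V.  For
    stepsizes that are small constant multiples of the stated orders, summing over t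
    < T gives, deterministically,
      sum ||grad Phi||^2 + 130 kappa^2 L^2 sum dz <= (initial terms) + 65 kappa^2 sum ep.
    Conditioning each minibatch on the past shows that E ep is reset to at most
    sigma^2/S1 every q steps and otherwise grows by at most (L^2/S2) E dz, so
    sum E ep <= T sigma^2/S1 + L^2 sum E dz because q <= S2, and the dz terms cancel.
    With S1 of order kappa^2 sigma^2/eps^2, the bound g <= eps/2 + g^2/(2 eps) turns
    the squared norms into norms. *)

Require Import Defs.
From HB Require Import structures.
From mathcomp Require Import all_boot all_order all_algebra.
From mathcomp Require Import all_classical all_reals all_analysis.
From mathcomp Require Import measurable_realfun.
From mathcomp Require Import zify ring lra.

Set Implicit Arguments.
Unset Strict Implicit.
Unset Printing Implicit Defensive.
Import Order.TTheory GRing.Theory Num.Theory.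
Import numFieldNormedType.Exports.
Local Open Scope classical_set_scope.
Local Open Scope ring_scope.

(** The recursions form a cycle: [dz] drives [b], [b] drives [a], and [a] and [b] drive [dz]. Each
    of the two contractions loses a factor 1/r when summed and another through Young's inequality,
    so the gain of the cycle is of order (L eta_y)^2 / r^4; this is why L eta_y must be of order
    r^2. The condition L kappa eta_y = O(1) keeps the y-step inside the budget of [dz], and kappa^2
    eta_x = O(eta_y) makes the drift of the maximizer small against the contraction of [dl]. Two
    points shape the probabilistic half. Conditional expectations are never formed: quantities known
    before a sample is drawn are frozen by integrating over a product law. And square integrability
    along the iterates is not assumed, apart from the initial tracking error; it is obtained step by
    step, the pathwise inequality bounding [dz] by errors up to the same time and the minibatch
    estimate bounding the next error. The factor 65 is 3 + 3 * 20 plus slack: 3 compares v with the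
    gradient at the maximizer, 20 is the error fed through [dl]. Twice 65 multiplies [dz], more than
    cancellation requires. *)

(** * Frobenius inner product, Cauchy-Schwarz and Young inequalities *)

Definition dot (R : realType) (p n : nat) (A B : 'M[R]_(p, n)) : R :=
  \sum_(i < p) \sum_(j < n) A i j * B i j.

Section FrobeniusInnerProduct.
Variables (R : realType) (p n : nat).
Implicit Types (A B C : 'M[R]_(p, n)) (a b : R).

Lemma dotC A B : dot A B = dot B A.
Proof. by apply: eq_bigr => i _; apply: eq_bigr => j _; rewrite mulrC. Qed.

Lemma dotDl A B C : dot (A + B) C = dot A C + dot B C.
Proof.
rewrite /dot -big_split; apply: eq_bigr => i _ /=.
by rewrite -big_split; apply: eq_bigr => j _; rewrite mxE mulrDl.
Qed.

Lemma dotZl a A B : dot (a *: A) B = a * dot A B.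
Proof.
rewrite /dot mulr_sumr; apply: eq_bigr => i _; rewrite mulr_sumr.
by apply: eq_bigr => j _; rewrite mxE mulrA.
Qed.

Lemma dotDr A B C : dot A (B + C) = dot A B + dot A C.
Proof. by rewrite !(dotC A) dotDl. Qed.

Lemma dotZr a A B : dot A (a *: B) = a * dot A B.
Proof. by rewrite !(dotC A) dotZl. Qed.

Lemma dotNl A B : dot (- A) B = - dot A B.
Proof. by rewrite -scaleN1r dotZl mulN1r. Qed.

Lemma dotNr A B : dot A (- B) = - dot A B.
Proof. by rewrite !(dotC A) dotNl. Qed.

Definition dotE := (dotDl, dotDr, dotNl, dotNr, dotZl, dotZr).

Lemma dot_ge0 A : 0 <= dot A A.
Proof.
by apply: sumr_ge0 => i _; apply: sumr_ge0 => j _; rewrite -expr2 sqr_ge0.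
Qed.

Lemma fnorm_sqr A : fnorm A ^+ 2 = dot A A.
Proof.
rewrite /fnorm; under eq_bigr do under eq_bigr do rewrite expr2.
exact/sqr_sqrtr/dot_ge0.
Qed.

Lemma fnorm_ge0 A : 0 <= fnorm A.
Proof. exact: sqrtr_ge0. Qed.

Lemma fnorm_eq0 A : fnorm A = 0 -> A = 0.
Proof.
move=> A0; have : dot A A = 0 by rewrite -fnorm_sqr A0 expr0n.
move=> /eqP; rewrite psumr_eq0; last first.
  by move=> i _; apply: sumr_ge0 => j _; rewrite -expr2 sqr_ge0.
move=> /allP H; apply/matrixP => i j; rewrite mxE.
have := H i (mem_index_enum _) => /=; rewrite psumr_eq0 => [/allP|k _]; last first.
  by rewrite -expr2 sqr_ge0.
by move=> /(_ j (mem_index_enum _)) /=; rewrite mulf_eq0 orbb => /eqP.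
Qed.

Lemma fnorm0 : fnorm (0 : 'M[R]_(p, n)) = 0.
Proof.
by apply/eqP; rewrite -sqrf_eq0 fnorm_sqr -[X in dot X _](scale0r 0) dotZl mul0r.
Qed.

(** Cauchy-Schwarz: the square of [fnorm B *: A - fnorm A *: B] expands to twice [fnorm A * fnorm B]
    times the gap between the two sides. Zero norms are split off so that this factor can be
    cancelled. *)
Lemma dot_fnorm_le A B : dot A B <= fnorm A * fnorm B.
Proof.
have [A0|A0] := eqVneq (fnorm A) 0.
  by rewrite A0 (fnorm_eq0 A0) -(scale0r A) dotZl !mul0r.
have [B0|B0] := eqVneq (fnorm B) 0.
  by rewrite B0 (fnorm_eq0 B0) -(scale0r B) dotZr mul0r mulr0.
have := dot_ge0 (fnorm B *: A - fnorm A *: B).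
rewrite !dotE -!fnorm_sqr (dotC B A).
move=> H; suff : 0 <= 2 * (fnorm A * fnorm B) * (fnorm A * fnorm B - dot A B).
  rewrite pmulr_rge0 ?subr_ge0// mulr_gt0// mulr_gt0// lt_def fnorm_ge0.
    by rewrite A0.
  by rewrite B0.
by apply: le_trans H _; rewrite le_eqVlt; apply/orP; left; apply/eqP; ring.
Qed.

Lemma fnormZ a A : fnorm (a *: A) = `|a| * fnorm A.
Proof.
apply/eqP; rewrite -(eqrXn2 (ltn0Sn 1)) ?mulr_ge0 ?fnorm_ge0//.
by rewrite exprMn real_normK ?num_real// !fnorm_sqr !dotE mulrA expr2.
Qed.

Lemma fnormN A : fnorm (- A) = fnorm A.
Proof. by rewrite -scaleN1r fnormZ normrN1 mul1r. Qed.

Lemma fnormB A B : fnorm (A - B) = fnorm (B - A).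
Proof. by rewrite -fnormN opprB. Qed.

Lemma fnormD A B : fnorm (A + B) <= fnorm A + fnorm B.
Proof.
rewrite -(@ler_pXn2r _ 2)// ?nnegrE ?addr_ge0 ?fnorm_ge0//.
rewrite fnorm_sqr !dotE sqrrD -!fnorm_sqr (dotC B A).
by have := dot_fnorm_le A B; lra.
Qed.

Lemma normr_dot_le A B : `|dot A B| <= fnorm A * fnorm B.
Proof.
by rewrite ler_norml dot_fnorm_le lerNl -dotNl -(fnormN A) dot_fnorm_le.
Qed.

Lemma fnorm_le_sqr A b : 0 <= b -> fnorm A ^+ 2 <= b ^+ 2 -> fnorm A <= b.
Proof. by move=> b0; rewrite ler_pXn2r ?nnegrE ?fnorm_ge0. Qed.

Lemma fnormD_sqr A B : fnorm (A + B) ^+ 2 <= 2 * (fnorm A ^+ 2 + fnorm B ^+ 2).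
Proof. by have := dot_ge0 (A - B); rewrite !fnorm_sqr !dotE (dotC B A); lra. Qed.

Lemma fnorm3_sqr A B C :
  fnorm (A + B + C) ^+ 2 <= 3 * (fnorm A ^+ 2 + fnorm B ^+ 2 + fnorm C ^+ 2).
Proof.
move: (dot_ge0 (A - B)) (dot_ge0 (A - C)) (dot_ge0 (B - C)).
by rewrite !fnorm_sqr !dotE (dotC B A) (dotC C A) (dotC C B); lra.
Qed.

(** Young with weight 2. The second term will be applied to an error already bounded with a factor
    2, so that 3/2 also becomes 3. *)
Lemma fnormD_sqr_weighted A B :
  fnorm (A + B) ^+ 2 <= 3 * fnorm A ^+ 2 + 3 / 2 * fnorm B ^+ 2.
Proof.
by have := dot_ge0 (2 *: A - B); rewrite !fnorm_sqr !dotE (dotC B A); lra.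
Qed.

Lemma fnormD_sqr_young a A B : 0 < a ->
  fnorm (A + B) ^+ 2 <= (1 + a) * fnorm A ^+ 2 + (1 + a^-1) * fnorm B ^+ 2.
Proof.
move=> a0; have := dot_ge0 (a *: A - B); rewrite !fnorm_sqr !dotE (dotC B A) => H.
rewrite -subr_ge0 -(pmulr_rge0 _ a0).
have -> : a * ((1 + a) * dot A A + (1 + a^-1) * dot B B -
    (dot A A + dot A B + (dot A B + dot B B))) =
  a * (a * dot A A) - a * dot A B + (- (a * dot A B) - - dot B B).
  by field; rewrite gt_eqF.
by apply: le_trans H _; rewrite le_eqVlt; apply/orP; left; apply/eqP; ring.
Qed.

Lemma dot_polar A B :
  dot A B = 2^-1 * (fnorm A ^+ 2 + fnorm B ^+ 2 - fnorm (A - B) ^+ 2).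
Proof. by rewrite !fnorm_sqr !dotE (dotC B A); field. Qed.

Lemma fnormZD_sqr a A B :
  fnorm (a *: A + B) ^+ 2 = a ^+ 2 * fnorm A ^+ 2 + 2 * a * dot B A + fnorm B ^+ 2.
Proof. by rewrite !fnorm_sqr !dotE (dotC A B); ring. Qed.

End FrobeniusInnerProduct.

(** Convexity of the square at (1 - r) x + r (y / r). A perturbed contraction of norms thus becomes
    a contraction of squared norms at the same rate, at the price of 1/r on the perturbation. *)
Lemma sqrr_young (R : realType) (r x y : R) : 0 < r <= 1 ->
  ((1 - r) * x + y) ^+ 2 <= (1 - r) * x ^+ 2 + r^-1 * y ^+ 2.
Proof.
move=> /andP[r0 r1]; rewrite -subr_ge0 -(pmulr_rge0 _ r0).
have -> : r * ((1 - r) * x ^+ 2 + r^-1 * y ^+ 2 - ((1 - r) * x + y) ^+ 2) =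
    (1 - r) * (r * x - y) ^+ 2.
  by field; rewrite gt_eqF.
by rewrite mulr_ge0 ?sqr_ge0// subr_ge0.
Qed.

(** * Rows, columns and blocks; Frobenius and spectral norms of products *)

Section Blocks.
Variable R : realType.

Lemma fnorm_sum_row p n (A : 'M[R]_(p, n)) :
  fnorm A ^+ 2 = \sum_(i < p) fnorm (row i A) ^+ 2.
Proof.
rewrite fnorm_sqr; apply: eq_bigr => i _; rewrite fnorm_sqr /dot big_ord1.
by apply: eq_bigr => j _; rewrite !mxE.
Qed.

Lemma fnorm_sum_col p n (A : 'M[R]_(p, n)) :
  fnorm A ^+ 2 = \sum_(j < n) fnorm (col j A) ^+ 2.
Proof.
rewrite fnorm_sqr /dot exchange_big; apply: eq_bigr => j _.
rewrite fnorm_sqr /dot; apply: eq_bigr => i _.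
by rewrite big_ord1 !mxE.
Qed.

Lemma dot_row_mx p n1 n2 (A B : 'M[R]_(p, n1)) (A' B' : 'M[R]_(p, n2)) :
  dot (row_mx A A') (row_mx B B') = dot A B + dot A' B'.
Proof.
rewrite /dot -big_split; apply: eq_bigr => i _; rewrite big_split_ord /=.
by congr (_ + _); apply: eq_bigr => j _; rewrite ?row_mxEl ?row_mxEr.
Qed.

Lemma fnorm_row_mx p n1 n2 (A : 'M[R]_(p, n1)) (B : 'M[R]_(p, n2)) :
  fnorm (row_mx A B) ^+ 2 = fnorm A ^+ 2 + fnorm B ^+ 2.
Proof. by rewrite !fnorm_sqr dot_row_mx. Qed.

Lemma fnorm_sub_mx p n1 n2 (A : 'M[R]_(p, n1 + n2)) :
  fnorm A ^+ 2 = fnorm (lsubmx A) ^+ 2 + fnorm (rsubmx A) ^+ 2.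
Proof. by rewrite -{1}(hsubmxK A) fnorm_row_mx. Qed.

Lemma fnorm_lsubmx p n1 n2 (A : 'M[R]_(p, n1 + n2)) : fnorm (lsubmx A) <= fnorm A.
Proof.
apply: fnorm_le_sqr; first exact: fnorm_ge0.
by rewrite (fnorm_sub_mx A) lerDl sqr_ge0.
Qed.

Lemma fnorm_rsubmx p n1 n2 (A : 'M[R]_(p, n1 + n2)) : fnorm (rsubmx A) <= fnorm A.
Proof.
apply: fnorm_le_sqr; first exact: fnorm_ge0.
by rewrite (fnorm_sub_mx A) lerDr sqr_ge0.
Qed.

Lemma fnorm_mulmx p n k (A : 'M[R]_(p, n)) (B : 'M[R]_(n, k)) :
  fnorm (A *m B) <= fnorm A * fnorm B.
Proof.
apply: fnorm_le_sqr; first by rewrite mulr_ge0 ?fnorm_ge0.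
rewrite exprMn (fnorm_sum_row A) (fnorm_sum_col B) fnorm_sqr /dot mulr_suml.
apply: ler_sum => i _; rewrite mulr_sumr; apply: ler_sum => j _.
have -> : (A *m B) i j = dot (row i A) (col j B)^T.
  by rewrite mxE /dot big_ord1; apply: eq_bigr => l _; rewrite !mxE.
have -> : fnorm (col j B) ^+ 2 = fnorm (col j B)^T ^+ 2.
  rewrite !fnorm_sqr /dot big_ord1; apply: eq_bigr => l _.
  by rewrite big_ord1 !mxE.
rewrite -expr2 -exprMn -[X in X <= _]real_normK ?num_real//.
by rewrite ler_pXn2r ?nnegrE ?mulr_ge0 ?fnorm_ge0 ?normr_dot_le.
Qed.

(** The supremum defining the spectral norm is over a bounded set because the Frobenius norm is
    submultiplicative. Scaling to the unit ball gives the bound for vectors, and summing squares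
    over the columns of B gives it for matrices. *)
Lemma spectral_norm_mulmx n k (A : 'M[R]_n) (B : 'M[R]_(n, k)) :
  fnorm (A *m B) <= spectral_norm A * fnorm B.
Proof.
pose S := [set fnorm (A *m v) | v in [set v : 'cV[R]_n | fnorm v <= 1]].
have ubS : has_ubound S.
  exists (fnorm A) => _ [v /= v1 <-]; apply: le_trans (fnorm_mulmx _ _) _.
  by rewrite ler_piMr ?fnorm_ge0.
have A0 : 0 <= spectral_norm A.
  by apply: ub_le_sup => //; exists 0 => /=; rewrite ?mulmx0 fnorm0.
have Av (v : 'cV[R]_n) : fnorm (A *m v) <= spectral_norm A * fnorm v.
  have [v0|v0] := eqVneq (fnorm v) 0.
    by rewrite v0 (fnorm_eq0 v0) mulmx0 fnorm0 mulr0.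
  have vp : 0 < fnorm v by rewrite lt_def v0 fnorm_ge0.
  rewrite -ler_pdivrMr//; apply: ub_le_sup => //.
  exists ((fnorm v)^-1 *: v) => /=.
    by rewrite fnormZ normfV ger0_norm ?fnorm_ge0// mulVf.
  by rewrite -scalemxAr fnormZ normfV ger0_norm ?fnorm_ge0// mulrC.
apply: fnorm_le_sqr; first by rewrite mulr_ge0 ?fnorm_ge0.
rewrite exprMn fnorm_sum_col (fnorm_sum_col B) mulr_sumr; apply: ler_sum => j _.
rewrite colE -mulmxA -colE -exprMn ler_pXn2r ?nnegrE ?mulr_ge0 ?fnorm_ge0//.
Qed.

End Blocks.

(** * Averages over agents *)

Section RowMean.
Variables (R : realType) (M n : nat).
Hypothesis M0 : (0 < M)%N.
Implicit Types A B : 'M[R]_(M, n).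

Let MR0 : (M%:R : R) != 0. Proof. by rewrite pnatr_eq0 -lt0n. Qed.

Lemma row_meanE A j : row_mean A 0 j = M%:R^-1 * \sum_(i < M) A i j.
Proof. by rewrite mxE summxE; under eq_bigr do rewrite mxE. Qed.

Lemma avg_mxE A i j : (avg_mx R M *m A) i j = row_mean A 0 j.
Proof. by rewrite row_meanE mxE mulr_sumr; under eq_bigr do rewrite mxE. Qed.

Lemma row_avg_mx A i : row i (avg_mx R M *m A) = row_mean A.
Proof. by apply/rowP => j; rewrite mxE avg_mxE. Qed.

Lemma row_meanD A B : row_mean (A + B) = row_mean A + row_mean B.
Proof.
apply/rowP => j; rewrite [in RHS]mxE !row_meanE -mulrDr -big_split.
by congr (_ * _); apply: eq_bigr => i _; rewrite mxE.
Qed.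

Lemma row_meanZ a A : row_mean (a *: A) = a *: row_mean A.
Proof.
apply/rowP => j; rewrite [in RHS]mxE !row_meanE mulrCA.
by congr (_ * _); rewrite mulr_sumr; apply: eq_bigr => i _; rewrite mxE.
Qed.

Lemma row_meanN A : row_mean (- A) = - row_mean A.
Proof. by rewrite -scaleN1r row_meanZ scaleN1r. Qed.

(** Pythagoras: the averaging matrix is an orthogonal projection, so the deviation from the mean is
    orthogonal to the mean. *)
Lemma fnorm_avg_decomp A :
  fnorm A ^+ 2 = fnorm (A - avg_mx R M *m A) ^+ 2 + M%:R * fnorm (row_mean A) ^+ 2.
Proof.
pose B := avg_mx R M *m A.
have AB : dot A B = M%:R * dot (row_mean A) (row_mean A).
  rewrite /dot big_ord1 mulr_sumr exchange_big; apply: eq_bigr => j _ /=.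
  under eq_bigr do rewrite avg_mxE.
  by rewrite -mulr_suml mulrA {2}row_meanE mulrA divff// mul1r.
have BB : dot B B = M%:R * dot (row_mean A) (row_mean A).
  rewrite /dot big_ord1 mulr_sumr exchange_big; apply: eq_bigr => j _ /=.
  under eq_bigr do rewrite avg_mxE.
  by rewrite sumr_const card_ord mulr_natl.
rewrite -/B; rewrite [fnorm (A - B) ^+ 2]fnorm_sqr !dotDl !dotDr !dotNl !dotNr.
rewrite (dotC B A) AB BB -!fnorm_sqr; lra.
Qed.

Lemma fnorm_row_mean A : fnorm (row_mean A) ^+ 2 <= M%:R^-1 * fnorm A ^+ 2.
Proof.
rewrite [X in _ * X]fnorm_avg_decomp ler_pdivlMl ?ltr0n// lerDr sqr_ge0//.
Qed.

End RowMean.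

Lemma row_mean_row_mx (R : realType) (M n1 n2 : nat) (A : 'M[R]_(M, n1)) (B : 'M[R]_(M, n2)) :
  row_mean (row_mx A B) = row_mx (row_mean A) (row_mean B).
Proof.
apply/rowP => j; rewrite row_meanE mxE; case: splitP => k jk.
  by rewrite row_meanE; congr (_ * _); apply: eq_bigr => i _; rewrite (_ : j = lshift n2 k) ?row_mxEl//; apply/val_inj.
by rewrite row_meanE; congr (_ * _); apply: eq_bigr => i _; rewrite (_ : j = rshift n1 k) ?row_mxEr//; apply/val_inj.
Qed.

Lemma lsubmx_row_mean (R : realType) (M n1 n2 : nat) (A : 'M[R]_(M, n1 + n2)) :
  lsubmx (row_mean A) = row_mean (lsubmx A).
Proof. by rewrite -{1}(hsubmxK A) row_mean_row_mx row_mxKl. Qed.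

Lemma rsubmx_row_mean (R : realType) (M n1 n2 : nat) (A : 'M[R]_(M, n1 + n2)) :
  rsubmx (row_mean A) = row_mean (rsubmx A).
Proof. by rewrite -{1}(hsubmxK A) row_mean_row_mx row_mxKr. Qed.

(** * Mixing matrices contract the consensus error *)

Section Mixing.
Variables (R : realType) (M : nat) (e : rel 'I_M) (rho : R) (W : 'M[R]_M).
Hypotheses (M0 : (0 < M)%N) (mW : mixing_matrix e rho W).

Let MR0 : (M%:R : R) != 0. Proof. by rewrite pnatr_eq0 -lt0n. Qed.

Lemma mixing_rowE i : \sum_j W i j = 1.
Proof.
have /matrixP/(_ i 0) := mixing_row mW; rewrite !mxE => <-.
by apply: eq_bigr => j _; rewrite mxE mulr1.
Qed.

Lemma mixing_colE j : \sum_i W i j = 1.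
Proof.
have /matrixP/(_ j 0) := mixing_col mW; rewrite !mxE => <-.
by apply: eq_bigr => i _; rewrite !mxE mulr1.
Qed.

Lemma mixing_avg : W *m avg_mx R M = avg_mx R M.
Proof.
apply/matrixP => i j; rewrite !mxE; under eq_bigr do rewrite mxE.
by rewrite -mulr_suml mixing_rowE mul1r.
Qed.

Lemma avg_mixing : avg_mx R M *m W = avg_mx R M.
Proof.
apply/matrixP => i j; rewrite !mxE; under eq_bigr do rewrite mxE.
by rewrite -mulr_sumr mixing_colE mulr1.
Qed.

Lemma avg_avg : avg_mx R M *m avg_mx R M = avg_mx R M.
Proof.
apply/matrixP => i j; rewrite !mxE; under eq_bigr do rewrite !mxE.
by rewrite sumr_const card_ord -[LHS]mulr_natl mulrA divff ?mul1r.
Qed.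

Lemma row_mean_mixing n (A : 'M[R]_(M, n)) : row_mean (W *m A) = row_mean A.
Proof.
by rewrite -(row_avg_mx _ (Ordinal M0)) mulmxA avg_mixing row_avg_mx.
Qed.

(** W fixes averages on both sides, so W - Pi annihilates Pi A and may be applied to A - Pi A
    instead of A. Symmetry of W does not enter. *)
Lemma mixing_contract n (A : 'M[R]_(M, n)) :
  fnorm (W *m A - avg_mx R M *m (W *m A)) <= rho * fnorm (A - avg_mx R M *m A).
Proof.
rewrite mulmxA avg_mixing.
have -> : W *m A - avg_mx R M *m A =
    (W - avg_mx R M) *m (A - avg_mx R M *m A).
  by rewrite mulmxBl !mulmxBr !mulmxA mixing_avg avg_avg subrr subr0.
by rewrite (mixing_rho mW) spectral_norm_mulmx.
Qed.

(** W A and A have the same average, so their difference is a difference of deviations, of size at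
    most 1 + rho <= 2 times that of A. *)
Lemma mixing_sub_id n (A : 'M[R]_(M, n)) :
  fnorm (W *m A - A) <= 2 * fnorm (A - avg_mx R M *m A).
Proof.
have := mixing_contract A; rewrite mulmxA avg_mixing => H.
have -> : W *m A - A = (W *m A - avg_mx R M *m A) - (A - avg_mx R M *m A).
  by rewrite opprB addrA subrK.
apply: le_trans (fnormD _ _) _; rewrite fnormN.
have /andP[r0 r1] := mixing_rho01 mW.
have := fnorm_ge0 (A - avg_mx R M *m A); nra.
Qed.

End Mixing.

(** * Gradients and first-order expansions *)

Section Gradient.
Variables (R : realType) (n : nat).
Implicit Types (h : 'rV[R]_n -> R) (z v : 'rV[R]_n).

Lemma derive_grad h z v : differentiable h z -> 'D_v h z = dot (grad h z) v.
Proof.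
move=> dh; rewrite deriveE// {1}(row_sum_delta v) linear_sum /dot big_ord1.
by apply: eq_bigr => j _; rewrite linearZ /= mxE -deriveE// mulrC.
Qed.

Lemma taylor1 h z v : (forall x, differentiable h x) ->
  exists2 s : R, 0 <= s <= 1 & h (z + v) - h z = dot (grad h (z + s *: v)) v.
Proof.
move=> dh; pose f (s : R) := h (z + s *: v).
have df (s : R) : is_derive s 1 f (dot (grad h (z + s *: v)) v).
  have E : (fun t : R => t^-1 *: ((f \o shift s) (t *: 1) - f s)) =
           (fun t : R => t^-1 *: ((h \o shift (z + s *: v)) (t *: v) - h (z + s *: v))).
    apply/funext => t /=; congr (_ *: (h _ - _)).
    by rewrite [t *: 1]mulr1 scalerDl addrCA addrA.
  have dv : derivable h (z + s *: v) v by apply: diff_derivable.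
  apply: DeriveDef; first by rewrite /derivable E.
  by rewrite /derive E -derive_grad.
have [s s01 fE] := MVT (ltr01 : 0 < 1 :> R) (fun x _ => df x)
  (continuous_subspaceT (fun x => differentiable_continuous
    ((derivable1_diffP _ _).1 (@ex_derive _ _ _ _ _ _ _ (df x))))).
exists s; first by move: s01; rewrite in_itv /= => /andP[/ltW -> /ltW ->].
by move: fE; rewrite /f scale1r scale0r addr0 subr0 mulr1.
Qed.

(** The mean value theorem along the segment suffices for the remainder; it gives the constant L
    where integrating along the segment would give L/2. *)
Lemma smooth_bound h (L : R) z v : 0 <= L ->
    (forall x, differentiable h x) -> smooth L h ->
  `|h (z + v) - h z - dot (grad h z) v| <= L * fnorm v ^+ 2.
Proof.
move=> L0 dh sh; have [s /andP[s0 s1] ->] := taylor1 z v dh.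
rewrite -dotNl -dotDl; apply: le_trans (normr_dot_le _ _) _.
rewrite expr2 mulrA ler_wpM2r ?fnorm_ge0//; apply: le_trans (sh _ _) _.
rewrite addrAC subrr add0r ler_wpM2l// fnormZ ger0_norm//.
by rewrite ler_piMl ?fnorm_ge0.
Qed.

(** A quadratic remainder determines the directional derivatives, hence [grad], of a function not
    known in advance to be differentiable. It serves for [Phi]. *)
Lemma smooth_bound_eqgrad h (p v x : 'rV[R]_n) (K : R) :
  (forall u, `|h (x + u) - h x - dot p u| <= K * fnorm u ^+ 2) ->
  'D_v h x = dot p v.
Proof.
move=> hK; apply/cvg_lim => //; apply/cvgrPdist_le => e e0.
have K1 : 0 <= `|K| * fnorm v ^+ 2 by apply: mulr_ge0 => //; exact: sqr_ge0.
have K0 : 0 < `|K| * fnorm v ^+ 2 + 1 by rewrite ltr_wpDl.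
near=> t; have t0 : t != 0 by near: t; exact: nbhs_dnbhs_neq.
have -> : dot p v - t^-1 *: ((h \o shift x) (t *: v) - h x) =
    - t^-1 * (h (x + t *: v) - h x - dot p (t *: v)).
  rewrite /= (addrC (t *: v)) dotZr -[_ *: _]/(_ * _); field; exact: t0.
rewrite normrM normrN normfV ler_pdivrMl ?normr_gt0//.
apply: le_trans (hK _) _; rewrite fnormZ exprMn expr2 -!mulrA mulrCA.
rewrite ler_wpM2l//.
have te : `|t| <= e / (`|K| * fnorm v ^+ 2 + 1).
  near: t; apply: dnbhs0_le; exact: divr_gt0.
move: te; rewrite ler_pdivlMr//.
apply: le_trans; rewrite mulrCA ler_wpM2l//.
apply: (@le_trans _ _ (`|K| * fnorm v ^+ 2)); last by rewrite lerDl.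
by rewrite ler_wpM2r ?sqr_ge0// ler_norm.
Unshelve. all: by end_near. Qed.

End Gradient.

(** * The average inherits differentiability, smoothness and strong concavity *)

Section AverageFunction.
Variables (R : realType) (M n : nat) (f : 'I_M -> 'rV[R]_n -> R).
Hypothesis M0 : (0 < M)%N.
Hypothesis df : forall i z, differentiable (f i) z.

Let avgE : avg_fun f = M%:R^-1 *: \sum_(i < M) f i.
Proof. by apply/funext => z; rewrite /avg_fun /= fct_sumE. Qed.

Lemma differentiable_avg_fun z : differentiable (avg_fun f) z.
Proof.
rewrite avgE; apply: differentiableZ; apply: differentiable_sum => i; exact: df.
Qed.

Lemma grad_avg_fun z : grad (avg_fun f) z = M%:R^-1 *: \sum_(i < M) grad (f i) z.
Proof.
apply/rowP => j; rewrite !mxE summxE avgE.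
rewrite deriveZ; last by apply: diff_derivable; apply: differentiable_sum => i; exact: df.
rewrite derive_sum => [|i]; last exact: diff_derivable.
by congr (_ * _); apply: eq_bigr => i _; rewrite mxE.
Qed.

Lemma smooth_avg_fun (L : R) : (forall i, smooth L (f i)) -> smooth L (avg_fun f).
Proof.
move=> sf z z'; rewrite !grad_avg_fun -scalerBr -sumrB fnormZ.
have M1 : 0 < M%:R^-1 :> R by rewrite invr_gt0 ltr0n.
rewrite ger0_norm ?(ltW M1)// ler_pdivrMl ?ltr0n//.
apply: (@le_trans _ _ (\sum_(i < M) fnorm (grad (f i) z - grad (f i) z'))).
  elim/big_ind2 : _ => [|x1 x2 y1 y2 h1 h2|//]; first by rewrite fnorm0.
  by apply: le_trans (fnormD _ _) _; exact: lerD.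
apply: (@le_trans _ _ (\sum_(i < M) (L * fnorm (z - z')))).
  by apply: ler_sum => i _; exact: sf.
by rewrite sumr_const card_ord mulr_natl.
Qed.

End AverageFunction.

Lemma strongly_concave_avg_fun (R : realType) (M d m : nat) (mu : R)
    (f : 'I_M -> 'rV[R]_(d + m) -> R) (x : 'rV[R]_d) : (0 < M)%N ->
    (forall i, strongly_concave mu (fun y : 'rV[R]_m => f i (row_mx x y))) ->
  strongly_concave mu (fun y : 'rV[R]_m => avg_fun f (row_mx x y)).
Proof.
move=> M0 cf y y' a a01; rewrite /avg_fun.
have M1 : 0 < M%:R :> R by rewrite ltr0n.
rewrite -(ler_pM2l M1) [leRHS]mulrA divff ?gt_eqF// mul1r.
have -> : forall s1 s2 k : R, M%:R * (a * (M%:R^-1 * s1) + (1 - a) * (M%:R^-1 * s2) + k) =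
   a * s1 + (1 - a) * s2 + M%:R * k by move=> *; field; rewrite gt_eqF.
rewrite !mulr_sumr (_ : M%:R * _ = \sum_(i < M) (mu / 2 * (a * (1 - a)) * fnorm (y - y') ^+ 2)).
  by rewrite -!big_split; apply: ler_sum => i _; exact: cf.
by rewrite sumr_const card_ord mulr_natl.
Qed.

(** * The maximizer [ystar] and the gradient of [Phi] *)

(** Arithmetic of the Danskin argument: a1, a2 are the values at x + u and a3, a4 those at x, where
    a1, a4 use the maximizer of x and a2, a3 that of x + u. The linear terms at x are p and p', b is
    the smoothness remainder and k the condition number. *)
Lemma two_sided_bound (R : realType) (a1 a2 a3 a4 p p' k b : R) :
  a1 <= a2 -> a3 <= a4 -> - b <= a1 - a4 - p -> a2 - a3 - p' <= b ->
  p' - p <= k * b -> b <= k * b -> - (2 * (k * b)) <= a2 - a4 - p <= 2 * (k * b).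
Proof. by move=> *; lra. Qed.

Section MaxFunction.
Variables (R : realType) (d m : nat) (F : 'rV[R]_(d + m) -> R) (L mu : R).
Hypotheses (L0 : 0 < L) (mu0 : 0 < mu).
Hypothesis dF : forall z, differentiable F z.
Hypothesis sF : smooth L F.
Hypothesis cF : forall x, strongly_concave mu (fun y : 'rV[R]_m => F (row_mx x y)).

Let gx x y : 'rV[R]_d := lsubmx (grad F (row_mx x y)).
Let gy x y : 'rV[R]_m := rsubmx (grad F (row_mx x y)).

Lemma dot_grad_row_mx x y u v :
  dot (grad F (row_mx x y)) (row_mx u v) = dot (gx x y) u + dot (gy x y) v.
Proof. by rewrite -{1}(hsubmxK (grad F (row_mx x y))) dot_row_mx. Qed.

Let fnorm_row0 (v : 'rV[R]_m) : fnorm (row_mx (0 : 'rV[R]_d) v) = fnorm v.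
Proof.
apply/eqP; rewrite -(eqrXn2 (ltn0Sn 1)) ?fnorm_ge0// fnorm_row_mx.
by rewrite fnorm0 expr0n add0r.
Qed.

Let fnorm_0row (u : 'rV[R]_d) : fnorm (row_mx u (0 : 'rV[R]_m)) = fnorm u.
Proof.
apply/eqP; rewrite -(eqrXn2 (ltn0Sn 1)) ?fnorm_ge0// fnorm_row_mx.
by rewrite fnorm0 expr0n addr0.
Qed.

Lemma smooth_bound_y x y v :
  `|F (row_mx x (y + v)) - F (row_mx x y) - dot (gy x y) v| <= L * fnorm v ^+ 2.
Proof.
have := smooth_bound (row_mx x y) (row_mx 0 v) (ltW L0) dF sF.
by rewrite add_row_mx addr0 dot_grad_row_mx -{1}(scale0r 0) dotZr mul0r add0r fnorm_row0.
Qed.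

Lemma smooth_bound_x x y u :
  `|F (row_mx (x + u) y) - F (row_mx x y) - dot (gx x y) u| <= L * fnorm u ^+ 2.
Proof.
have := smooth_bound (row_mx x y) (row_mx u 0) (ltW L0) dF sF.
by rewrite add_row_mx addr0 dot_grad_row_mx -{1}(scale0r 0) dotZr mul0r addr0 fnorm_0row.
Qed.

(** Concavity between y and y + v with weight a, divided by a, bounds the defect [X] by a multiple
    of a; then a tends to 0. *)
Lemma strongly_concave_grad x y v :
  F (row_mx x (y + v)) <= F (row_mx x y) + dot (gy x y) v - mu / 2 * fnorm v ^+ 2.
Proof.
pose X := F (row_mx x (y + v)) - F (row_mx x y) - dot (gy x y) v + mu / 2 * fnorm v ^+ 2.
pose K := (L + mu / 2) * fnorm v ^+ 2.
have K0 : 0 <= K by rewrite mulr_ge0 ?sqr_ge0// addr_ge0 ?divr_ge0 ?ltW.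
have H (a : R) : 0 < a <= 1 -> X <= a * K.
  move=> /andP[a0 a1].
  have a01 : 0 <= a <= 1 by rewrite ltW.
  have := cF x (y + v) y a01; rewrite [y + v - y]addrAC subrr add0r.
  rewrite (_ : a *: (y + v) + (1 - a) *: y = y + a *: v); last first.
    by rewrite scalerDr scalerBl scale1r addrC addrA subrK.
  have := smooth_bound_y x y (a *: v); rewrite ler_norml dotZr fnormZ exprMn.
  rewrite real_normK ?num_real// => /andP[_ h1] h2.
  rewrite -(ler_pM2l a0) /X /K; lra.
suff : X <= 0 by rewrite /X; lra.
rewrite leNgt; apply/negP => X0.
have XK : 0 < X + K by rewrite ltr_wpDr.
(* For this weight the bound X <= a K reads X (X + K) <= X K, impossible for X > 0. *)
have /H : 0 < X / (X + K) <= 1.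
  by rewrite divr_gt0//= ler_pdivrMr// mul1r lerDl.
by rewrite mulrAC ler_pdivlMr//; nra.
Qed.

Lemma strongly_monotone_grad x y y' :
  dot (gy x y - gy x y') (y - y') <= - mu * fnorm (y - y') ^+ 2.
Proof.
have := strongly_concave_grad x y (y' - y); have := strongly_concave_grad x y' (y - y').
by rewrite !subrKC -(opprB y y') fnormN !dotNr dotDl dotNl; lra.
Qed.

(** Strong monotonicity and the Lipschitz bound are compared along one nonzero direction, which
    exists because m > 0. Hence kappa >= 1. *)
Lemma smooth_ge_strongly_concave : (0 < m)%N -> mu <= L.
Proof.
move=> m0; pose v : 'rV[R]_m := const_mx 1.
have v0 : 0 < fnorm v ^+ 2.
  rewrite lt_def sqr_ge0 andbT sqrf_eq0; apply/eqP => /fnorm_eq0 /rowP /(_ (Ordinal m0)).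
  by rewrite !mxE => /eqP; rewrite oner_eq0.
have := strongly_monotone_grad 0 v 0; rewrite subr0.
set g := _ - _ => h1.
have : fnorm g <= L * fnorm v.
  have := sF (row_mx 0 v) (row_mx 0 0).
  rewrite opp_row_mx add_row_mx !subr0 fnorm_row0 => h2.
  apply: le_trans h2; apply: fnorm_le_sqr; first exact: fnorm_ge0.
  by rewrite [leRHS]fnorm_sub_mx !linearB lerDr sqr_ge0.
have := normr_dot_le g v; rewrite ler_norml => /andP[h3 _] h4.
have : fnorm g * fnorm v <= L * fnorm v ^+ 2.
  by rewrite expr2 mulrA ler_wpM2r ?fnorm_ge0.
move=> h5; rewrite -(ler_pM2r v0); lra.
Qed.

(** Coercivity: once the Euclidean norm of y' reaches r, the quadratic term outweighs the linear one
    and the value is at most that at 0. The compact set is a ball of the max norm, and leaving it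
    forces the larger Euclidean norm above r as well. *)
Lemma maximizer_exists x : exists y, forall y', F (row_mx x y') <= F (row_mx x y).
Proof.
pose r := 2 * fnorm (gy x 0) / mu.
have r0 : 0 <= r by rewrite divr_ge0 ?mulr_ge0 ?fnorm_ge0// ltW.
pose A := [set y : 'rV[R]_m | `|y| <= r].
have A0 : A !=set0 by exists 0; rewrite /A /= normr0.
have cA : compact A.
  apply: bounded_closed_compact.
    by exists r; split; rewrite ?num_real// => s rs y /= /le_trans; apply; exact: ltW.
  apply: (preimage_closed _ (@closed_le R r)) => y _.
  exact: norm_continuous.
have cr : continuous (fun y : 'rV[R]_m => row_mx x y).
  move=> y0; apply/(@cvgrPdist_le R 'rV[R]_(d + m) _ (nbhs y0) _).
  move=> e e0; near=> t; rewrite opp_row_mx add_row_mx subrr.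
  apply: (@le_trans _ _ `|y0 - t|).
    rewrite [leLHS]/Num.norm/= mx_normrE; apply/bigmax_leP; split=> // -[i j] _ /=.
    rewrite mxE; case: splitP => k _; rewrite ?mxE ?normr0// ord1.
    rewrite [leRHS]/Num.norm/= mx_normrE; apply/bigmax_geP; right => /=.
    by exists (0, k) => //=; rewrite !mxE.
  by near: t; apply: cvgr_dist_le.
have cf : {within A, continuous (fun y : 'rV[R]_m => F (row_mx x y))}.
  apply: continuous_subspaceT => y.
  apply: (@continuous_comp _ _ _ (fun y : 'rV[R]_m => row_mx x y) F (y : 'rV[R]_m)).
    exact: cr.
  exact: differentiable_continuous.
have [y _ ymax] := EVT_max_rV A0 cA cf.
exists y => y'; have [Ay'|Ay'] := boolP (`|y'| <= r); first by apply: ymax; rewrite inE.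
apply: (@le_trans _ _ (F (row_mx x 0))); last by apply: ymax; rewrite inE /A /= normr0.
have : r <= fnorm y'.
  apply: (@le_trans _ _ `|y'|); first by rewrite ltW// ltNge.
  rewrite [leLHS]/Num.norm/= mx_normrE; apply/bigmax_leP; split=> [|[i j] _ /=]; first exact: fnorm_ge0.
  rewrite -(@ler_pXn2r _ 2)// ?nnegrE ?fnorm_ge0// fnorm_sqr /dot big_ord1.
  rewrite (bigD1 j)//= real_normK ?num_real// ord1 expr2 lerDl.
  by apply: sumr_ge0 => k _; rewrite -expr2 sqr_ge0.
rewrite /r ler_pdivrMr// => h.
have := strongly_concave_grad x 0 y'; rewrite add0r.
have := dot_fnorm_le (gy x 0) y'; have := fnorm_ge0 y'; nra.
Unshelve. all: by end_near. Qed.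

Lemma ystar_max x y : F (row_mx x y) <= F (row_mx x (ystar F x)).
Proof.
have [y0 y0P] := maximizer_exists x.
exact: (@getPex _ [set y | forall y', F (row_mx x y') <= F (row_mx x y)] (ex_intro _ y0 y0P)).
Qed.

(** A trial ascent step of length 1/(2L) along the partial gradient g would gain at least |g|^2 /
    (4L) over the maximum. *)
Lemma grad_ystar x : rsubmx (grad F (row_mx x (ystar F x))) = 0.
Proof.
apply: fnorm_eq0; apply/eqP; rewrite -sqrf_eq0 eq_le sqr_ge0 andbT.
set g := rsubmx _.
have := smooth_bound_y x (ystar F x) ((2 * L)^-1 *: g).
have := ystar_max x (ystar F x + (2 * L)^-1 *: g).
rewrite ler_norml dotZr fnormZ exprMn real_normK ?num_real// -/g -fnorm_sqr => h1 /andP[h2 _].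
have h3 : L * ((2 * L)^-1 ^+ 2 * fnorm g ^+ 2) = (2 * L)^-1 / 2 * fnorm g ^+ 2.
  by field; rewrite gt_eqF.
have h4 : 0 < (2 * L)^-1 by rewrite invr_gt0 mulr_gt0.
rewrite h3 in h2; rewrite -(ler_pM2l h4) mulr0; lra.
Qed.

Lemma PhiE x : Phi F x = F (row_mx x (ystar F x)).
Proof.
apply/eqP; rewrite eq_le; apply/andP; split.
  by apply: ge_sup => [|_ [y _ <-]]; [exists (F (row_mx x 0)), 0|exact: ystar_max].
apply: ub_le_sup; last by exists (ystar F x).
by exists (F (row_mx x (ystar F x))) => _ [y _ <-]; exact: ystar_max.
Qed.

(** Strong monotonicity at x between the two maximizers: one partial gradient vanishes there, and
    the other is a difference between x and x' at the same y, of size at most L |x - x'|. *)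
Lemma ystar_lipschitz x x' :
  fnorm (ystar F x - ystar F x') <= L / mu * fnorm (x - x').
Proof.
set y := ystar F x; set y' := ystar F x'.
have [h0|h0] := eqVneq (fnorm (y - y')) 0.
  by rewrite h0 mulr_ge0 ?fnorm_ge0// divr_ge0 ?ltW.
have yp : 0 < fnorm (y - y') by rewrite lt_def h0 fnorm_ge0.
have := strongly_monotone_grad x y y'.
rewrite /gy grad_ystar sub0r -(subr0 (rsubmx _)) -(grad_ystar x').
have := sF (row_mx x y') (row_mx x' y').
rewrite opp_row_mx add_row_mx subrr fnorm_0row => h1.
set g := _ - _; have gL : fnorm g <= L * fnorm (x - x').
  apply: le_trans h1; apply: fnorm_le_sqr; first exact: fnorm_ge0.
  by rewrite [leRHS]fnorm_sub_mx !linearB lerDr sqr_ge0.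
rewrite dotNl mulNr lerN2 => h2; have h3 := dot_fnorm_le g (y - y').
rewrite mulrAC ler_pdivlMr// mulrC; apply: le_trans gL.
by rewrite -(ler_pM2r yp) -mulrA -expr2; apply: le_trans h3.
Qed.

(** The cross term contributes -2 mu eta and the quadratic term eta^2 L^2, of which the step-size
    condition leaves at most mu eta. *)
Lemma gradient_ascent_contraction (eta : R) x y : 0 < eta -> L ^+ 2 * eta <= mu ->
  fnorm (y + eta *: rsubmx (grad F (row_mx x y)) - ystar F x) ^+ 2 <=
    (1 - mu * eta) * fnorm (y - ystar F x) ^+ 2.
Proof.
move=> eta0 etaL; have := strongly_monotone_grad x y (ystar F x).
rewrite /gy grad_ystar subr0; set h := rsubmx (grad F (row_mx x y)) => mono.
have hL : fnorm h ^+ 2 <= L ^+ 2 * fnorm (y - ystar F x) ^+ 2.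
  rewrite -exprMn ler_pXn2r ?nnegrE ?mulr_ge0 ?fnorm_ge0 ?(ltW L0)//.
  have := sF (row_mx x y) (row_mx x (ystar F x)).
  rewrite opp_row_mx add_row_mx subrr fnorm_row0; apply: le_trans.
  by rewrite /h -[rsubmx _]subr0 -(grad_ystar x) -linearB /= fnorm_rsubmx.
move: (ystar F x) mono hL => ys mono hL.
rewrite -addrA addrCA fnormZD_sqr (dotC (y - ys) h).
move: (fnorm_ge0 (y - ys)) (fnorm_ge0 h) mono hL.
move: (dot h _) (fnorm h) (fnorm (y - ys)) => p x1 x2 x20 x10 mono hL.
have h1 := ler_wpM2l (ltW eta0) mono.
have h2 := ler_wpM2l (sqr_ge0 eta) hL.
have h3 : eta * (L ^+ 2 * eta * x2 ^+ 2) <= eta * (mu * x2 ^+ 2).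
  by rewrite ler_pM2l// ler_wpM2r ?sqr_ge0.
by lra.
Qed.

Hypothesis muL : mu <= L.

(* Danskin's theorem in quantitative form: compare F at the maximizers of both
   endpoints. *)
Lemma Phi_bound x u :
  `|Phi F (x + u) - Phi F x - dot (gx x (ystar F x)) u| <=
    2 * (L / mu) * L * fnorm u ^+ 2.
Proof.
have k1 : 1 <= L / mu by rewrite ler_pdivlMr ?mul1r.
rewrite !PhiE; move: (ystar_max x) (ystar_max (x + u)) (ystar_lipschitz (x + u) x).
move: (ystar F x) (ystar F (x + u)) => y y' ymax ymax' ylip.
have u2 : 0 <= L * fnorm u ^+ 2 by rewrite mulr_ge0 ?sqr_ge0 ?ltW.
have -> : 2 * (L / mu) * L * fnorm u ^+ 2 = 2 * (L / mu) * (L * fnorm u ^+ 2) by ring.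
have h1 := ymax' y; have h2 := ymax y'.
have := smooth_bound_x x y u; rewrite ler_norml => /andP[h3 _].
have := smooth_bound_x x y' u; rewrite ler_norml => /andP[_ h4].
have h5 : dot (gx x y' - gx x y) u <= L / mu * (L * fnorm u ^+ 2).
  apply: le_trans (dot_fnorm_le _ _) _.
  have -> : L / mu * (L * fnorm u ^+ 2) = (L * (L / mu * fnorm u)) * fnorm u by ring.
  rewrite ler_wpM2r ?fnorm_ge0//.
  have := sF (row_mx x y') (row_mx x y).
  rewrite opp_row_mx add_row_mx subrr fnorm_row0 => h.
  apply: (@le_trans _ _ (L * fnorm (y' - y))).
    apply: le_trans h; apply: fnorm_le_sqr; first exact: fnorm_ge0.
    by rewrite [leRHS]fnorm_sub_mx !linearB lerDl sqr_ge0.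
  rewrite ler_wpM2l ?(ltW L0)//; move: ylip.
  by rewrite [x + u - x]addrAC subrr add0r.
rewrite dotDl dotNl in h5.
have h6 : L * fnorm u ^+ 2 <= L / mu * (L * fnorm u ^+ 2) by rewrite ler_peMl.
rewrite ler_norml -mulrA; exact: two_sided_bound h1 h2 h3 h4 h5 h6.
Qed.

(** [Phi_bound] is a first-order expansion of [Phi] with quadratic remainder, so it identifies every
    partial derivative. *)
Lemma grad_Phi x : grad (Phi F) x = lsubmx (grad F (row_mx x (ystar F x))).
Proof.
apply/rowP => j; rewrite mxE (smooth_bound_eqgrad _ (Phi_bound x)) /dot big_ord1.
rewrite (bigD1 j)//= big1 => [|k kj]; last by rewrite !mxE (negbTE kj) andbF mulr0.
by rewrite [delta_mx _ _ _ _]mxE !eqxx mulr1 addr0.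
Qed.

End MaxFunction.

(** * Summing the coupled recursions along one trajectory *)

(** Elimination of the scaled sums. Without the terms carrying q, the bound on G contributes 63 E (3
    directly, 60 through Dl), and 130 Dz contributes 1040 Ia through 8 A. Every return to Dz or X
    carries q, so the slack in 65 and 2000 and the term (1 - 4q) X absorb it. *)
Lemma pathwise_linear (R : realType) (A B Dz Dl E G X Y Ia Ib Id Ip : R) :
  let q := 1000^-1 * 1000^-1 in
  0 <= E -> 0 <= A -> 0 <= Dz -> 0 <= Dl -> 0 <= B -> 0 <= X ->
  0 <= Ia -> 0 <= Ib -> 0 <= Id ->
  B <= q * (Ib + 3 * (2 * E + Dz)) -> A <= Ia + B ->
  Dz <= 8 * A + 2 * B + 2 * (q * X + Y) -> Y <= q * (3 * (Dl + A + E)) ->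
  G + (1 - 4 * q) * X <= 2 * Ip + 3 * (Dl + A + E) ->
  Dl <= 4 * Id + 20 * (A + E) + 20 * q * X ->
  G + 130 * Dz <= 2 * Ip + 2000 * (Id + Ia + Ib) + 65 * E.
Proof. move=> q; rewrite /q => *; lra. Qed.

Section PathwiseInequality.
Variable R : realType.

(** The left sum has one term more than the right one. This is what [b] requires: its forcing at
    step t contains [ep t.+1], which must stay within the range of summation. *)
Lemma sum_contraction (r : R) (x y : nat -> R) T : 0 <= r <= 1 ->
    (forall t, 0 <= x t) -> (forall t, x t.+1 <= (1 - r) * x t + y t) ->
  r * \sum_(t < T.+1) x t <= x 0%N + \sum_(t < T) y t.
Proof.
move=> /andP[r0 r1] x0 xS.
(* The last term, kept with weight 1 - r, makes the induction close. *)
suff : r * \sum_(t < T.+1) x t + (1 - r) * x T <= x 0%N + \sum_(t < T) y t.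
  by apply: le_trans; rewrite lerDl mulr_ge0// subr_ge0.
elim: T => [|T IH]; first by rewrite big_ord_recr !big_ord0 /=; lra.
rewrite big_ord_recr [X in _ <= _ + X]big_ord_recr /=.
by have := xS T; rewrite mulrDr; lra.
Qed.

Lemma sum_contraction_lt (r : R) (x y : nat -> R) T : 0 <= r <= 1 ->
    (forall t, 0 <= x t) -> (forall t, 0 <= y t) ->
    (forall t, x t.+1 <= (1 - r) * x t + y t) ->
  r * \sum_(t < T) x t <= x 0%N + \sum_(t < T) y t.
Proof.
move=> r01 x0 y0 xS; case: T => [|T].
  by rewrite !big_ord0 mulr0 addr0.
apply: le_trans (sum_contraction T r01 x0 xS) _.
by rewrite lerD2l [leRHS]big_ord_recr /= lerDl.
Qed.

Variables (r L mu eta etax : R) (a b ep dz gx gy dl g ph : nat -> R).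
Let kappa := L / mu.
Variable c : R.
Hypothesis cE : c = 1000^-1.
Hypotheses (r01 : 0 < r <= 1) (mu0 : 0 < mu) (muL : mu <= L).
Hypotheses (eta0 : 0 < eta) (etax0 : 0 < etax).
Hypotheses (eta_r : L * eta <= c * r ^+ 2) (eta_kappa : L * kappa * eta <= c).
Hypothesis etax_eta : kappa ^+ 2 * etax <= c * eta.
Hypotheses (a0 : forall t, 0 <= a t) (b0 : forall t, 0 <= b t).
Hypotheses (ep0 : forall t, 0 <= ep t) (dz0 : forall t, 0 <= dz t).
Hypotheses (gx0 : forall t, 0 <= gx t) (gy0 : forall t, 0 <= gy t).
Hypotheses (dl0 : forall t, 0 <= dl t).
Hypothesis step_b : forall t, b t.+1 <= (1 - r) * b t +
  r^-1 * (3 * (ep t.+1 + ep t + L ^+ 2 * dz t)).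
Hypothesis step_a : forall t, a t.+1 <= (1 - r) * a t + r^-1 * (eta ^+ 2 * b t).
Hypothesis bound_dz : forall t,
  dz t <= 8 * a t + 2 * eta ^+ 2 * b t + 2 * (etax ^+ 2 * gx t + eta ^+ 2 * gy t).
Hypothesis bound_gy : forall t,
  gy t <= 3 * (L ^+ 2 * dl t + L ^+ 2 * a t + ep t).
Hypothesis step_ph : forall t, ph t.+1 <= ph t - etax / 2 * g t - etax / 2 * gx t +
  etax / 2 * (3 * (L ^+ 2 * dl t + L ^+ 2 * a t + ep t)) +
  2 * kappa * L * etax ^+ 2 * gx t.
Hypothesis step_dl : forall t, dl t.+1 <= (1 - mu * eta / 4) * dl t +
  (5 * (eta / mu) * (L ^+ 2 * a t + ep t) +
   5 * (kappa ^+ 2 / (mu * eta)) * etax ^+ 2 * gx t).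

(** Each recursion is summed separately, the sums are rescaled by kappa, L and the stepsizes, and
    the resulting linear system is handed to [pathwise_linear]. The three stepsize conditions enter
    only through u, p and L kappa eta, each at most c, whose squares are at most q. *)
Lemma pathwise_inequality T :
  \sum_(t < T) g t + 130 * kappa ^+ 2 * L ^+ 2 * \sum_(t < T) dz t <=
  2 * ((ph 0%N - ph T) / etax) + 2000 * (L ^+ 2 / (mu * eta) * dl 0%N +
          kappa ^+ 2 * L ^+ 2 / r * a 0%N + kappa ^+ 2 * b 0%N) +
  65 * kappa ^+ 2 * \sum_(t < T) ep t.
Proof.
have /andP[r0 r1] := r01.
have L0 : 0 < L by apply: lt_le_trans muL.
have k1 : 1 <= kappa by rewrite /kappa ler_pdivlMr// mul1r.
have k0 : 0 < kappa by apply: lt_le_trans k1.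
have k21 : 1 <= kappa ^+ 2 by rewrite expr_ge1// ltW.
have c0 : 0 < c by rewrite cE; lra.
have c1 : c <= 1 by rewrite cE; lra.
pose q := c ^+ 2.
have qE : q = 1000^-1 * 1000^-1 by rewrite /q cE.
have q0 : 0 <= q by apply: sqr_ge0.
have mueta : mu * eta <= c.
  apply: (@le_trans _ _ (L * eta)); first by rewrite ler_pM2r.
  by apply: le_trans eta_r _; rewrite ger_pMr// expr_le1// ltW.
have mueta0 : 0 < mu * eta by rewrite mulr_gt0.
(* normalized stepsizes: eta = u r^2 / L, etax = p eta / kappa^2 *)
set u := L * eta / r ^+ 2; set p := kappa ^+ 2 * etax / eta.
have u0 : 0 <= u by rewrite /u divr_ge0 ?sqr_ge0// mulr_ge0 ?ltW.
have uc : u <= c by rewrite /u ler_pdivrMr// exprn_gt0.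
have p0 : 0 <= p by rewrite /p divr_ge0 ?(ltW eta0)// mulr_ge0 ?sqr_ge0// ltW.
have pc : p <= c by rewrite /p ler_pdivrMr.
have sq (x : R) : 0 <= x -> x <= c -> x ^+ 2 <= q.
  by move=> x0 xc; rewrite ler_pXn2r ?nnegrE// ltW.
have u2 := sq _ u0 uc; have p2 := sq _ p0 pc.
have w2 : (L * kappa * eta) ^+ 2 <= q.
  by apply: sq => //; rewrite mulr_ge0 ?(ltW eta0)// mulr_ge0 ?ltW.
pose Ib := kappa ^+ 2 * b 0%N; pose Ia := kappa ^+ 2 * L ^+ 2 / r * a 0%N.
pose Id := L ^+ 2 / (mu * eta) * dl 0%N.
have k2 : 0 <= kappa ^+ 2 by apply: sqr_ge0.
have Ib0 : 0 <= Ib by rewrite mulr_ge0.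
have Ia0 : 0 <= Ia by rewrite mulr_ge0// divr_ge0 ?(ltW r0)// mulr_ge0 ?sqr_ge0.
have Id0 : 0 <= Id by rewrite mulr_ge0// divr_ge0 ?sqr_ge0 ?ltW.
(* The empty sum is treated apart because the summed recursion for [b] runs over a successor number
   of terms. *)
case: T => [|T].
  rewrite !big_ord0 subrr mul0r !mulr0 -/Ia -/Ib -/Id; clearbody Ia Ib Id; lra.
set N := T.+1.
set SG := \sum_(t < N) g t; set SD := \sum_(t < N) dz t.
set SE := \sum_(t < N) ep t.
pose SA := \sum_(t < N) a t; pose SB := \sum_(t < N) b t.
pose X := \sum_(t < N) gx t; pose SY := \sum_(t < N) gy t.
pose SL := \sum_(t < N) dl t.
have SA0 : 0 <= SA by apply: sumr_ge0 => i _; exact: a0.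
have SB0 : 0 <= SB by apply: sumr_ge0 => i _; exact: b0.
have SE0 : 0 <= SE by apply: sumr_ge0 => i _; exact: ep0.
have SD0 : 0 <= SD by apply: sumr_ge0 => i _; exact: dz0.
have SY0 : 0 <= SY by apply: sumr_ge0 => i _; exact: gy0.
have SL0 : 0 <= SL by apply: sumr_ge0 => i _; exact: dl0.
have X0 : 0 <= X by apply: sumr_ge0 => i _; exact: gx0.
have H1 : r * SB <= b 0%N + r^-1 * (3 * (2 * SE + L ^+ 2 * SD)).
  have r01' : 0 <= r <= 1 by rewrite ltW.
  have := sum_contraction T r01' b0 step_b; rewrite -/SB => /le_trans; apply.
  rewrite lerD2l -mulr_sumr ler_wpM2l ?invr_ge0 ?(ltW r0)//.
  rewrite -mulr_sumr ler_wpM2l// !big_split /=.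
  have -> : 2 * SE = SE + SE by ring.
  (* The shifted sum of [ep] misses its first term, the unshifted one and the sum of [dz] their
     last. *)
  apply: lerD; [apply: lerD|].
  - by rewrite [leRHS]big_ord_recl /= lerDr.
  - by rewrite [leRHS]big_ord_recr /= lerDl.
  - by rewrite /SD mulr_sumr [leRHS]big_ord_recr /= lerDl mulr_ge0 ?sqr_ge0.
have H2 : r * SA <= a 0%N + r^-1 * (eta ^+ 2 * SB).
  have r01' : 0 <= r <= 1 by rewrite ltW.
  have := sum_contraction_lt N r01' a0 _ step_a.
  rewrite -!mulr_sumr; apply => t.
  by rewrite mulr_ge0 ?invr_ge0 ?(ltW r0)// mulr_ge0 ?sqr_ge0.
have H3 : SD <= 8 * SA + 2 * eta ^+ 2 * SB + 2 * (etax ^+ 2 * X + eta ^+ 2 * SY).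
  rewrite /SA /SB /X /SY !mulr_sumr -!big_split mulr_sumr -big_split /=.
  by apply: ler_sum => i _; exact: bound_dz.
have H4 : SY <= 3 * (L ^+ 2 * SL + L ^+ 2 * SA + SE).
  rewrite /SL /SA /SE !mulr_sumr -!big_split mulr_sumr.
  by apply: ler_sum => i _; exact: bound_gy.
have H5 : etax / 2 * SG + (etax / 2 - 2 * kappa * L * etax ^+ 2) * X <=
    ph 0%N - ph N + etax / 2 * (3 * (L ^+ 2 * SL + L ^+ 2 * SA + SE)).
  rewrite /SG /X /SL /SA /SE; elim: (N) => [|n IH].
    by rewrite !big_ord0 !mulr0 subrr !addr0 !mulr0.
  by rewrite !big_ord_recr /=; have := step_ph n; lra.
have H6 : mu * eta / 4 * SL <= dl 0%N + (5 * (eta / mu) * (L ^+ 2 * SA + SE) +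
   5 * (kappa ^+ 2 / (mu * eta)) * etax ^+ 2 * X).
  have m01 : 0 <= mu * eta / 4 <= 1 by have := le_trans mueta c1; lra.
  have := sum_contraction_lt N m01 dl0 _ step_dl.
  rewrite big_split -!mulr_sumr big_split -!mulr_sumr; apply => t.
  rewrite addr_ge0// !mulr_ge0 ?invr_ge0 ?addr_ge0 ?mulr_ge0 ?sqr_ge0//; exact: ltW.
(* The scaling of B is the forcing that b exerts on the scaled sum of a: with L eta = u r^2 it
   equals kappa^2 (L eta)^2 / r^2 times [SB]. *)
pose E := kappa ^+ 2 * SE; pose A := kappa ^+ 2 * (L ^+ 2 * SA).
pose Dz := kappa ^+ 2 * L ^+ 2 * SD; pose B := kappa ^+ 2 * u ^+ 2 * r ^+ 2 * SB.
pose Dl := L ^+ 2 * SL.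
pose Ip := (ph 0%N - ph N) / etax.
have E0 : 0 <= E by rewrite mulr_ge0.
have A0 : 0 <= A by rewrite mulr_ge0// mulr_ge0 ?sqr_ge0.
have Dz0 : 0 <= Dz by rewrite mulr_ge0// mulr_ge0 ?sqr_ge0.
have Dl0 : 0 <= Dl by rewrite mulr_ge0 ?sqr_ge0.
have B0 : 0 <= B by rewrite mulr_ge0// mulr_ge0 ?sqr_ge0// mulr_ge0 ?sqr_ge0.
have etaE : L * eta = u * r ^+ 2 by rewrite /u divfK// sqrf_eq0 gt_eqF.
have J1 : B <= q * (Ib + 3 * (2 * E + Dz)).
  have : B <= u ^+ 2 * (r * Ib + 3 * (2 * E + Dz)).
    have /(ler_wpM2l (ltW r0)) := H1; rewrite mulrDr mulVKf ?gt_eqF//.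
    move=> /(ler_wpM2l (mulr_ge0 k2 (sqr_ge0 u))) /le_trans H.
    apply: le_trans (H _ _); first by rewrite le_eqVlt; apply/orP; left; apply/eqP; rewrite /B; ring.
    by rewrite le_eqVlt; apply/orP; left; apply/eqP; rewrite /E /Dz /Ib; ring.
  move/le_trans; apply; apply: ler_pM => //; first exact: sqr_ge0.
    by apply: addr_ge0; [exact: mulr_ge0 (ltW r0) Ib0 | rewrite mulr_ge0 ?ler0n// addr_ge0// mulr_ge0 ?ler0n].
  by rewrite lerD2r ler_piMl.
have J2 : A <= Ia + B.
  have /(ler_wpM2l (mulr_ge0 k2 (sqr_ge0 L))) H := H2.
  rewrite -(ler_pM2l r0); move: H => /le_trans H.
  apply: le_trans (H _ _); first by rewrite le_eqVlt; apply/orP; left; apply/eqP; rewrite /A; ring.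
  rewrite le_eqVlt; apply/orP; left; apply/eqP; rewrite /Ia /B.
  have -> : kappa ^+ 2 * L ^+ 2 * (a 0%N + r^-1 * (eta ^+ 2 * SB)) =
    kappa ^+ 2 * L ^+ 2 * a 0%N + kappa ^+ 2 * (L * eta) ^+ 2 * r^-1 * SB by ring.
  by rewrite etaE; field; rewrite gt_eqF.
have J4 : kappa ^+ 2 * L ^+ 2 * eta ^+ 2 * SY <= q * (3 * (Dl + A + E)).
  have -> : kappa ^+ 2 * L ^+ 2 * eta ^+ 2 = (L * kappa * eta) ^+ 2 by ring.
  apply: ler_pM => //; first exact: sqr_ge0.
  apply: le_trans H4 _; rewrite ler_wpM2l// /Dl /A /E.
  by rewrite -!addrA lerD2l lerD// ler_peMl// mulr_ge0// sqr_ge0.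
have etaxE : etax = p * eta / kappa ^+ 2.
  by rewrite /p; field; rewrite !gt_eqF.
have ki1 : (kappa ^+ 2)^-1 <= 1 by rewrite invf_le1 ?exprn_gt0// expr_ge1// ltW.
have ki0 : 0 <= (kappa ^+ 2)^-1 by rewrite invr_ge0.
have pk0 : 0 <= p / kappa ^+ 2 by rewrite mulr_ge0.
have pkc : p / kappa ^+ 2 <= c by rewrite -[leRHS]mulr1; apply: ler_pM.
have pk1 : p / kappa ^+ 2 <= 1 by apply: le_trans c1.
have J3 : Dz <= 8 * A + 2 * B + 2 * (q * X +
    kappa ^+ 2 * L ^+ 2 * eta ^+ 2 * SY).
  have /(ler_wpM2l (mulr_ge0 k2 (sqr_ge0 L))) := H3; rewrite -/Dz => /le_trans; apply.
  have -> : kappa ^+ 2 * L ^+ 2 * (8 * SA + 2 * eta ^+ 2 * SB +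
      2 * (etax ^+ 2 * X + eta ^+ 2 * SY)) = 8 * A + 2 * (kappa ^+ 2 * (L * eta) ^+ 2 * SB) +
      2 * ((kappa * L * etax) ^+ 2 * X + kappa ^+ 2 * L ^+ 2 * eta ^+ 2 * SY).
    by rewrite /A; ring.
  apply: lerD; [rewrite lerD2l ler_wpM2l// | rewrite ler_wpM2l// lerD2r].
    rewrite etaE; have -> : kappa ^+ 2 * (u * r ^+ 2) ^+ 2 * SB = r ^+ 2 * B by rewrite /B; ring.
    by rewrite ler_piMl// expr_le1// ltW.
  rewrite ler_wpM2r//; have -> : (kappa * L * etax) ^+ 2 = (L * kappa * eta) ^+ 2 * (p / kappa ^+ 2) ^+ 2.
    by rewrite etaxE; ring.
  by rewrite -[leRHS]mulr1; apply: ler_pM; rewrite ?sqr_ge0// expr_le1.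
have J6 : Dl <= 4 * Id + 20 * (A + E) + 20 * q * X.
  have H7 : 0 <= 4 * L ^+ 2 / (mu * eta) by rewrite divr_ge0 ?mulr_ge0 ?sqr_ge0// ltW.
  have /(ler_wpM2l H7) H := H6; move: H.
  have -> : 4 * L ^+ 2 / (mu * eta) * (mu * eta / 4 * SL) = Dl.
    by rewrite /Dl; field; rewrite !gt_eqF.
  move=> /le_trans; apply.
  have -> : 4 * L ^+ 2 / (mu * eta) * (dl 0%N +
    (5 * (eta / mu) * (L ^+ 2 * SA + SE) + 5 * (kappa ^+ 2 / (mu * eta)) * etax ^+ 2 * X)) =
    4 * Id + 20 * (A + E) + 20 * (p ^+ 2 * X).
    by rewrite /Id /A /E /p /kappa; field; rewrite !gt_eqF.
  by rewrite lerD2l -mulrA ler_wpM2l// ler_wpM2r.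
have J5 : SG + (1 - 4 * q) * X <= 2 * Ip + 3 * (Dl + A + E).
  have H7 : 0 <= 2 / etax by rewrite divr_ge0// ltW.
  have /(ler_wpM2l H7) H := H5; move: H.
  have -> : 2 / etax * (etax / 2 * SG + (etax / 2 - 2 * kappa * L * etax ^+ 2) * X) =
     SG + (1 - 4 * (kappa * L * etax)) * X by field; rewrite gt_eqF.
  have -> : 2 / etax * (ph 0%N - ph N + etax / 2 * (3 * (L ^+ 2 * SL + L ^+ 2 * SA + SE))) =
     2 * Ip + 3 * (L ^+ 2 * SL + (L ^+ 2 * SA + SE)).
    by rewrite /Ip; field; rewrite gt_eqF.
  move=> H; apply: (@le_trans _ _ (SG + (1 - 4 * (kappa * L * etax)) * X)).
    rewrite lerD2l ler_wpM2r// lerD2l lerN2 ler_wpM2l//.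
    have -> : kappa * L * etax = (L * kappa * eta) * (p / kappa ^+ 2).
      by rewrite {1}etaxE; ring.
    have -> : q = c * c by [].
    by apply: ler_pM => //; rewrite mulr_ge0 ?(ltW eta0)// mulr_ge0 ?ltW.
  apply: le_trans H _; rewrite lerD2l ler_wpM2l//.
  rewrite -addrA lerD2l /A /E -mulrDr ler_peMl//.
  by rewrite addr_ge0// mulr_ge0// sqr_ge0.
rewrite -/SG -/Ip -/Id -/Ia -/Ib.
have -> : 130 * kappa ^+ 2 * L ^+ 2 * SD = 130 * Dz by rewrite /Dz; ring.
have -> : 65 * kappa ^+ 2 * SE = 65 * E by rewrite /E; ring.
rewrite qE in J1 J3 J4 J5 J6.
exact: pathwise_linear J1 J2 J3 J4 J5 J6.
Qed.
End PathwiseInequality.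

(** * Lower integrals of nonnegative functions *)

Section LowerIntegral.
Local Open Scope ereal_scope.
Context d (T : measurableType d) (R : realType) (mu : {measure set T -> \bar R}).
Import HBNNSimple.

(* The integral of a nonnegative function is its lower integral, whether or not
   the function is measurable: the measurability of [w |-> grad Phi (xbar w)] is
   never needed. *)
Lemma le_integral_ge0 (f g : T -> \bar R) : (forall x, 0 <= f x) ->
  (forall x, f x <= g x) -> \int[mu]_x f x <= \int[mu]_x g x.
Proof.
move=> f0 fg; have g0 x : 0 <= g x by apply: le_trans (fg x).
rewrite !ge0_integralTE//; apply: le_ereal_sup => _ [h /= hf <-].
by exists h => // x; apply: le_trans (fg x).
Qed.

(** A simple function below f plus one below g lies below f + g. Only this half of additivity is
    available without measurability, and it is the half needed for sums on the smaller side of an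
    inequality. *)
Lemma le_integralD (f g : T -> \bar R) : (forall x, 0 <= f x) ->
  (forall x, 0 <= g x) ->
  \int[mu]_x f x + \int[mu]_x g x <= \int[mu]_x (f x + g x).
Proof.
move=> f0 g0; pose N (h : T -> \bar R) := ereal_sup [set sintegral mu k |
  k in [set k : {nnsfun T >-> R} | forall x, (k x)%:E <= h x]].
have NE h : (forall x, 0 <= h x) -> \int[mu]_x h x = N h.
  by move=> h0; rewrite ge0_integralTE.
have fg0 x : 0 <= f x + g x by exact: adde_ge0.
rewrite !NE//; set I := N (fun x => f x + g x).
have fg (h1 h2 : {nnsfun T >-> R}) : (forall x, (h1 x)%:E <= f x) ->
    (forall x, (h2 x)%:E <= g x) -> sintegral mu h1 + sintegral mu h2 <= I.
  move=> h1f h2g; rewrite -sintegralD.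
  apply: ereal_sup_ubound; exists (add_nnsfun h1 h2) => //= x.
  by rewrite EFinD leeD.
(* Below, integrals are moved across the inequality by subtraction, which requires finite values. *)
have [->|Ioo] := eqVneq I +oo; first exact: leey.
have I0 : 0 <= I.
  by apply: ereal_sup_ubound; exists nnsfun0 => [x /=|]; [exact: adde_ge0|exact: sintegral0].
have Ifin : I \is a fin_num by rewrite ge0_fin_numE// lt_neqAle Ioo leey.
have step (h2 : {nnsfun T >-> R}) : (forall x, (h2 x)%:E <= g x) ->
    sintegral mu h2 \is a fin_num.
  move=> h2g; rewrite ge0_fin_numE ?sintegral_ge0//.
  apply: (@le_lt_trans _ _ I); last by rewrite -ge0_fin_numE.
  rewrite -[leLHS]add0e -(sintegral0 mu); exact: (fg nnsfun0 h2).
have H (h2 : {nnsfun T >-> R}) : (forall x, (h2 x)%:E <= g x) ->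
    N f <= I - sintegral mu h2.
  move=> h2g; apply: ge_ereal_sup => _ [h1 /= h1f <-].
  by rewrite leeBrDr ?step//; exact: fg.
have nf : N f \is a fin_num.
  rewrite ge0_fin_numE; last first.
    by apply: ereal_sup_ubound; exists nnsfun0 => //; exact: sintegral0.
  apply: (@le_lt_trans _ _ I); last by rewrite -ge0_fin_numE.
  by have := H nnsfun0 g0; rewrite sintegral0 sube0.
rewrite addeC -leeBrDr//; apply: ge_ereal_sup => _ [h2 /= h2g <-].
by rewrite leeBrDr// addeC -leeBrDr ?step//; exact: H.
Qed.

Lemma le_integral_sum n (f : 'I_n -> T -> \bar R) : (forall i x, 0 <= f i x) ->
  \sum_(i < n) \int[mu]_x f i x <= \int[mu]_x (\sum_(i < n) f i x).
Proof.
elim: n f => [f _|n IH f f0].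
  by rewrite big_ord0 integral_ge0// => x _; rewrite big_ord0.
rewrite big_ord_recr /=; under [leRHS]eq_integral do rewrite big_ord_recr /=.
apply: le_trans (le_integralD _ _) => //; first by rewrite leeD2r// IH.
by move=> x; exact: sume_ge0.
Qed.

End LowerIntegral.

(** * Independence: freezing the past *)

Section Freezing.
Local Open Scope ereal_scope.
Context (R : realType) dO dT dX (Omega : measurableType dO) (T : measurableType dT)
  (Xi : measurableType dX) (P : probability Omega R) (Q : probability Xi R).
Variables (U : Omega -> T) (xi : Omega -> Xi).
Hypotheses (mU : measurable_fun setT U) (mxi : measurable_fun setT xi).
Hypothesis xi_law : forall B, measurable B -> P (xi @^-1` B) = Q B.
Hypothesis indep : forall A B, measurable A -> measurable B ->
  P (U @^-1` A `&` xi @^-1` B) = P (U @^-1` A) * P (xi @^-1` B).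

(** Independence makes the joint law of (U, xi) the product of their laws, since both agree on
    rectangles; Tonelli then integrates the sample out first. This replaces conditioning on U. *)
Lemma integral_freeze (phi : (T * Xi)%type -> \bar R) :
  measurable_fun [set: (T * Xi)%type] phi -> (forall p, 0 <= phi p) ->
  \int[P]_w phi (U w, xi w) = \int[P]_w (\int[Q]_s phi (U w, s)).
Proof.
move=> mphi phi0.
pose mU' := HB.pack_for {mfun Omega >-> T} U (isMeasurableFun.Build _ _ _ _ _ mU).
pose J w := (U w, xi w).
have mJ : measurable_fun setT J by exact: measurable_fun_pair.
pose mJ' := HB.pack_for {mfun Omega >-> (T * Xi)%type} J (isMeasurableFun.Build _ _ _ _ _ mJ).
have -> : \int[P]_w phi (U w, xi w) = \int[distribution P mJ']_p phi p.
  by rewrite ge0_integral_distribution.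
have -> : \int[distribution P mJ']_p phi p = \int[distribution P mU' \x Q]_p phi p.
  apply: eq_measure_integral => A mA _; apply/esym.
  apply: product_measure_unique => // A1 A2 mA1 mA2.
  by rewrite /distribution /pushforward /= -xi_law// -indep.
rewrite fubini_tonelli1// ge0_integral_distribution//.
  exact: measurable_fun_fubini_tonelli_F.
by move=> u; apply: integral_ge0.
Qed.

End Freezing.

Section IndependentPast.
Local Open Scope ereal_scope.
Context (R : realType) dO (Omega : measurableType dO) (P : probability Omega R).
Variables (I : eqType) (K : set I) (E : I -> set (set Omega)).
Hypothesis mE : forall k, K k -> E k `<=` measurable.
Hypothesis ET : forall k, K k -> E k setT.
Hypothesis EI : forall k, K k -> setI_closed (E k).
Hypothesis indK : mutually_independent P K E.

(** Finite intersections of past events form a pi-system generating the past. The measures A -> P (A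
    and B) and A -> P(B) P(A) are finite and agree on it by mutual independence, hence agree on the
    generated sigma-algebra. *)
Lemma independent_past (past : set I) k0 A B : past `<=` K -> K k0 -> ~ past k0 ->
  <<s \bigcup_(k in past) E k >> A -> E k0 B -> P (A `&` B) = P A * P B.
Proof.
move=> pK Kk0 pk0 HA HB.
pose G := [set C | exists (s : seq I) (F : I -> set Omega),
  [/\ uniq s, (forall k, k \in s -> past k /\ E k (F k)) &
      C = \bigcap_(k in [set` s]) F k]].
have Gm : G `<=` measurable.
  move=> _ [s [F [us sF ->]]]; apply: fin_bigcap_measurable => // k /= ks.
  by have [pk] := sF k ks; apply: mE; exact: pK.
have GT : G setT.
  by exists [::], (fun=> setT); split=> //; apply/seteqP; split.
have GI : setI_closed G.
  move=> _ _ [s [F [us sF ->]]] [s' [F' [us' sF' ->]]].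
  pose H k := (if k \in s then F k else setT) `&` (if k \in s' then F' k else setT).
  exists (undup (s ++ s')), H; split; first exact: undup_uniq.
    move=> k; rewrite mem_undup mem_cat /H => ks.
    have pk : past k by case/orP: ks => [/sF|/sF'] [].
    split=> //; apply: EI; first exact: pK.
      by case: ifPn => [/sF[]//|_]; apply: ET; exact: pK.
    by case: ifPn => [/sF'[]//|_]; apply: ET; exact: pK.
  apply/seteqP; split=> [x [h h'] k /=|x h].
    rewrite mem_undup mem_cat /H => _; split.
      by case: ifPn => // ks; exact: h.
    by case: ifPn => // ks; exact: h'.
  split=> k /= ks.
    by have [] := h k; rewrite /= ?mem_undup ?mem_cat ?ks//.
  by have [] := h k; rewrite /= ?mem_undup ?mem_cat ?ks ?orbT//.
have sub : \bigcup_(k in past) E k `<=` G.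
  move=> C [k pk EC]; exists [:: k], (fun=> C); split=> //.
    by move=> k'; rewrite inE => /eqP ->.
  apply/seteqP; split=> [x Cx k' //|x h].
  by apply: (h k); rewrite /= mem_head.
have {HA} HA : <<s G >> A by apply: sub_smallest2r HA.
have mB : measurable B by exact: mE HB.
have mA : measurable A.
  by apply: HA; split; [exact: sigma_algebra_measurable|exact: Gm].
have PB0 : (0 <= fine (P B))%R by rewrite fine_ge0.
pose m1 := mrestr P mB; pose m2 := mscale (NngNum PB0) P.
have : m1 A = m2 A.
  apply: (g_sigma_algebra_measure_unique G Gm (fun=> setT)) => //.
  - by rewrite bigcup_const.
  - move=> C [s [F [us sF CE]]]; rewrite /m1 /m2 /mrestr /mscale /=.
    have mC : measurable C by apply: Gm; exists s, F.
    (* The event B is placed at the new index, so that one application of mutual independence covers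
       [k0 :: s]. *)
    pose F' k := if k == k0 then B else F k.
    have k0s : k0 \notin s by apply/negP => /sF[].
    have F's k : k \in s -> F' k = F k.
      by rewrite /F'; case: eqP => // -> ks; rewrite ks in k0s.
    have := @indK (k0 :: s) F'; rewrite /= k0s us => /(_ isT) H.
    have {}H : fine (P (C `&` B)) = (fine (P B) * fine (P C))%R.
      have -> : C `&` B = \bigcap_(k in [set` k0 :: s]) F' k.
        rewrite CE; apply/seteqP; split=> [x [h xB] k /=|x h].
          rewrite inE => /orP[/eqP ->|ks]; first by rewrite /F' eqxx.
          by rewrite F's//; exact: h.
        split=> [k /= ks|].
          by rewrite -F's//; apply: h; rewrite /= inE ks orbT.
        by have := h k0; rewrite /F' eqxx; apply; rewrite /= mem_head.
      rewrite H ?big_cons.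
        congr (_ * _)%R; first by rewrite /F' eqxx.
        have HC : fine (P C) = (\prod_(k <- s) fine (P (F k)))%R.
          by rewrite CE; apply: indK => // k /sF[pk ?]; split=> //; exact: pK.
        by rewrite HC; apply: eq_big_seq => k /F's ->.
      move=> k; rewrite inE => /orP[/eqP ->|ks]; first by rewrite /F' eqxx.
      by rewrite F's//; have [pk ?] := sF k ks; split=> //; exact: pK.
    transitivity (P (C `&` B)) => //.
    rewrite -(fineK (fin_num_measure P _ (measurableI _ _ mC mB))) H EFinM.
    by congr (_ * _); rewrite fineK//; exact: fin_num_measure.
  - move=> k; apply: (@le_lt_trans _ _ 1); last exact: ltry.
    by apply: probability_le1; exact: measurableI.
move=> h; transitivity (m1 A) => //; rewrite h; transitivity ((fine (P B))%:E * P A) => //.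
by rewrite fineK 1?muleC//; exact: fin_num_measure.
Qed.

End IndependentPast.

(** * Entrywise measurability of random matrices *)

Definition measurable_mx d (T : measurableType d) (R : realType) (p n : nat)
  (f : T -> 'M[R]_(p, n)) : Prop := forall i j, measurable_fun setT (fun w => f w i j).

Section MeasurableMatrix.
Context d (T : measurableType d) (R : realType) (p n : nat).
Implicit Types f g : T -> 'M[R]_(p, n).

Lemma measurable_mxD f g : measurable_mx f -> measurable_mx g ->
  measurable_mx (fun w => f w + g w).
Proof.
move=> mf mg i j; apply: (eq_measurable_fun (fun w => f w i j + g w i j)).
  by move=> w _; rewrite mxE.
exact: measurable_funD.
Qed.

Lemma measurable_mxZ a f : measurable_mx f -> measurable_mx (fun w => a *: f w).
Proof.
move=> mf i j; apply: (eq_measurable_fun (fun w => a * f w i j)).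
  by move=> w _; rewrite mxE.
exact: measurable_funM.
Qed.

Lemma measurable_mxN f : measurable_mx f -> measurable_mx (fun w => - f w).
Proof.
move=> mf; rewrite (_ : (fun w => _) = (fun w => -1 *: f w)); first exact: measurable_mxZ.
by apply/funext => w; rewrite scaleN1r.
Qed.

Lemma measurable_mxB f g : measurable_mx f -> measurable_mx g ->
  measurable_mx (fun w => f w - g w).
Proof. by move=> mf mg; apply: measurable_mxD => //; exact: measurable_mxN. Qed.

Lemma measurable_mx_sum (N : nat) (F : nat -> T -> 'M[R]_(p, n)) :
  (forall l, (l < N)%N -> measurable_mx (F l)) ->
  measurable_mx (fun w => \sum_(l < N) F l w).
Proof.
elim: N => [_ i j|N IH mF].
  apply: (eq_measurable_fun (fun=> (0 : R))) => [w _|]; last exact: measurable_cst.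
  by rewrite big_ord0 mxE.
rewrite (_ : (fun w => _) = (fun w => \sum_(l < N) F l w + F N w)).
  by apply: measurable_mxD; [apply: IH => l lN; apply: mF; exact: ltnW|exact: mF].
by apply/funext => w; rewrite big_ord_recr.
Qed.

Lemma measurable_mx_fnorm f : measurable_mx f ->
  measurable_fun setT (fun w => fnorm (f w) ^+ 2).
Proof.
move=> mf; rewrite (_ : (fun w => _) = (fun w => \sum_(i < p) \sum_(j < n) f w i j ^+ 2)).
  by apply: measurable_sum => i; apply: measurable_sum => j; exact: measurable_funX.
by apply/funext => w; rewrite fnorm_sqr; under [RHS]eq_bigr do under eq_bigr do rewrite expr2.
Qed.

Lemma measurable_mulmx q (A : 'M[R]_(q, p)) f : measurable_mx f ->
  measurable_mx (fun w => A *m f w).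
Proof.
move=> mf i j; apply: (eq_measurable_fun (fun w => \sum_k A i k * f w k j)).
  by move=> w _; rewrite mxE.
by apply: measurable_sum => k; exact: measurable_funM.
Qed.

Lemma measurable_mx_row f i : measurable_mx f -> measurable_mx (fun w => row i (f w)).
Proof.
move=> mf i' j; apply: (eq_measurable_fun (fun w => f w i j)) => //.
by move=> w _; rewrite mxE.
Qed.

Lemma measurable_mx_rows f : (forall i, measurable_mx (fun w => row i (f w))) ->
  measurable_mx f.
Proof.
move=> mf i j; apply: (eq_measurable_fun (fun w => row i (f w) 0 j)).
  by move=> w _; rewrite mxE.
exact: mf.
Qed.

End MeasurableMatrix.

Section MeasurableBlocks.
Context d (T : measurableType d) (R : realType) (p n1 n2 : nat).

Lemma measurable_row_mx (f : T -> 'M[R]_(p, n1)) (g : T -> 'M[R]_(p, n2)) :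
  measurable_mx f -> measurable_mx g -> measurable_mx (fun w => row_mx (f w) (g w)).
Proof.
move=> mf mg i j; have [k ->|k ->] := split_ordP j.
  by apply: (eq_measurable_fun (fun w => f w i k)) => // w _; rewrite row_mxEl.
by apply: (eq_measurable_fun (fun w => g w i k)) => // w _; rewrite row_mxEr.
Qed.

Lemma measurable_lsubmx (f : T -> 'M[R]_(p, n1 + n2)) :
  measurable_mx f -> measurable_mx (fun w => lsubmx (f w)).
Proof.
move=> mf i j; apply: (eq_measurable_fun (fun w => f w i (lshift n2 j))) => //.
by move=> w _; rewrite mxE.
Qed.

Lemma measurable_rsubmx (f : T -> 'M[R]_(p, n1 + n2)) :
  measurable_mx f -> measurable_mx (fun w => rsubmx (f w)).
Proof.
move=> mf i j; apply: (eq_measurable_fun (fun w => f w i (rshift n1 j))) => //.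
by move=> w _; rewrite mxE.
Qed.

End MeasurableBlocks.

(** Row vectors are passed through tuples because joint measurability of the oracle is stated for
    the product sigma-algebra on tuples. *)
Definition row_tuple (R : realType) n (z : 'rV[R]_n) : n.-tuple R :=
  [tuple z 0 j | j < n].

Definition tuple_row (R : realType) n (x : n.-tuple R) : 'rV[R]_n := \row_j tnth x j.

Lemma row_tupleK (R : realType) n : cancel (@row_tuple R n) (@tuple_row R n).
Proof. by move=> z; apply/rowP => j; rewrite mxE tnth_mktuple. Qed.

Lemma measurable_row_tuple d (T : measurableType d) (R : realType) n (f : T -> 'rV[R]_n) :
  measurable_mx f -> measurable_fun setT (fun w => row_tuple (f w)).
Proof.
move=> mf; apply/measurable_fun_tnthP => i.
apply: (eq_measurable_fun (fun w => f w 0 i)) => // w _.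
by rewrite /= tnth_mktuple.
Qed.

Lemma measurable_tuple_row d (T : measurableType d) (R : realType) n (f : T -> n.-tuple R) :
  measurable_fun setT f -> measurable_mx (fun w => tuple_row (f w)).
Proof.
move=> mf i j; apply: (eq_measurable_fun (fun w => tnth (f w) j)).
  by move=> w _; rewrite mxE.
exact: measurableT_comp (measurable_tnth j) mf.
Qed.

(** * Second moments and parametric integrals *)

Section SecondMoment.
Context (R : realType) dX (Xi : measurableType dX) (Q : probability Xi R) (n : nat).
Local Open Scope ereal_scope.

(* The variance of Y is at most its second moment. *)
Lemma second_moment_shift (Y : Xi -> 'rV[R]_n) (a mY : 'rV[R]_n) (c v : R) :
  measurable_mx Y -> (forall k, Q.-integrable setT (fun s => (Y s ord0 k)%:E)) ->
  (forall k, \int[Q]_s (Y s ord0 k)%:E = (mY ord0 k)%:E) ->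
  \int[Q]_s (fnorm (Y s) ^+ 2)%:E <= v%:E ->
  \int[Q]_s (fnorm (a + c *: (Y s - mY)) ^+ 2)%:E <= (fnorm a ^+ 2 + c ^+ 2 * v)%:E.
Proof.
move=> measY iY eY vY; pose b := (a - c *: mY)%R.
have iY2 : Q.-integrable setT (fun s => (fnorm (Y s) ^+ 2)%:E).
  apply/integrableP; split; first exact/measurable_EFinP/measurable_mx_fnorm.
  under eq_integral do rewrite gee0_abs ?lee_fin ?sqr_ge0//.
  by apply: le_lt_trans vY _; rewrite ltry.
pose f k s := ((2 * c * b ord0 k)%:E * (Y s ord0 k)%:E).
have if_ k : Q.-integrable setT (f k) by exact: integrableZl.
have -> : \int[Q]_s (fnorm (a + c *: (Y s - mY)) ^+ 2)%:E =
    \int[Q]_s ((c ^+ 2)%:E * (fnorm (Y s) ^+ 2)%:E +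
       (\sum_(k < n) f k s + (fnorm b ^+ 2)%:E)).
  apply: eq_integral => s _; rewrite /f; under eq_bigr do rewrite -EFinM.
  rewrite sumEFin -EFinM -!EFinD; congr (_%:E).
  have -> : (a + c *: (Y s - mY) = c *: Y s + b)%R.
    by rewrite /b scalerBr addrCA.
  have -> : (\sum_(i < n) 2 * c * b ord0 i * Y s ord0 i = 2 * c * dot b (Y s))%R.
    by rewrite /dot big_ord1 mulr_sumr; apply: eq_bigr => i _; rewrite mulrA.
  by rewrite fnormZD_sqr; ring.
have i1 : Q.-integrable setT (fun s => (c ^+ 2)%:E * (fnorm (Y s) ^+ 2)%:E).
  exact: integrableZl.
have i2 : Q.-integrable setT (fun s => \sum_(k < n) f k s) by exact: integrable_sum.
have i3 : Q.-integrable setT (fun=> (fnorm b ^+ 2)%:E).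
  exact: finite_measure_integrable_cst.
have e3 : \int[Q]_s (fnorm b ^+ 2)%:E = (fnorm b ^+ 2)%:E.
  transitivity ((fnorm b ^+ 2)%:E * Q setT).
    exact: (@integral_cst _ _ _ Q setT measurableT (fnorm b ^+ 2)%:E).
  by rewrite (probability_setT Q) mule1.
rewrite integralD//; last exact: integrableD.
rewrite integralD// e3 integralZl//.
rewrite integral_sum//.
under eq_bigr do rewrite integralZl// eY -EFinM.
rewrite sumEFin -EFinD.
apply: (@le_trans _ _ ((c ^+ 2)%:E * v%:E + (\sum_(i < n) 2 * c * b ord0 i * mY ord0 i + fnorm b ^+ 2)%:E)).
  by rewrite leeD2r// lee_wpmul2l// lee_fin sqr_ge0.
rewrite -EFinM -EFinD lee_fin.
have -> : (\sum_(i < n) 2 * c * b ord0 i * mY ord0 i = 2 * c * dot b mY)%R.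
  by rewrite /dot big_ord1 mulr_sumr; apply: eq_bigr => i _; rewrite mulrA.
(* This is the term -c^2 |mY|^2 discarded in passing from the variance to the second moment. *)
have : (0 <= c ^+ 2 * dot mY mY)%R by rewrite mulr_ge0 ?sqr_ge0 ?dot_ge0.
rewrite !fnorm_sqr /b !dotE (dotC mY a); set x := dot a mY; set y := dot mY mY.
set z := dot a a; lra.
Qed.

(** Tonelli gives measurability for the positive and negative parts separately. It is used for the
    gradients, which are integrals of the oracle. *)
Lemma measurable_integral_fin d (T : measurableType d) (f : (T * Xi)%type -> R) :
  measurable_fun setT f -> measurable_fun setT (fun u => fine (\int[Q]_s (f (u, s))%:E)).
Proof.
move=> mf; have mfE : measurable_fun setT (EFin \o f) by exact/measurable_EFinP.
apply: (measurableT_comp (fine_measurable measurableT)).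
rewrite (_ : (fun u => _) = (fun u => \int[Q]_s ((EFin \o f)^\+ (u, s)) -
     \int[Q]_s ((EFin \o f)^\- (u, s)))).
  apply: emeasurable_funB.
    apply: (@measurable_fun_fubini_tonelli_F _ _ _ _ _ Q _ (measurable_funepos mfE)).
    exact: funepos_ge0.
  apply: (@measurable_fun_fubini_tonelli_F _ _ _ _ _ Q _ (measurable_funeneg mfE)).
  exact: funeneg_ge0.
apply/funext => u; rewrite [LHS]integralE.
by congr (_ - _); apply: eq_integral => s _; rewrite ?funeposE ?funenegE.
Qed.

End SecondMoment.

(** * Sigma-algebras generated by the samples *)

Section SubSigmaAlgebra.
Context dO (Omega : measurableType dO) (G G' : set (set Omega)).

Lemma measurable_fun_sub_sigma d (T : measurableType d) (f : Omega -> T) :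
  G `<=` G' -> measurable_fun [set: g_sigma_algebraType G] f ->
  measurable_fun [set: g_sigma_algebraType G'] f.
Proof. by move=> GG' mf _ B mB; by apply: sub_smallest2r (mf measurableT B mB). Qed.

Lemma measurable_fun_sigma d (T : measurableType d) (f : Omega -> T) :
  G `<=` measurable -> measurable_fun [set: g_sigma_algebraType G] f ->
  measurable_fun setT f.
Proof.
move=> Gm mf _ B mB; have h := mf measurableT B mB.
by apply: h; split=> //; exact: sigma_algebra_measurable.
Qed.

Lemma measurable_fun_sigma_of d (T : measurableType d) (f : Omega -> T) :
  sigma_of f `<=` G -> measurable_fun [set: g_sigma_algebraType G] f.
Proof. by move=> fG _ B mB; apply: sub_sigma_algebra; apply: fG; exists B. Qed.

End SubSigmaAlgebra.

Lemma sigma_of_setT d d' (T : measurableType d) (T' : measurableType d') (f : T -> T') :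
  sigma_of f setT.
Proof. by exists setT => //; rewrite preimage_setT setTI. Qed.

Lemma sigma_of_setI d d' (T : measurableType d) (T' : measurableType d') (f : T -> T') :
  setI_closed (sigma_of f).
Proof.
move=> _ _ [A mA <-] [B mB <-]; exists (A `&` B); first exact: measurableI.
by rewrite preimage_setI setIACA setIid.
Qed.

Lemma sigma_of_measurable d d' (T : measurableType d) (T' : measurableType d') (f : T -> T') :
  measurable_fun setT f -> sigma_of f `<=` measurable.
Proof. by move=> mf _ [A mA <-]; exact: mf. Qed.

(** * Second moment of a minibatch *)

Section MiniBatch.
Local Open Scope ereal_scope.
Context (R : realType) dO dT dX (Omega : measurableType dO) (T : measurableType dT)
  (Xi : measurableType dX) (P : probability Omega R) (Q : probability Xi R) (n : nat).
Variables (I : eqType) (K : set I) (E : I -> set (set Omega)).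
Hypothesis mE : forall k, K k -> E k `<=` measurable.
Hypothesis ET : forall k, K k -> E k setT.
Hypothesis EI : forall k, K k -> setI_closed (E k).
Hypothesis indK : mutually_independent P K E.
Variables (past : set I) (S : nat) (key : nat -> I) (xi : nat -> Omega -> Xi).
Hypothesis pastK : past `<=` K.
Hypothesis keyK : forall j, (j < S)%N -> K (key j).
Hypothesis key_past : forall j, (j < S)%N -> ~ past (key j).
Hypothesis key_inj : injective key.
Hypothesis E_key : forall j, (j < S)%N -> E (key j) = sigma_of (xi j).
Hypothesis mxi : forall j, (j < S)%N -> measurable_fun setT (xi j).
Hypothesis xi_law : forall j, (j < S)%N ->
  forall B, measurable B -> P (xi j @^-1` B) = Q B.

Let G := \bigcup_(k in past) E k.

Variables (U : Omega -> T) (a : Omega -> 'rV[R]_n).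
Hypothesis mU : measurable_fun [set: g_sigma_algebraType G] U.
Hypothesis ma : measurable_mx (a : g_sigma_algebraType G -> 'rV[R]_n).

Variables (psi : T -> Xi -> 'rV[R]_n) (mpsi : T -> 'rV[R]_n) (v : T -> R).
Hypothesis psi_meas : measurable_mx (fun p : (T * Xi)%type => psi p.1 p.2).
Hypothesis mpsi_meas : measurable_mx mpsi.
Hypothesis v_meas : measurable_fun setT v.
Hypothesis psi_int : forall u k, Q.-integrable setT (fun s => (psi u s ord0 k)%:E).
Hypothesis psi_mean : forall u k,
  \int[Q]_s (psi u s ord0 k)%:E = (mpsi u ord0 k)%:E.
Hypothesis psi_sqr : forall u, \int[Q]_s (fnorm (psi u s) ^+ 2)%:E <= (v u)%:E.

Let v_ge0 u : (0 <= v u)%R.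
Proof.
rewrite -lee_fin; apply: le_trans (psi_sqr u).
by apply: integral_ge0 => s _; rewrite lee_fin sqr_ge0.
Qed.

(** The samples are added one at a time, each independent of the past enlarged by the earlier ones.
    Given these, the new summand is centered, so its cross term vanishes and it adds at most c^2
    v(U). Thus S samples cost S c^2, not (S c)^2. *)
Lemma minibatch_second_moment (c : R) :
  \int[P]_w (fnorm (a w + c *: \sum_(l < S) (psi (U w) (xi l w) - mpsi (U w))) ^+ 2)%:E
    <= \int[P]_w (fnorm (a w) ^+ 2)%:E + (S%:R * c ^+ 2)%:E * \int[P]_w (v (U w))%:E.
Proof.
pose pastN N := past `|` [set k | exists2 l, (l < N)%N & k = key l].
pose GN N := \bigcup_(k in pastN N) E k.
have pastNK N : (N <= S)%N -> pastN N `<=` K.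
  by move=> NS k [/pastK//|[l lN ->]]; apply: keyK; exact: leq_trans NS.
have GNm N : (N <= S)%N -> GN N `<=` measurable.
  by move=> NS A [k pk Ek]; apply: mE Ek; exact: pastNK pk.
have GGN N : G `<=` GN N by move=> A [k pk Ek]; exists k => //; left.
pose aN N w := (a w + c *: \sum_(l < N) (psi (U w) (xi l w) - mpsi (U w)))%R.
have mUN N : measurable_fun [set: g_sigma_algebraType (GN N)] U.
  exact: measurable_fun_sub_sigma mU.
have maN N : (N <= S)%N -> measurable_mx (aN N : g_sigma_algebraType (GN N) -> 'rV[R]_n).
  move=> NS; apply: measurable_mxD.
    by move=> i j; apply: measurable_fun_sub_sigma (GGN N) _; exact: ma.
  apply: measurable_mxZ.
  apply: (@measurable_mx_sum _ (g_sigma_algebraType (GN N)) R 1 n N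
    (fun l w => psi (U w) (xi l w) - mpsi (U w))%R) => l lN.
  have lS : (l < S)%N by exact: leq_trans NS.
  have mxil : measurable_fun [set: g_sigma_algebraType (GN N)] (xi l).
    apply: measurable_fun_sigma_of => A; rewrite -E_key// => EA.
    by exists (key l) => //; right; exists l.
  apply: measurable_mxB.
    move=> i j; have mp : measurable_fun [set: g_sigma_algebraType (GN N)]
      (fun w => (U w, xi l w)) by exact: measurable_fun_pair.
    exact: (measurableT_comp (psi_meas i j) mp).
  by move=> i j; exact: (measurableT_comp (mpsi_meas i j) (mUN N)).
have mvU : measurable_fun setT (fun w => (v (U w))%:E).
  apply/measurable_EFinP; apply: measurableT_comp v_meas _.
  by apply: measurable_fun_sigma mU => A [k pk]; apply: mE; exact: pastK.
have step N : (N < S)%N -> \int[P]_w (fnorm (aN N.+1 w) ^+ 2)%:E <=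
    \int[P]_w (fnorm (aN N w) ^+ 2)%:E + (c ^+ 2)%:E * \int[P]_w (v (U w))%:E.
  (* Both the partial sum and the point U are known before sample N; freezing the pair leaves that
     sample as the only randomness. *)
  move=> NS; pose U' w := (row_tuple (aN N w), U w).
  pose phi (p : ((n.-tuple R * T) * Xi)%type) :=
    (fnorm (tuple_row p.1.1 + c *: (psi p.1.2 p.2 - mpsi p.1.2)) ^+ 2)%:E.
  have mU' : measurable_fun [set: g_sigma_algebraType (GN N)] U'.
    apply: measurable_fun_pair => //; apply: measurable_row_tuple.
    by apply: maN; exact: ltnW.
  have mU'0 : measurable_fun setT U'.
    by apply: measurable_fun_sigma mU'; apply: GNm; exact: ltnW.
  have mphi : measurable_fun setT phi.
    apply/measurable_EFinP; apply: measurable_mx_fnorm.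
    apply: measurable_mxD.
      apply: measurable_tuple_row; exact: measurableT_comp.
    apply: measurable_mxZ; apply: measurable_mxB => i j.
      have mp : measurable_fun [set: ((n.-tuple R * T) * Xi)%type] (fun p => (p.1.2, p.2)).
        by apply: measurable_fun_pair => //; exact: measurableT_comp.
      exact: (measurableT_comp (psi_meas i j) mp).
    have mp : measurable_fun [set: ((n.-tuple R * T) * Xi)%type] (fun p => p.1.2).
      exact: measurableT_comp.
    exact: (measurableT_comp (mpsi_meas i j) mp).
  have phi0 p : 0 <= phi p by rewrite lee_fin sqr_ge0.
  have ind A B : measurable A -> measurable B ->
      P (U' @^-1` A `&` xi N @^-1` B) = P (U' @^-1` A) * P (xi N @^-1` B).
    move=> mA mB; apply: (independent_past mE ET EI indK (past := pastN N) (k0 := key N)).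
    - by apply: pastNK; exact: ltnW.
    - exact: keyK.
    - move=> [|[l lN /key_inj Nl]]; first exact: key_past.
      by rewrite Nl ltnn in lN.
    - by rewrite -[_ @^-1` A]setTI; exact: mU'.
    - by rewrite E_key//; exists B => //; rewrite setTI.
  have -> : \int[P]_w (fnorm (aN N.+1 w) ^+ 2)%:E = \int[P]_w phi (U' w, xi N w).
    apply: eq_integral => w _; rewrite /phi /= row_tupleK /aN big_ord_recr /=.
    by rewrite scalerDr addrA.
  rewrite (integral_freeze mU'0 (mxi NS) (xi_law NS) ind)//.
  have v0 w : 0 <= (c ^+ 2)%:E * (v (U w))%:E by rewrite -EFinM lee_fin mulr_ge0 ?sqr_ge0.
  have maN0 : measurable_fun setT (fun w => (fnorm (aN N w) ^+ 2)%:E).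
    apply/measurable_EFinP; apply: measurable_mx_fnorm => i j.
    by apply: measurable_fun_sigma (maN N _ i j); [apply: GNm|]; exact: ltnW.
  apply: (@le_trans _ _ (\int[P]_w ((fnorm (aN N w) ^+ 2)%:E + (c ^+ 2)%:E * (v (U w))%:E))).
    apply: le_integral_ge0 => w; first by apply: integral_ge0.
    rewrite /phi /= row_tupleK -EFinM -EFinD.
    apply: second_moment_shift => //= i j.
    have mp : measurable_fun [set: Xi] (fun s => (U w, s)) by exact: measurable_fun_pair.
    exact: (measurableT_comp (psi_meas i j) mp).
  rewrite ge0_integralD//; last 2 first.
    by move=> w _; rewrite lee_fin sqr_ge0.
    exact: measurable_funeM.
  rewrite leeD2l// ge0_integralZl_EFin ?sqr_ge0// => w _.
  by rewrite lee_fin.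
suff H N : (N <= S)%N -> \int[P]_w (fnorm (aN N w) ^+ 2)%:E <=
    \int[P]_w (fnorm (a w) ^+ 2)%:E + (N%:R * c ^+ 2)%:E * \int[P]_w (v (U w))%:E.
  exact: H.
elim: N => [_|N IH NS].
  rewrite mul0r mul0e adde0; apply: le_integral_ge0 => w; first by rewrite lee_fin sqr_ge0.
  by rewrite /aN big_ord0 scaler0 addr0.
apply: le_trans (step N NS) _; apply: le_trans (leeD2r _ (IH (ltnW NS))) _.
have c2 : (0 <= c ^+ 2)%R := sqr_ge0 c.
rewrite -addeA leeD2l// -ge0_muleDl; [|by rewrite lee_fin mulr_ge0|by rewrite lee_fin].
by rewrite -EFinD -natr1 mulrDl mul1r.
Qed.

End MiniBatch.

(** * Means and measurability of the oracles *)

Section Oracle.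
Context (R : realType) (M n : nat) dX (Xi : measurableType dX) (Q : 'I_M -> probability Xi R).
Variables (f : 'I_M -> 'rV[R]_n -> R) (G : 'I_M -> 'rV[R]_n -> Xi -> 'rV[R]_n).
Hypothesis mG : measurable_oracle G.
Hypothesis uG : unbiased_oracle Q f G.
Local Open Scope ereal_scope.

Lemma oracle_measurable i :
  measurable_mx (fun p : (n.-tuple R * Xi)%type => G i (tuple_row p.1) p.2).
Proof. by move=> i' k; rewrite ord1; exact: mG. Qed.

Lemma oracle_mean i z k : \int[Q i]_s (G i z s ord0 k)%:E = (grad (f i) z ord0 k)%:E.
Proof. by have [_] := uG i z k; rewrite expectation.unlock. Qed.

(** By unbiasedness the gradient is an integral of the jointly measurable oracle; no regularity of f
    is invoked. *)
Lemma grad_measurable i : measurable_mx (fun u : n.-tuple R => grad (f i) (tuple_row u)).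
Proof.
move=> i' k; rewrite ord1.
apply: (eq_measurable_fun (fun u => fine (\int[Q i]_s (G i (tuple_row u) s ord0 k)%:E))).
  by move=> u _; rewrite oracle_mean.
exact: (measurable_integral_fin (Q i) (oracle_measurable i ord0 k)).
Qed.

Lemma oracle_sub_integrable i z (x : 'rV[R]_n) k :
  (Q i).-integrable setT (fun s => ((G i z s - x) ord0 k)%:E).
Proof.
have [iG _] := uG i z k.
apply: (eq_integrable _ (fun s => (G i z s ord0 k)%:E - (x ord0 k)%:E)) => //.
  by move=> s _; rewrite !mxE.
by apply: integrableB => //; exact: finite_measure_integrable_cst.
Qed.

Lemma oracle_sub_mean i z (x : 'rV[R]_n) k :
  \int[Q i]_s ((G i z s - x) ord0 k)%:E = ((grad (f i) z - x)%R ord0 k)%:E.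
Proof.
have [iG _] := uG i z k.
transitivity (\int[Q i]_s ((G i z s ord0 k)%:E - (x ord0 k)%:E)).
  by apply: eq_integral => s _; rewrite !mxE.
rewrite integralB_EFin//; last exact: finite_measure_integrable_cst.
rewrite oracle_mean !mxE EFinB; congr (_ - _).
transitivity ((x ord0 k)%:E * Q i setT); last by rewrite (probability_setT (Q i)) mule1.
exact: (@integral_cst _ _ _ (Q i) setT measurableT (x ord0 k)%:E).
Qed.

Lemma oracle_diff_integrable i z z' k :
  (Q i).-integrable setT (fun s => ((G i z s - G i z' s) ord0 k)%:E).
Proof.
have [iG _] := uG i z k; have [iG' _] := uG i z' k.
apply: (eq_integrable _ (fun s => (G i z s ord0 k)%:E - (G i z' s ord0 k)%:E)) => //.
  by move=> s _; rewrite !mxE.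
exact: integrableB.
Qed.

Lemma oracle_diff_mean i z z' k :
  \int[Q i]_s ((G i z s - G i z' s) ord0 k)%:E =
    ((grad (f i) z - grad (f i) z')%R ord0 k)%:E.
Proof.
have [iG _] := uG i z k; have [iG' _] := uG i z' k.
transitivity (\int[Q i]_s ((G i z s ord0 k)%:E - (G i z' s ord0 k)%:E)).
  by apply: eq_integral => s _; rewrite !mxE.
by rewrite integralB_EFin// !oracle_mean !mxE EFinB.
Qed.

End Oracle.

Definition grad_mx (R : realType) (M n : nat) (f : 'I_M -> 'rV[R]_n -> R)
  (Z : 'M[R]_(M, n)) : 'M[R]_(M, n) := \matrix_(i, j) grad (f i) (row i Z) 0 j.

Lemma row_grad_mx (R : realType) (M n : nat) (f : 'I_M -> 'rV[R]_n -> R) Z i :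
  row i (grad_mx f Z) = grad (f i) (row i Z).
Proof. by apply/rowP => j; rewrite !mxE. Qed.

Lemma scale_sum_sub (R : realType) p n (S : nat) (g : 'I_S -> 'M[R]_(p, n)) x :
  (0 < S)%N -> S%:R^-1 *: \sum_(j < S) (g j - x) = S%:R^-1 *: \sum_(j < S) g j - x.
Proof.
move=> S0; rewrite sumrB sumr_const card_ord scalerBr -(scaler_nat S x) scalerA.
by rewrite mulVf ?scale1r// pnatr_eq0 -lt0n.
Qed.

Lemma integral_fnorm_rows d (T : measurableType d) (R : realType) (P : probability T R)
    (p n : nat) (h : T -> 'M[R]_(p, n)) (a : R) : 0 <= a -> measurable_mx h ->
  (\int[P]_w (a * fnorm (h w) ^+ 2)%:E =
    a%:E * \sum_(i < p) \int[P]_w (fnorm (row i (h w)) ^+ 2)%:E)%E.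
Proof.
move=> a0 mh; rewrite -ge0_integral_sum//; last 2 first.
  by move=> i; apply/measurable_EFinP; apply: measurable_mx_fnorm; exact: measurable_mx_row.
  by move=> i w _; rewrite lee_fin sqr_ge0.
rewrite -ge0_integralZl_EFin//; last 2 first.
  by move=> w _; apply: sume_ge0 => i _; rewrite lee_fin sqr_ge0.
  apply: emeasurable_sum => i; apply/measurable_EFinP; apply: measurable_mx_fnorm.
  exact: measurable_mx_row.
by apply: eq_integral => w _; rewrite sumEFin -EFinM -fnorm_sum_row.
Qed.

(** * Adaptedness of the iterates and growth of the estimation error *)

Section Iterates.
Context (R : realType) (M d m : nat).
Variables (L sigma eta_x eta_y : R) (S1 S2 q : nat).
Variables (f : 'I_M -> 'rV[R]_(d + m) -> R) (W : 'M[R]_M).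
Context dX (Xi : measurableType dX) (Q : 'I_M -> probability Xi R).
Variable G : 'I_M -> 'rV[R]_(d + m) -> Xi -> 'rV[R]_(d + m).
Context dO (Omega : measurableType dO) (P : probability Omega R).
Variables (xi : nat -> 'I_M -> nat -> Omega -> Xi).
Variables (X0 : 'M[R]_(M, d)) (Y0 : 'M[R]_(M, m)).
Variables (X : nat -> Omega -> 'M[R]_(M, d)) (Y : nat -> Omega -> 'M[R]_(M, m)).
Variables (V D : nat -> Omega -> 'M[R]_(M, d + m)).
Hypothesis mG : measurable_oracle G.
Hypothesis uG : unbiased_oracle Q f G.
Hypothesis vG : oracle_variance_le Q sigma f G.
Hypothesis lG : mean_squared_lipschitz Q L G.
Hypotheses (S10 : (0 < S1)%N) (S20 : (0 < S2)%N).
Hypothesis samp : dgda_vr_sampling P Q S1 S2 q xi (D 0%N).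
Hypothesis iter : dgda_vr_iterates G W eta_x eta_y S1 S2 q X0 Y0 xi X Y V D.

Definition zmx t w : 'M[R]_(M, d + m) := row_mx (X t w) (Y t w).
Definition grad_err t w : 'M[R]_(M, d + m) := V t w - grad_mx f (zmx t w).

Let key := option (nat * 'I_M * nat).
Let K : set key := [set o | if o is Some k then (0 < k.1.1)%N && used_sample S1 S2 q k else true].
Let E (o : key) : set (set Omega) :=
  if o is Some k then sigma_of (xi k.1.1 k.1.2 k.2) else sigma_init S1 xi (D 0%N).

(** Indices of all that has been drawn once v^t is computed; [None] carries the initial information.
    [F t] is the generating family, from which [g_sigma_algebraType] forms the sigma-algebra. *)
Let past t : set key :=
  [set o | if o is Some k then [&& (0 < k.1.1)%N, (k.1.1 <= t)%N & used_sample S1 S2 q k] else true].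
Let F t := \bigcup_(k in past t) E k.

Let pastK t : past t `<=` K.
Proof. by move=> [k|//] /= /and3P[-> _ ->]. Qed.

Let F_le t : F t `<=` F t.+1.
Proof.
move=> A [[k|] pk EA]; last by exists None.
exists (Some k) => //; case/and3P: pk => h1 h2 h3.
by rewrite /past /= h1 h3 (leq_trans h2).
Qed.

Let mE k : K k -> E k `<=` measurable.
Proof.
case: k => [[[t i] j] /= /andP[_ ju]|_].
  by apply: sigma_of_measurable; exact: (sampling_measurable samp).
apply: smallest_sub; first exact: sigma_algebra_measurable.
move=> A [[i _ [j /= jS]]|[i _ [k _]]]; apply: sigma_of_measurable.
  by apply: (sampling_measurable samp).
exact: (sampling_D0_measurable samp).
Qed.

Let ET k : K k -> E k setT.
Proof.
case: k => [k _|_]; first exact: sigma_of_setT.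
by have := @measurableT _ (g_sigma_algebraType ((\bigcup_i \bigcup_(j in [set j | (j < S1)%N]) sigma_of (xi 0%N i j))
      `|` (\bigcup_i \bigcup_k sigma_of (fun w => D 0%N w i k)))).
Qed.

Let EI k : K k -> setI_closed (E k).
Proof.
case: k => [k _|_]; first exact: sigma_of_setI.
move=> A B hA hB.
by have := @measurableI _ (g_sigma_algebraType ((\bigcup_i \bigcup_(j in [set j | (j < S1)%N]) sigma_of (xi 0%N i j))
      `|` (\bigcup_i \bigcup_k sigma_of (fun w => D 0%N w i k)))) A B hA hB.
Qed.

Let Fm t : F t `<=` measurable.
Proof. by move=> A [k pk]; apply: mE; exact: pastK pk. Qed.

Let adapted t p n (h : Omega -> 'M[R]_(p, n)) :=
  measurable_mx (h : g_sigma_algebraType (F t) -> 'M[R]_(p, n)).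

Let adapted_le t p n (h : Omega -> 'M[R]_(p, n)) : adapted t h -> adapted t.+1 h.
Proof. by move=> ah i j; apply: measurable_fun_sub_sigma (@F_le t) (ah i j). Qed.

Let adapted_measurable t p n (h : Omega -> 'M[R]_(p, n)) : adapted t h -> measurable_mx h.
Proof. by move=> ah i j; apply: measurable_fun_sigma (@Fm t) (ah i j). Qed.

Let adapted_oracle t i (z : Omega -> 'rV[R]_(d + m)) (s : Omega -> Xi) :
  adapted t z -> measurable_fun [set: g_sigma_algebraType (F t)] s ->
  adapted t (fun w => G i (z w) (s w)).
Proof.
move=> az ms i' k; rewrite ord1.
have mp : measurable_fun [set: g_sigma_algebraType (F t)] (fun w => (row_tuple (z w), s w)).
  by apply: measurable_fun_pair => //; exact: measurable_row_tuple.
apply: (eq_measurable_fun (fun w : g_sigma_algebraType (F t) => G i (tuple_row (row_tuple (z w))) (s w) ord0 k)).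
  by move=> w _; rewrite row_tupleK.
exact: (measurableT_comp (oracle_measurable mG i ord0 k) mp).
Qed.

Let adapted_grad t i (z : Omega -> 'rV[R]_(d + m)) :
  adapted t z -> adapted t (fun w => grad (f i) (z w)).
Proof.
move=> az i' k; rewrite ord1.
have mp : measurable_fun [set: g_sigma_algebraType (F t)] (fun w => row_tuple (z w)).
  exact: measurable_row_tuple.
apply: (eq_measurable_fun (fun w : g_sigma_algebraType (F t) => grad (f i) (tuple_row (row_tuple (z w))) ord0 k)).
  by move=> w _; rewrite row_tupleK.
exact: (measurableT_comp (grad_measurable mG uG i ord0 k) mp).
Qed.

Let sample0_measurable t i j : (j < S1)%N ->
  measurable_fun [set: g_sigma_algebraType (F t)] (xi 0%N i j).
Proof.
move=> jS; apply: measurable_fun_sigma_of => A hA; exists None => //=.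
by apply: sub_sigma_algebra; left; exists i => //; exists j.
Qed.

Let sample_measurable t i j : (j < batch_size S1 S2 q t.+1)%N ->
  measurable_fun [set: g_sigma_algebraType (F t.+1)] (xi t.+1 i j).
Proof.
move=> jS; apply: measurable_fun_sigma_of => A hA; exists (Some (t.+1, i, j)) => //=.
by rewrite leqnn /used_sample.
Qed.

Let adaptedD0 : adapted 0 (D 0%N).
Proof.
move=> i k; apply: measurable_fun_sigma_of => A hA; exists None => //=.
by apply: sub_sigma_algebra; right; exists i => //; exists k.
Qed.

Let adapted_rows t p n (h : Omega -> 'M[R]_(p, n)) :
  (forall i, adapted t (fun w => row i (h w))) -> adapted t h.
Proof. by move=> ah; apply: measurable_mx_rows. Qed.

Let adapted_sum t p n N (h : nat -> Omega -> 'M[R]_(p, n)) :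
  (forall l, (l < N)%N -> adapted t (h l)) -> adapted t (fun w => \sum_(l < N) h l w).
Proof. by move=> ah; apply: measurable_mx_sum. Qed.

Lemma iterates_adapted t : [/\ adapted t (X t), adapted t (Y t), adapted t (V t) & adapted t (D t)].
Proof.
elim: t => [|t [aX aY aV aD]].
  split=> //.
  - by rewrite (funext (iter_X0 iter)) => i j; exact: measurable_cst.
  - by rewrite (funext (iter_Y0 iter)) => i j; exact: measurable_cst.
  - apply: adapted_rows => i; rewrite (funext (fun w => iter_V0 iter w i)).
    apply: measurable_mxZ.
    apply: (adapted_sum (h := fun j w => G i (row i (row_mx X0 Y0)) (xi 0%N i j w))) => j jS.
    apply: (@adapted_oracle 0%N i (fun=> row i (row_mx X0 Y0)) (xi 0%N i j)); last exact: sample0_measurable.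
    by move=> i' j'; exact: measurable_cst.
have aX1 : adapted t.+1 (X t.+1).
  apply: adapted_le; rewrite (funext (iter_X iter t)).
  apply: measurable_mxB; first exact: measurable_mulmx.
  by apply: measurable_mxZ; exact: measurable_lsubmx.
have aY1 : adapted t.+1 (Y t.+1).
  apply: adapted_le; rewrite (funext (iter_Y iter t)).
  apply: measurable_mxD; first exact: measurable_mulmx.
  by apply: measurable_mxZ; exact: measurable_rsubmx.
have aZ i : adapted t.+1 (fun w => row i (row_mx (X t.+1 w) (Y t.+1 w))).
  by apply: measurable_mx_row; exact: measurable_row_mx.
have aZ' i : adapted t.+1 (fun w => row i (row_mx (X t w) (Y t w))).
  by apply: adapted_le; apply: measurable_mx_row; exact: measurable_row_mx.
have aV1 : adapted t.+1 (V t.+1).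
  apply: adapted_rows => i; have [tq|tq] := eqVneq (t %% q)%N 0%N.
    rewrite (funext (fun w => iter_V_full iter w i tq)).
    apply: measurable_mxZ.
    apply: (adapted_sum (h := fun j w => G i (row i (row_mx (X t.+1 w) (Y t.+1 w))) (xi t.+1 i j w))) => j jS.
    by apply: adapted_oracle => //; apply: sample_measurable; rewrite /= tq.
  have tq' := elimN eqP tq; rewrite (funext (fun w => iter_V_vr iter w i tq')).
  apply: measurable_mxD; first by apply: measurable_mx_row; exact: adapted_le.
  apply: measurable_mxZ.
  apply: (adapted_sum (h := fun j w => G i (row i (row_mx (X t.+1 w) (Y t.+1 w))) (xi t.+1 i j w) -
    G i (row i (row_mx (X t w) (Y t w))) (xi t.+1 i j w))) => j jS.
  by apply: measurable_mxB; apply: adapted_oracle => //; apply: sample_measurable; rewrite /= (negbTE tq).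
split=> //; rewrite (funext (iter_D iter t)); apply: measurable_mulmx.
by apply: measurable_mxB; [apply: measurable_mxD => //|]; exact: adapted_le.
Qed.

Let adaptedZ t : adapted t (zmx t).
Proof. by have [aX aY _ _] := iterates_adapted t; exact: measurable_row_mx. Qed.

(** The point z^(t+1) is determined before the samples of step t + 1 are drawn, which is what allows
    it to be frozen in the estimates of v^(t+1). *)
Let adaptedZS t : adapted t (zmx t.+1).
Proof.
have [aX aY _ aD] := iterates_adapted t; apply: measurable_row_mx.
  rewrite (funext (iter_X iter t)); apply: measurable_mxB; first exact: measurable_mulmx.
  by apply: measurable_mxZ; exact: measurable_lsubmx.
rewrite (funext (iter_Y iter t)); apply: measurable_mxD; first exact: measurable_mulmx.
by apply: measurable_mxZ; exact: measurable_rsubmx.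
Qed.

Let adapted_err t : adapted t (grad_err t).
Proof.
have [_ _ aV _] := iterates_adapted t; apply: measurable_mxB => //.
apply: adapted_rows => i.
rewrite (_ : (fun w => _) = (fun w => grad (f i) (row i (zmx t w)))); last first.
  by apply/funext => w; rewrite row_grad_mx.
by apply: adapted_grad; apply: measurable_mx_row; exact: adaptedZ.
Qed.

Lemma zmx_measurable t : measurable_mx (zmx t).
Proof. exact: (@adapted_measurable t _ _ _ (@adaptedZ t)). Qed.

Lemma grad_err_measurable t : measurable_mx (grad_err t).
Proof. exact: (@adapted_measurable t _ _ _ (@adapted_err t)). Qed.

Lemma D_measurable t : measurable_mx (D t).
Proof. by have [_ _ _ aD] := iterates_adapted t; exact: (@adapted_measurable t _ _ _ aD). Qed.

Local Open Scope ereal_scope.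

Let psi_full i (u : (d + m)%N.-tuple R) s := (G i (tuple_row u) s - grad (f i) (tuple_row u))%R.

Let psi_full_meas i : measurable_mx (fun p : ((d + m)%N.-tuple R * Xi)%type => psi_full i p.1 p.2).
Proof.
apply: measurable_mxB; first exact: oracle_measurable.
by move=> i' k; exact: (measurableT_comp (grad_measurable mG uG i i' k) measurable_fst).
Qed.

Let psi_full_mean i u k :
  \int[Q i]_s (psi_full i u s ord0 k)%:E = ((0 : 'rV[R]_(d + m)%N)%R ord0 k)%:E.
Proof. by rewrite (oracle_sub_mean uG) subrr. Qed.

Let psi_full_sqr i u : \int[Q i]_s (fnorm (psi_full i u s) ^+ 2)%:E <= (sigma ^+ 2)%:E.
Proof. by have := vG i (tuple_row u); rewrite expectation.unlock. Qed.

Let full_sqr (S : nat) : (0 < S)%N ->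
  \int[P]_w (fnorm (0 : 'rV[R]_(d + m)%N)%R ^+ 2)%:E +
    (S%:R * S%:R^-1 ^+ 2)%:E * \int[P]_w (sigma ^+ 2)%:E = (sigma ^+ 2 / S%:R)%:E.
Proof.
move=> S0; have cstE (r : R) : \int[P]_w r%:E = r%:E.
  transitivity (r%:E * P setT); last by rewrite (probability_setT P) mule1.
  exact: (@integral_cst _ _ _ P setT measurableT r%:E).
rewrite !cstE fnorm0 expr0n add0e -EFinM; congr (_%:E).
by field; rewrite pnatr_eq0 -lt0n.
Qed.

(** The family containing [None] bundles all time-zero samples into a single index, so the
    independence used here is that of the individual samples, with an empty past and a deterministic
    starting point. *)
Lemma grad_err_init i :
  \int[P]_w (fnorm (row i (grad_err 0 w)) ^+ 2)%:E <= (sigma ^+ 2 / S1%:R)%:E.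
Proof.
pose Z0 := row i (row_mx X0 Y0).
have := @minibatch_second_moment R _ _ _ Omega ((d + m)%N.-tuple R)%type Xi P (Q i) (d + m)%N
  (nat * 'I_M * nat)%type [set k | used_sample S1 S2 q k]
  (fun k => sigma_of (xi k.1.1 k.1.2 k.2)) _ _ _ (sampling_independent samp)
  set0 S1 (fun j => (0%N, i, j)) (xi 0%N i) _ _ _ _ _ _ _
  (fun=> row_tuple Z0) (fun=> 0%R) _ _ (psi_full i) (fun=> 0%R) (fun=> (sigma ^+ 2)%R)
  _ _ _ _ (psi_full_mean i) (psi_full_sqr i) (S1%:R^-1)%R.
rewrite (full_sqr S10) => H; apply: le_trans (H _ _ _ _ _ _ _ _ _ _ _ _ _ _ _ _) => {H} //.
- rewrite le_eqVlt; apply/orP; left; apply/eqP; apply: eq_integral => w _; congr (fnorm _ ^+ 2)%:E.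
  rewrite add0r /grad_err linearB /= (iter_V0 iter) row_grad_mx /zmx (iter_X0 iter) (iter_Y0 iter).
  rewrite /psi_full row_tupleK; under [in RHS]eq_bigr do rewrite subr0.
  by rewrite scale_sum_sub.
- move=> [[t i'] j] /= ju; apply: sigma_of_measurable; exact: (sampling_measurable samp).
- move=> k _; exact: sigma_of_setT.
- move=> k _; exact: sigma_of_setI.
- by move=> j jS [].
- by move=> j j' [].
- by move=> j jS; apply: (sampling_measurable samp).
- by move=> j jS; exact: (sampling_law samp).
- by move=> u k; exact: (oracle_sub_integrable uG).
Qed.

Lemma grad_err_full t i : (t %% q = 0)%N ->
  \int[P]_w (fnorm (row i (grad_err t.+1 w)) ^+ 2)%:E <= (sigma ^+ 2 / S1%:R)%:E.
Proof.
move=> tq.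
have bt : batch_size S1 S2 q t.+1 = S1 by rewrite /= tq.
have := @minibatch_second_moment R _ _ _ Omega ((d + m)%N.-tuple R)%type Xi P (Q i) (d + m)%N
  key K E mE ET EI (sampling_D0_independent samp)
  (past t) S1 (fun j => Some (t.+1, i, j)) (xi t.+1 i) (@pastK t) _ _ _ _ _ _
  (fun w => row_tuple (row i (zmx t.+1 w))) (fun=> 0%R) _ _ (psi_full i) (fun=> 0%R) (fun=> (sigma ^+ 2)%R)
  _ _ _ _ (psi_full_mean i) (psi_full_sqr i) (S1%:R^-1)%R.
rewrite (full_sqr S10) => H; apply: le_trans (H _ _ _ _ _ _ _ _ _ _ _ _) => {H} //.
- rewrite le_eqVlt; apply/orP; left; apply/eqP; apply: eq_integral => w _; congr (fnorm _ ^+ 2)%:E.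
  rewrite add0r /grad_err linearB /= (iter_V_full iter)// row_grad_mx.
  rewrite /psi_full row_tupleK; under [in RHS]eq_bigr do rewrite subr0.
  by rewrite scale_sum_sub.
- by move=> j jS; rewrite /K /= /used_sample /= tq.
- by move=> j jS /=; rewrite ltnn.
- by move=> j j' [].
- by move=> j jS; apply: (sampling_measurable samp); rewrite bt.
- by move=> j jS; apply: (sampling_law samp); rewrite bt.
- by apply: measurable_row_tuple; apply: measurable_mx_row; exact: adaptedZS.
- by move=> u k; exact: (oracle_sub_integrable uG).
Qed.

Let psi_vr i (u : ((d + m)%N.-tuple R * (d + m)%N.-tuple R)%type) s :=
  (G i (tuple_row u.1) s - G i (tuple_row u.2) s)%R.

Let mpsi_vr i (u : ((d + m)%N.-tuple R * (d + m)%N.-tuple R)%type) :=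
  (grad (f i) (tuple_row u.1) - grad (f i) (tuple_row u.2))%R.

(** The new error is the old one plus an average of centered differences of oracle values at two
    frozen points. The old error belongs to the past, so the squares add up, and the mean-squared
    Lipschitz property bounds the differences. *)
Lemma grad_err_vr t i : (t %% q <> 0)%N ->
  \int[P]_w (fnorm (row i (grad_err t.+1 w)) ^+ 2)%:E <=
  \int[P]_w (fnorm (row i (grad_err t w)) ^+ 2)%:E +
  (S2%:R^-1)%:E * \int[P]_w (L ^+ 2 * fnorm (row i (zmx t.+1 w) - row i (zmx t w)) ^+ 2)%:E.
Proof.
move=> tq.
have bt : batch_size S1 S2 q t.+1 = S2 by rewrite /= (introF eqP tq).
pose U w := (row_tuple (row i (zmx t.+1 w)), row_tuple (row i (zmx t w))).
pose v (u : ((d + m)%N.-tuple R * (d + m)%N.-tuple R)%type) :=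
  (L ^+ 2 * fnorm (tuple_row u.1 - tuple_row u.2) ^+ 2)%R.
have H : \int[P]_w (fnorm (row i (grad_err t w) +
      S2%:R^-1 *: \sum_(l < S2) (psi_vr i (U w) (xi t.+1 i l w) - mpsi_vr i (U w))) ^+ 2)%:E
    <= \int[P]_w (fnorm (row i (grad_err t w)) ^+ 2)%:E +
    (S2%:R * S2%:R^-1 ^+ 2)%:E * \int[P]_w (v (U w))%:E.
  apply: (@minibatch_second_moment R _ _ _ Omega _ Xi P (Q i) _ key K E mE ET EI
    (sampling_D0_independent samp) (past t) S2 (fun j => Some (t.+1, i, j)) (xi t.+1 i)) => //.
  - by move=> j jS; rewrite /K /= /used_sample bt.
  - by move=> j jS /=; rewrite ltnn.
  - by move=> j j' [].
  - by move=> j jS; apply: (sampling_measurable samp); rewrite bt.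
  - by move=> j jS; apply: (sampling_law samp); rewrite bt.
  - apply: measurable_fun_pair; apply: measurable_row_tuple; apply: measurable_mx_row.
      exact: adaptedZS.
    exact: adaptedZ.
  - by apply: measurable_mx_row; exact: adapted_err.
  - apply: measurable_mxB => i' k.
      have mp : measurable_fun [set: (((d + m)%N.-tuple R * (d + m)%N.-tuple R) * Xi)%type]
        (fun p => (p.1.1, p.2)).
        by apply: measurable_fun_pair => //; exact: measurableT_comp.
      exact: (measurableT_comp (oracle_measurable mG i i' k) mp).
    have mp : measurable_fun [set: (((d + m)%N.-tuple R * (d + m)%N.-tuple R) * Xi)%type]
      (fun p => (p.1.2, p.2)).
      by apply: measurable_fun_pair => //; exact: measurableT_comp.
    exact: (measurableT_comp (oracle_measurable mG i i' k) mp).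
  - apply: measurable_mxB => i' k.
      exact: (measurableT_comp (grad_measurable mG uG i i' k) measurable_fst).
    exact: (measurableT_comp (grad_measurable mG uG i i' k) measurable_snd).
  - apply: measurable_funM => //; apply: measurable_mx_fnorm.
    apply: measurable_mxB; apply: measurable_tuple_row.
      exact: measurable_fst.
    exact: measurable_snd.
  - by move=> u k; exact: (oracle_diff_integrable uG).
  - by move=> u k; exact: (oracle_diff_mean uG).
  - move=> u; have := lG i (tuple_row u.1) (tuple_row u.2).
    by rewrite expectation.unlock.
apply: le_trans (le_trans H _).
  rewrite le_eqVlt; apply/orP; left; apply/eqP; apply: eq_integral => w _; congr (fnorm _ ^+ 2)%:E.
  rewrite /grad_err [row i (V t.+1 w - _)%R]linearB [row i (V t w - _)%R]linearB /= (iter_V_vr iter)// !row_grad_mx -/(zmx t.+1 w) -/(zmx t w).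
  rewrite /psi_vr /mpsi_vr /U /= !row_tupleK scale_sum_sub//.
  by rewrite opprB [in RHS]addrACA addKr.
have -> : (S2%:R * S2%:R^-1 ^+ 2 = S2%:R^-1 :> R)%R.
  by field; rewrite pnatr_eq0 -lt0n.
suff <- : \int[P]_w (v (U w))%:E = \int[P]_w (L ^+ 2 *
    fnorm (row i (zmx t.+1 w) - row i (zmx t w)) ^+ 2)%:E by [].
by apply: eq_integral => w _; rewrite /v /U /= !row_tupleK.
Qed.

Hypothesis M0 : (0 < M)%N.

Let MR0 : (0 <= M%:R^-1 :> R)%R. Proof. by rewrite invr_ge0. Qed.

Let mean_le (c : R) (h : Omega -> 'M[R]_(M, (d + m)%N)) : measurable_mx h ->
  (forall i, \int[P]_w (fnorm (row i (h w)) ^+ 2)%:E <= c%:E) ->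
  \int[P]_w (M%:R^-1 * fnorm (h w) ^+ 2)%:E <= c%:E.
Proof.
move=> mh hc; rewrite integral_fnorm_rows//.
apply: (@le_trans _ _ ((M%:R^-1)%:E * \sum_(i < M) c%:E)).
  by apply: lee_wpmul2l; [rewrite lee_fin|apply: lee_sum => i _].
by rewrite sumEFin sumr_const card_ord -EFinM -(mulr_natl c M) mulKf// pnatr_eq0 -lt0n.
Qed.

Lemma mean_grad_err_init :
  \int[P]_w (M%:R^-1 * fnorm (grad_err 0 w) ^+ 2)%:E <= (sigma ^+ 2 / S1%:R)%:E.
Proof. by apply: mean_le => [|i]; [exact: grad_err_measurable|exact: grad_err_init]. Qed.

Lemma mean_grad_err_full t : (t %% q = 0)%N ->
  \int[P]_w (M%:R^-1 * fnorm (grad_err t.+1 w) ^+ 2)%:E <= (sigma ^+ 2 / S1%:R)%:E.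
Proof.
by move=> tq; apply: mean_le => [|i]; [exact: grad_err_measurable|exact: grad_err_full].
Qed.

Let mean_le_add (c : R) (h1 h0 hd : Omega -> 'M[R]_(M, (d + m)%N)) : (0 <= c)%R ->
  measurable_mx h1 -> measurable_mx h0 -> measurable_mx hd ->
  (forall i, \int[P]_w (fnorm (row i (h1 w)) ^+ 2)%:E <=
    \int[P]_w (fnorm (row i (h0 w)) ^+ 2)%:E +
      c%:E * \int[P]_w (fnorm (row i (hd w)) ^+ 2)%:E) ->
  \int[P]_w (M%:R^-1 * fnorm (h1 w) ^+ 2)%:E <=
    \int[P]_w (M%:R^-1 * fnorm (h0 w) ^+ 2)%:E +
    c%:E * \int[P]_w (M%:R^-1 * fnorm (hd w) ^+ 2)%:E.
Proof.
move=> c0 m1 m0 md hi; have sum0 (h : Omega -> 'M[R]_(M, (d + m)%N)) :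
    0 <= \sum_(i < M) \int[P]_w (fnorm (row i (h w)) ^+ 2)%:E.
  by apply: sume_ge0 => i _; apply: integral_ge0 => w _; rewrite lee_fin sqr_ge0.
rewrite !integral_fnorm_rows// muleCA -ge0_muleDr ?mule_ge0//.
apply: lee_wpmul2l; first by rewrite lee_fin.
rewrite ge0_sume_distrr => [|i _]; last first.
  by apply: integral_ge0 => w _; rewrite lee_fin sqr_ge0.
by rewrite -big_split /=; apply: lee_sum => i _.
Qed.

Lemma mean_grad_err_vr t : (t %% q <> 0)%N ->
  \int[P]_w (M%:R^-1 * fnorm (grad_err t.+1 w) ^+ 2)%:E <=
  \int[P]_w (M%:R^-1 * fnorm (grad_err t w) ^+ 2)%:E +
  (L ^+ 2 / S2%:R)%:E * \int[P]_w (M%:R^-1 * fnorm (zmx t.+1 w - zmx t w) ^+ 2)%:E.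
Proof.
move=> tq.
have mz i : measurable_fun setT (fun w => (fnorm (row i (zmx t.+1 w - zmx t w)%R) ^+ 2)%:E).
  apply/measurable_EFinP; apply: measurable_mx_fnorm; apply: measurable_mx_row.
  by apply: measurable_mxB; exact: zmx_measurable.
apply: (mean_le_add (hd := fun w => zmx t.+1 w - zmx t w)%R) => [||||i].
- by rewrite divr_ge0 ?sqr_ge0.
- exact: grad_err_measurable.
- exact: grad_err_measurable.
- by apply: measurable_mxB; exact: zmx_measurable.
have -> : (L ^+ 2 / S2%:R)%:E * \int[P]_w (fnorm (row i (zmx t.+1 w - zmx t w)%R) ^+ 2)%:E =
  (S2%:R^-1)%:E * \int[P]_w (L ^+ 2 * fnorm (row i (zmx t.+1 w) - row i (zmx t w)) ^+ 2)%:E.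
  rewrite mulrC EFinM -muleA; congr (_ * _).
  rewrite -ge0_integralZl_EFin ?sqr_ge0// => [|w _]; last by rewrite lee_fin sqr_ge0.
  by apply: eq_integral => w _; rewrite linearB.
exact: grad_err_vr.
Qed.

End Iterates.

(* s is the contraction rate mu * eta_y and w = eta_y / mu *)
Lemma distance_recursion (R : realType) (s w dl P P1 P2 N Q nv q : R) :
  0 < s -> s <= 1 / 100 -> 0 < w -> 0 <= dl -> 0 <= N -> 0 <= Q ->
  P <= (1 - s) * dl -> nv <= s * w * (2 * N) -> q <= Q ->
  P1 <= (1 + s / 2) * P + (1 + (s / 2)^-1) * nv ->
  P2 <= (1 + s / 4) * P1 + (1 + (s / 4)^-1) * q ->
  P2 <= (1 - s / 4) * dl + (5 * w * N + 5 * (s^-1 * Q)).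
Proof.
move=> s0 s1 w0 dl0 N0 Q0 hP hnv hq hP1 hP2.
have e1 : (1 + (s / 2)^-1) * (s * w * (2 * N)) = (s + 2) * (2 * (w * N)).
  by field; rewrite gt_eqF.
have e2 : (1 + (s / 4)^-1) * Q = (s + 4) * (s^-1 * Q) by field; rewrite gt_eqF.
have wN0 : 0 <= w * N by rewrite mulr_ge0// ltW.
have sQ0 : 0 <= s^-1 * Q by rewrite mulr_ge0// invr_ge0 ltW.
have i1 : 0 <= 1 + (s / 2)^-1 by rewrite addr_ge0// invr_ge0 divr_ge0// ltW.
have i2 : 0 <= 1 + (s / 4)^-1 by rewrite addr_ge0// invr_ge0 divr_ge0// ltW.
have hP1' : P1 <= (1 + s / 2) * ((1 - s) * dl) + (s + 2) * (2 * (w * N)).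
  apply: le_trans hP1 _; rewrite -e1; apply: lerD; last exact: ler_wpM2l.
  by apply: ler_wpM2l => //; lra.
apply: le_trans hP2 _.
apply: (@le_trans _ _ ((1 + s / 4) * ((1 + s / 2) * ((1 - s) * dl) + (s + 2) * (2 * (w * N))) +
    (s + 4) * (s^-1 * Q))).
  rewrite -e2; apply: lerD; last exact: ler_wpM2l.
  by apply: ler_wpM2l => //; lra.
rewrite -[5 * w * N]mulrA; move: (w * N) (s^-1 * Q) wN0 sQ0 => x y x0 y0.
(* The two Young weights s/2 and s/4 spend three quarters of the contraction s; the leftover terms
   of order s^2 and s^3 are negative. *)
have h1 : (1 + s / 4) * ((1 + s / 2) * ((1 - s) * dl)) <= (1 - s / 4) * dl.
  have -> : (1 + s / 4) * ((1 + s / 2) * ((1 - s) * dl)) =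
    ((1 + s / 4) * ((1 + s / 2) * (1 - s))) * dl by ring.
  by rewrite ler_wpM2r//; nra.
have h2 : (1 + s / 4) * ((s + 2) * (2 * x)) <= 5 * x.
  have -> : (1 + s / 4) * ((s + 2) * (2 * x)) = ((1 + s / 4) * ((s + 2) * 2)) * x by ring.
  by rewrite ler_wpM2r//; nra.
have h3 : (s + 4) * y <= 5 * y by rewrite ler_wpM2r//; lra.
by rewrite mulrDr; lra.
Qed.

(** * One-step inequalities along a trajectory *)

Section PathwiseSteps.
Variables (R : realType) (M d m : nat) (L mu rho eta_x eta_y : R).
Variables (f : 'I_M -> 'rV[R]_(d + m) -> R) (e : rel 'I_M) (W : 'M[R]_M).
Variables (X : nat -> 'M[R]_(M, d)) (Y : nat -> 'M[R]_(M, m)).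
Variables (V D : nat -> 'M[R]_(M, d + m)).
Let kappa := L / mu.
Let F := avg_fun f.
Let Pi := avg_mx R M.
Hypotheses (M0 : (0 < M)%N) (m0 : (0 < m)%N) (L0 : 0 < L) (mu0 : 0 < mu).
Hypothesis df : forall i z, differentiable (f i) z.
Hypothesis sf : forall i, smooth L (f i).
Hypothesis cf : forall i x, strongly_concave mu (fun y : 'rV[R]_m => f i (row_mx x y)).
Hypothesis mW : mixing_matrix e rho W.
Hypotheses (eta_y0 : 0 < eta_y) (eta_x0 : 0 < eta_x).
Hypothesis (eta_xy : eta_x <= eta_y).
Hypothesis iter_mean : Pi *m D 0%N = Pi *m V 0%N.
Hypothesis XS : forall t, X t.+1 = W *m X t - eta_x *: lsubmx (D t).
Hypothesis YS : forall t, Y t.+1 = W *m Y t + eta_y *: rsubmx (D t).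
Hypothesis DS : forall t, D t.+1 = W *m (D t + V t.+1 - V t).

Let MR0 : 0 < M%:R^-1 :> R. Proof. by rewrite invr_gt0 ltr0n. Qed.
Let dF z : differentiable F z. Proof. exact: differentiable_avg_fun. Qed.
Let sF : smooth L F. Proof. exact: smooth_avg_fun. Qed.
Let cF x : strongly_concave mu (fun y : 'rV[R]_m => F (row_mx x y)).
Proof. exact: strongly_concave_avg_fun. Qed.
Let muL : mu <= L. Proof. exact: (smooth_ge_strongly_concave L0 mu0 dF sF cF m0). Qed.

Let perp n (A : 'M[R]_(M, n)) := A - Pi *m A.
Let Z t := row_mx (X t) (Y t).
Let err t := V t - grad_mx f (Z t).
Let vb t := row_mean (V t).
Let xb t := row_mean (X t).
Let yb t := row_mean (Y t).

Definition path_a t := M%:R^-1 * fnorm (perp (Z t)) ^+ 2.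
Definition path_b t := M%:R^-1 * fnorm (perp (D t)) ^+ 2.
Definition path_ep t := M%:R^-1 * fnorm (err t) ^+ 2.
Definition path_dz t := M%:R^-1 * fnorm (Z t.+1 - Z t) ^+ 2.
Definition path_gx t := fnorm (lsubmx (vb t)) ^+ 2.
Definition path_gy t := fnorm (rsubmx (vb t)) ^+ 2.
Definition path_dl t := fnorm (ystar F (xb t) - yb t) ^+ 2.
Definition path_g t := fnorm (grad (Phi F) (xb t)) ^+ 2.
Definition path_ph t := Phi F (xb t).

Let perpD n (A B : 'M[R]_(M, n)) : perp (A + B) = perp A + perp B.
Proof. by rewrite /perp mulmxDr opprD addrACA. Qed.

Let perp_le n (A : 'M[R]_(M, n)) : fnorm (perp A) <= fnorm A.
Proof.
apply: fnorm_le_sqr; first exact: fnorm_ge0.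
by rewrite [leRHS](fnorm_avg_decomp M0) lerDl mulr_ge0 ?ler0n ?sqr_ge0.
Qed.

Let r01 : 0 < 1 - rho <= 1.
Proof. by have /andP[r0 r1] := mixing_rho01 mW; rewrite subr_gt0 r1 gerBl. Qed.

Let contract n (A B : 'M[R]_(M, n)) x : fnorm (perp B) <= x ->
  fnorm (perp (W *m A + B)) ^+ 2 <=
    (1 - (1 - rho)) * fnorm (perp A) ^+ 2 + (1 - rho)^-1 * x ^+ 2.
Proof.
move=> Bx; apply: le_trans (sqrr_young _ _ r01).
have /andP[r0 _] := mixing_rho01 mW.
have x0 : 0 <= x by apply: le_trans Bx; exact: fnorm_ge0.
rewrite subKr perpD ler_pXn2r ?nnegrE ?fnorm_ge0//.
  by apply: le_trans (fnormD _ _) _; rewrite lerD// (mixing_contract M0 mW).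
by rewrite addr_ge0 ?mulr_ge0 ?fnorm_ge0.
Qed.

Let grad_mx_lip (A B : 'M[R]_(M, d + m)) :
  fnorm (grad_mx f A - grad_mx f B) ^+ 2 <= L ^+ 2 * fnorm (A - B) ^+ 2.
Proof.
rewrite fnorm_sum_row (fnorm_sum_row (A - B)) mulr_sumr; apply: ler_sum => i _.
rewrite !linearB /= !row_grad_mx -exprMn ler_pXn2r ?nnegrE ?mulr_ge0 ?fnorm_ge0 ?(ltW L0)//.
exact: sf.
Qed.

(** Invariant of gradient tracking: mixing preserves averages and the increments of V telescope, so
    the averaged iterates move exactly along the averaged estimate. *)
Let mean_D t : row_mean (D t) = vb t.
Proof.
elim: t => [|t IH].
  by rewrite /vb -(row_avg_mx (D 0%N) (Ordinal M0)) iter_mean row_avg_mx.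
rewrite DS (row_mean_mixing M0 mW) row_meanD row_meanD row_meanN IH /vb.
by rewrite addrAC subrr add0r.
Qed.

Let xbS t : xb t.+1 = xb t - eta_x *: lsubmx (vb t).
Proof.
rewrite /xb XS row_meanD row_meanN row_meanZ (row_mean_mixing M0 mW).
by rewrite -lsubmx_row_mean mean_D.
Qed.

Let ybS t : yb t.+1 = yb t + eta_y *: rsubmx (vb t).
Proof.
by rewrite /yb YS row_meanD row_meanZ (row_mean_mixing M0 mW) -rsubmx_row_mean mean_D.
Qed.

Let H t := row_mx (- eta_x *: lsubmx (D t)) (eta_y *: rsubmx (D t)).

Let ZS t : Z t.+1 = W *m Z t + H t.
Proof. by rewrite /Z XS YS /H mul_mx_row add_row_mx scaleNr. Qed.

(** The increment of V is the new error, minus the old one, plus a difference of gradients at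
    successive points; squaring three terms gives the 3. Mixing acts on this increment too, and its
    factor rho is bounded by 1. *)
Lemma path_step_b t : path_b t.+1 <= (1 - (1 - rho)) * path_b t +
  (1 - rho)^-1 * (3 * (path_ep t.+1 + path_ep t + L ^+ 2 * path_dz t)).
Proof.
set dV := V t.+1 - V t.
have DE : fnorm (perp (D t.+1)) <= rho * fnorm (perp (D t)) + rho * fnorm dV.
  rewrite DS -addrA -/dV; apply: le_trans (mixing_contract M0 mW _) _.
  rewrite -/Pi -/(perp _) perpD -mulrDr; have /andP[r0 _] := mixing_rho01 mW.
  apply: ler_wpM2l => //; apply: le_trans (fnormD _ _) _.
  by rewrite lerD2l.
have {}DE : fnorm (perp (D t.+1)) ^+ 2 <=
    (1 - (1 - rho)) * fnorm (perp (D t)) ^+ 2 + (1 - rho)^-1 * fnorm dV ^+ 2.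
  apply: le_trans (sqrr_young _ _ r01); rewrite subKr.
  have /andP[r0 r1] := mixing_rho01 mW.
  rewrite ler_pXn2r ?nnegrE ?fnorm_ge0//; last first.
    by rewrite addr_ge0 ?mulr_ge0 ?fnorm_ge0.
  apply: le_trans DE _; rewrite lerD2l ler_piMl ?fnorm_ge0//; exact: ltW.
have dVE : fnorm dV ^+ 2 <= 3 * (fnorm (err t.+1) ^+ 2 + fnorm (err t) ^+ 2 +
    L ^+ 2 * fnorm (Z t.+1 - Z t) ^+ 2).
  have -> : dV = err t.+1 + (- err t) + (grad_mx f (Z t.+1) - grad_mx f (Z t)).
    rewrite /dV /err; move: (grad_mx f _) (grad_mx f _) (V t.+1) (V t) => A B v' v.
    by apply/matrixP => i j; rewrite !mxE; ring.
  apply: le_trans (fnorm3_sqr _ _ _) _; rewrite fnormN ler_wpM2l//.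
  by rewrite lerD2l.
have /andP[r0 r1] := r01.
apply: (@le_trans _ _ (M%:R^-1 * ((1 - (1 - rho)) * fnorm (perp (D t)) ^+ 2 +
   (1 - rho)^-1 * (3 * (fnorm (err t.+1) ^+ 2 + fnorm (err t) ^+ 2 +
    L ^+ 2 * fnorm (Z t.+1 - Z t) ^+ 2))))).
  rewrite ler_pM2l//; apply: le_trans DE _.
  by rewrite lerD2l ler_pM2l ?invr_gt0.
rewrite /path_b /path_ep /path_dz le_eqVlt; apply/orP; left; apply/eqP.
by move: (fnorm _) (fnorm _) (fnorm _) (fnorm _) (1 - rho) => x1 x2 x3 x4 r; ring.
Qed.

(** The x- and y-blocks move with different stepsizes; eta_x <= eta_y allows a single factor for
    both. *)
Let perpH t : fnorm (perp (H t)) <= eta_y * fnorm (perp (D t)).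
Proof.
apply: fnorm_le_sqr; first by rewrite mulr_ge0 ?fnorm_ge0// ltW.
rewrite /perp /H mul_mx_row opp_row_mx add_row_mx fnorm_row_mx.
rewrite -!scalemxAr -!scalerBr !mulmx_lsub mulmx_rsub -!linearB /= !fnormZ normrN.
rewrite !gtr0_norm// !exprMn (fnorm_sub_mx (D t - _)) mulrDr lerD2r.
by rewrite ler_wpM2r ?sqr_ge0// ler_pXn2r ?nnegrE ?(ltW eta_x0) ?(ltW eta_y0).
Qed.

Lemma path_step_a t : path_a t.+1 <= (1 - (1 - rho)) * path_a t +
  (1 - rho)^-1 * (eta_y ^+ 2 * path_b t).
Proof.
rewrite /path_a ZS; have := contract (Z t) (perpH t).
rewrite -(ler_pM2l MR0) => /le_trans; apply.
rewrite /path_b le_eqVlt; apply/orP; left; apply/eqP.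
by move: (fnorm _) (fnorm _) => x1 x2; ring.
Qed.

(** Mixing displaces Z by at most twice its deviation, whence 8 = 2 * 2^2; the gradient displacement
    splits orthogonally into its deviation and its mean. *)
Lemma path_bound_dz t : path_dz t <= 8 * path_a t + 2 * eta_y ^+ 2 * path_b t +
  2 * (eta_x ^+ 2 * path_gx t + eta_y ^+ 2 * path_gy t).
Proof.
have Hm : fnorm (row_mean (H t)) ^+ 2 = eta_x ^+ 2 * path_gx t + eta_y ^+ 2 * path_gy t.
  rewrite /H row_mean_row_mx fnorm_row_mx !row_meanZ -lsubmx_row_mean -rsubmx_row_mean.
  by rewrite mean_D !fnormZ !exprMn !real_normK ?num_real// sqrrN.
have HE : fnorm (H t) ^+ 2 <= eta_y ^+ 2 * fnorm (perp (D t)) ^+ 2 +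
    M%:R * (eta_x ^+ 2 * path_gx t + eta_y ^+ 2 * path_gy t).
  rewrite (fnorm_avg_decomp M0) Hm lerD2r -exprMn ler_pXn2r ?nnegrE ?fnorm_ge0 ?perpH//.
  by rewrite mulr_ge0 ?fnorm_ge0// ltW.
have dE : fnorm (Z t.+1 - Z t) ^+ 2 <= 2 * (4 * fnorm (perp (Z t)) ^+ 2 + fnorm (H t) ^+ 2).
  rewrite ZS addrAC; apply: le_trans (fnormD_sqr _ _) _.
  rewrite ler_wpM2l// lerD2r.
  have -> : 4 * fnorm (perp (Z t)) ^+ 2 = (2 * fnorm (perp (Z t))) ^+ 2 by ring.
  by rewrite ler_pXn2r ?nnegrE ?mulr_ge0 ?fnorm_ge0// (mixing_sub_id M0 mW).
apply: (@le_trans _ _ (M%:R^-1 * (2 * (4 * fnorm (perp (Z t)) ^+ 2 +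
  (eta_y ^+ 2 * fnorm (perp (D t)) ^+ 2 + M%:R * (eta_x ^+ 2 * path_gx t + eta_y ^+ 2 * path_gy t)))))).
  by rewrite ler_pM2l//; apply: le_trans dE _; rewrite ler_wpM2l// lerD2l.
rewrite /path_a /path_b le_eqVlt; apply/orP; left; apply/eqP.
move: (fnorm _) (fnorm _) (path_gx t) (path_gy t) => x1 x2 x3 x4.
by field; rewrite pnatr_eq0 -lt0n.
Qed.

Let verr t := vb t - grad F (row_mx (xb t) (yb t)).

(** Replacing each z_i by the average point costs L times the consensus error, and the rest is the
    averaged estimation error; Jensen handles both means. *)
Let verr_le t : fnorm (verr t) ^+ 2 <= 2 * (L ^+ 2 * path_a t + path_ep t).
Proof.
have -> : verr t = row_mean (grad_mx f (Z t) - grad_mx f (Pi *m Z t)) + row_mean (err t).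
  rewrite -row_meanD /err addrC -addrA (addrA (- _)) addNr add0r.
  rewrite row_meanD row_meanN /verr; congr (_ - _); rewrite grad_avg_fun// /row_mean.
  congr (_ *: _); apply: eq_bigr => i _; rewrite row_grad_mx row_avg_mx.
  by rewrite /Z row_mean_row_mx.
apply: le_trans (fnormD_sqr _ _) _; rewrite ler_wpM2l//; apply: lerD.
  apply: le_trans (fnorm_row_mean M0 _) _; rewrite /path_a [leRHS]mulrCA ler_pM2l//.
exact: fnorm_row_mean.
Qed.

Let fnorm_row0 (y : 'rV[R]_m) (x : 'rV[R]_d) (y' : 'rV[R]_m) :
  fnorm (row_mx x y - row_mx x y') = fnorm (y - y').
Proof.
rewrite opp_row_mx add_row_mx subrr.
apply/eqP; rewrite -(eqrXn2 (ltn0Sn 1)) ?fnorm_ge0// fnorm_row_mx.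
by rewrite fnorm0 expr0n add0r.
Qed.

Let grad_dl t : fnorm (grad F (row_mx (xb t) (yb t)) -
    grad F (row_mx (xb t) (ystar F (xb t)))) ^+ 2 <= L ^+ 2 * path_dl t.
Proof.
rewrite /path_dl fnormB -exprMn ler_pXn2r ?nnegrE ?mulr_ge0 ?fnorm_ge0 ?(ltW L0)//.
by apply: le_trans (sF _ _) _; rewrite fnorm_row0.
Qed.

(** A single comparison with the gradient at the maximizer serves both blocks: its y-part there is 0
    and its x-part is the gradient of [Phi]. *)
Let vstar_le t :
  fnorm (vb t - grad F (row_mx (xb t) (ystar F (xb t)))) ^+ 2 <=
    3 * (L ^+ 2 * path_dl t + L ^+ 2 * path_a t + path_ep t).
Proof.
have := fnormD_sqr_weighted (grad F (row_mx (xb t) (yb t)) -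
  grad F (row_mx (xb t) (ystar F (xb t)))) (verr t).
have -> : grad F (row_mx (xb t) (yb t)) - grad F (row_mx (xb t) (ystar F (xb t))) +
    verr t = vb t - grad F (row_mx (xb t) (ystar F (xb t))).
  by rewrite /verr addrC addrA subrK.
move: (verr_le t) (grad_dl t).
move: (fnorm _) (fnorm _) (fnorm _) (L ^+ 2 * path_a t) (L ^+ 2 * path_dl t) (path_ep t).
by move=> x1 x2 x3 x4 x5 x6; lra.
Qed.

Lemma path_bound_gy t :
  path_gy t <= 3 * (L ^+ 2 * path_dl t + L ^+ 2 * path_a t + path_ep t).
Proof.
apply: le_trans (vstar_le t); rewrite /path_gy.
rewrite -[rsubmx (vb t)]subr0 -(grad_ystar L0 mu0 dF sF cF (xb t)) -linearB /=.
by rewrite ler_pXn2r ?nnegrE ?fnorm_ge0// fnorm_rsubmx.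
Qed.

(** Expansion of [Phi] along the averaged step. Polarizing the inner product of the gradient with v
    yields both negative squares and leaves only their distance as error. *)
Lemma path_step_ph t : path_ph t.+1 <= path_ph t - eta_x / 2 * path_g t -
  eta_x / 2 * path_gx t +
  eta_x / 2 * (3 * (L ^+ 2 * path_dl t + L ^+ 2 * path_a t + path_ep t)) +
  2 * kappa * L * eta_x ^+ 2 * path_gx t.
Proof.
set u := - eta_x *: lsubmx (vb t).
have := Phi_bound L0 mu0 dF sF cF muL (xb t) u.
have -> : xb t + u = xb t.+1 by rewrite xbS /u scaleNr.
rewrite -(grad_Phi L0 mu0 dF sF cF muL) ler_norml => /andP[_].
rewrite /u fnormZ exprMn real_normK ?num_real// sqrrN dotZr.
rewrite -/(path_ph t.+1) -/(path_ph t) -/(path_gx t) -/kappa.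
set p := grad (Phi F) (xb t).
have pE : fnorm (p - lsubmx (vb t)) ^+ 2 <=
    3 * (L ^+ 2 * path_dl t + L ^+ 2 * path_a t + path_ep t).
  apply: le_trans (vstar_le t).
  rewrite /p (grad_Phi L0 mu0 dF sF cF muL) fnormB -linearB /=.
  by rewrite ler_pXn2r ?nnegrE ?fnorm_ge0// fnorm_lsubmx.
have pvE : dot p (lsubmx (vb t)) = 2^-1 * (path_g t + path_gx t - fnorm (p - lsubmx (vb t)) ^+ 2).
  exact: dot_polar.
rewrite pvE; move: (ler_wpM2l (ltW eta_x0) pE).
move: (fnorm _) (path_g t) (path_gx t) (path_ph _) (path_ph _) (_ + path_ep t) => x1 x2 x3 x4 x5 x6.
lra.
Qed.

Hypothesis eta_kappa : L * kappa * eta_y <= 1 / 100.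

(** Three effects: an exact ascent step contracts, the gradient error perturbs it, and the maximizer
    drifts by at most kappa times the x-step. Two Young inequalities, weighted by s/2 and s/4 with s
    = mu eta_y, combine them. *)
Lemma path_step_dl t : path_dl t.+1 <= (1 - mu * eta_y / 4) * path_dl t +
  (5 * (eta_y / mu) * (L ^+ 2 * path_a t + path_ep t) +
   5 * (kappa ^+ 2 / (mu * eta_y)) * eta_x ^+ 2 * path_gx t).
Proof.
have s0 : 0 < mu * eta_y by rewrite mulr_gt0.
have Lk : L ^+ 2 * eta_y = mu * (L * kappa * eta_y).
  by rewrite /kappa; field; rewrite gt_eqF.
have s1 : mu * eta_y <= 1 / 100.
  apply: le_trans eta_kappa; rewrite ler_pM2r//.
  apply: le_trans muL _; rewrite ler_peMr ?(ltW L0)//.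
  by rewrite /kappa ler_pdivlMr// mul1r.
have Le : L ^+ 2 * eta_y <= mu.
  by rewrite Lk ler_piMr ?(ltW mu0)//; apply: le_trans eta_kappa _; lra.
have c1 := gradient_ascent_contraction L0 mu0 dF sF cF (xb t) (yb t) eta_y0 Le.
have vE : fnorm (rsubmx (verr t)) ^+ 2 <= 2 * (L ^+ 2 * path_a t + path_ep t).
  apply: le_trans (verr_le t).
  by rewrite ler_pXn2r ?nnegrE ?fnorm_ge0// fnorm_rsubmx.
have y2E : yb t.+1 = yb t + eta_y *: rsubmx (grad F (row_mx (xb t) (yb t))) +
    eta_y *: rsubmx (verr t).
  by rewrite ybS /verr linearB /= scalerBr -addrA subrKC.
have ylE : fnorm (ystar F (xb t) - ystar F (xb t.+1)) ^+ 2 <=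
    kappa ^+ 2 * (eta_x ^+ 2 * path_gx t).
  have := ystar_lipschitz L0 mu0 dF sF cF (xb t) (xb t.+1).
  rewrite xbS opprB subrKC fnormZ (gtr0_norm eta_x0) -/kappa => yl.
  rewrite /path_gx -!exprMn ler_pXn2r ?nnegrE ?fnorm_ge0//.
  by rewrite mulr_ge0 ?(mulr_ge0 (ltW eta_x0)) ?fnorm_ge0// /kappa divr_ge0 ?ltW.
have N0 : 0 <= L ^+ 2 * path_a t + path_ep t.
  by rewrite addr_ge0 ?(mulr_ge0 (sqr_ge0 L))// mulr_ge0 ?sqr_ge0// ltW.
have Q0 : 0 <= kappa ^+ 2 * (eta_x ^+ 2 * path_gx t).
  by rewrite (mulr_ge0 (sqr_ge0 _))// (mulr_ge0 (sqr_ge0 _))// sqr_ge0.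
move: c1 ylE; rewrite /path_dl (fnormB _ (yb t.+1)) (fnormB _ (yb t)) y2E.
move: (ystar F (xb t)) (ystar F (xb t.+1)) => ys ys'.
set y1 := yb t + _; set v := eta_y *: _ => c1 ylE.
have v2 : fnorm v ^+ 2 <= eta_y ^+ 2 * (2 * (L ^+ 2 * path_a t + path_ep t)).
  by rewrite /v fnormZ exprMn real_normK ?num_real// ler_wpM2l ?sqr_ge0.
have e1 : fnorm (y1 - ys + v) ^+ 2 <= _ := fnormD_sqr_young (y1 - ys) v (divr_gt0 s0 (ltr0n _ 2)).
have e2 : fnorm (y1 - ys + v + (ys - ys')) ^+ 2 <= _ :=
  fnormD_sqr_young (y1 - ys + v) (ys - ys') (divr_gt0 s0 (ltr0n _ 4)).
have -> : y1 + v - ys' = y1 - ys + v + (ys - ys').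
  by rewrite [y1 - ys + v]addrAC addrA subrK.
have w0 : 0 < eta_y / mu by rewrite divr_gt0.
have hw : eta_y ^+ 2 = mu * eta_y * (eta_y / mu) by field; rewrite gt_eqF.
rewrite hw in v2.
have -> : 5 * (kappa ^+ 2 * (mu * eta_y)^-1) * eta_x ^+ 2 * path_gx t =
  5 * ((mu * eta_y)^-1 * (kappa ^+ 2 * (eta_x ^+ 2 * path_gx t))) by ring.
exact: (distance_recursion s0 s1 w0 (sqr_ge0 _) N0 Q0 c1 v2 ylE e1 e2).
Qed.

End PathwiseSteps.

(* m t is the variance accumulated since the last full batch; the increment of
   step t is inherited by at most q further steps. *)
Lemma variance_sum (R : realType) (s c : R) (q : nat) (ep dz : nat -> R) T :
  (0 < q)%N -> 0 <= c -> (forall t, 0 <= dz t) ->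
  ep 0%N <= s -> (forall t, (t %% q = 0)%N -> ep t.+1 <= s) ->
  (forall t, (t %% q <> 0)%N -> ep t.+1 <= ep t + c * dz t) ->
  \sum_(t < T) ep t <= T%:R * s + q%:R * c * \sum_(t < T) dz t.
Proof.
move=> q0 c0 dz0 ep0 epfull epvr.
have [m [m00 mS]] : exists m : nat -> R, m 0%N = 0 /\
    forall t, m t.+1 = if (t %% q == 0)%N then 0 else m t + c * dz t.
  by exists (fix m t := if t is u.+1 then
    if (u %% q == 0)%N then 0 else m u + c * dz u else 0).
have m0 t : 0 <= m t.
  elim: t => [|t IH]; first by rewrite m00.
  by rewrite mS; case: ifP => // _; rewrite addr_ge0// mulr_ge0.
have epm t : ep t <= s + m t.
  elim: t => [|t IH]; first by rewrite m00 addr0.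
  rewrite mS; case: eqVneq => [tq|tq]; first by rewrite addr0; exact: epfull.
  apply: le_trans (epvr t (elimN eqP tq)) _; rewrite addrA lerD2r; exact: IH.
(* Potential argument: q - 1 - t mod q counts the later indices before the next reset that still
   inherit [m t.+1]. A reset at step t is visible in [m t.+1], whence the shift by one. *)
have pot t : \sum_(u < t.+2) m u + (q - 1 - t %% q)%:R * m t.+1 <=
    q%:R * c * \sum_(u < t.+1) dz u.
  elim: t => [|t IH].
    rewrite !big_ord_recl !big_ord0 /= mS m00 mod0n eqxx !(addr0, mulr0).
    by rewrite mulr_ge0// mulr_ge0.
  rewrite big_ord_recr [X in _ <= _ * X]big_ord_recr /=.
  have cq0 : 0 <= q%:R * c by rewrite mulr_ge0.
  have [tq|tq] := eqVneq (t.+1 %% q)%N 0%N.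
    rewrite (mS t.+1) tq eqxx addr0 mulr0 addr0 mulrDr.
    apply: (@le_trans _ _ (q%:R * c * \sum_(u < t.+1) dz u)).
      by apply: le_trans IH; rewrite lerDl mulr_ge0.
    by rewrite lerDl mulr_ge0.
  have aE : (t.+1 %% q = (t %% q).+1)%N.
    by move: tq; rewrite modnS; case: ifP.
  have aq : (t.+1 %% q < q)%N by rewrite ltn_mod.
  rewrite [m t.+2]mS (negbTE tq); set a := (t.+1 %% q)%N in aE aq *.
  have qa : (q - 1 - t %% q = (q - 1 - a).+1)%N by lia.
  rewrite qa in IH.
  (* The new increment is counted once now and q - 1 - a times later, at most q times in all. *)
  have h : (q - 1 - a)%:R * (c * dz t.+1) + c * dz t.+1 <= q%:R * c * dz t.+1.
    have -> : (q - 1 - a)%:R * (c * dz t.+1) + c * dz t.+1 =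
      (q - 1 - a).+1%:R * (c * dz t.+1) by rewrite -natr1; ring.
    rewrite -mulrA ler_wpM2r ?mulr_ge0// ler_nat; lia.
  rewrite -natr1 in IH; rewrite !mulrDr; lra.
have mT : \sum_(t < T) m t <= q%:R * c * \sum_(t < T) dz t.
  case: T => [|[|t]]; first by rewrite !big_ord0 mulr0.
    by rewrite !big_ord1 /= m00 mulr_ge0// mulr_ge0.
  apply: (@le_trans _ _ (q%:R * c * \sum_(u < t.+1) dz u)).
    by apply: le_trans (pot t); rewrite lerDl mulr_ge0.
  rewrite ler_wpM2l ?mulr_ge0//.
  by rewrite [leRHS]big_ord_recr /= lerDl.
apply: (@le_trans _ _ (\sum_(t < T) (s + m t))); first by apply: ler_sum => t _.
by rewrite big_split /= sumr_const card_ord mulr_natl lerD2l.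
Qed.

(** * From the pathwise inequality to expectations *)

Section ExpectedAverage.
Context (R : realType) dO (Omega : measurableType dO) (P : probability Omega R).
Local Open Scope ereal_scope.

Let Ex (h : Omega -> R) : R := fine (\int[P]_w (h w)%:E).

Let ExE h : P.-integrable setT (EFin \o h) -> \int[P]_w (h w)%:E = (Ex h)%:E.
Proof. by move=> ih; rewrite fineK//; exact: integrable_fin_num. Qed.

Let int_cst (a : R) : P.-integrable setT (fun=> a%:E).
Proof. exact: finite_measure_integrable_cst. Qed.

Let int_add (h k : Omega -> R) : P.-integrable setT (EFin \o h) ->
  P.-integrable setT (EFin \o k) -> P.-integrable setT (EFin \o (h \+ k)%R).
Proof. by move=> ih ik; apply: (eq_integrable _ ((EFin \o h) \+ (EFin \o k))) => //; exact: integrableD. Qed.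

Let int_scale (a : R) (h : Omega -> R) : P.-integrable setT (EFin \o h) ->
  P.-integrable setT (EFin \o (fun w => a * h w)%R).
Proof.
move=> ih; apply: (eq_integrable _ (fun w => a%:E * (h w)%:E)) => //.
exact: integrableZl.
Qed.

Let int_sum (n : nat) (h : nat -> Omega -> R) :
  (forall t, (t < n)%N -> P.-integrable setT (EFin \o h t)) ->
  P.-integrable setT (EFin \o (fun w => \sum_(t < n) h t w)%R).
Proof.
elim: n => [_|n IH ih].
  apply: (eq_integrable _ (fun=> 0%:E)) => // w _; last by rewrite /= big_ord0.
apply: (eq_integrable _ (EFin \o ((fun w => \sum_(t < n) h t w) \+ h n)%R)) => //.
  by move=> w _ /=; rewrite big_ord_recr.
by apply: int_add; [apply: IH => t tn; apply: ih; exact: ltnW|exact: ih].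
Qed.

Let Ex_add h k : P.-integrable setT (EFin \o h) -> P.-integrable setT (EFin \o k) ->
  Ex (h \+ k)%R = (Ex h + Ex k)%R.
Proof.
move=> ih ik; apply: EFin_inj; rewrite -ExE; last exact: int_add.
by rewrite EFinD -!ExE// -integralD.
Qed.

Let Ex_scale a h : P.-integrable setT (EFin \o h) -> Ex (fun w => a * h w)%R = (a * Ex h)%R.
Proof.
move=> ih; apply: EFin_inj; rewrite -ExE; last exact: int_scale.
by rewrite EFinM -!ExE// -integralZl.
Qed.

Let Ex_cst (a : R) : Ex (fun=> a) = a.
Proof.
rewrite /Ex; transitivity (fine (a%:E * P setT)); last by rewrite (probability_setT P) mule1.
by congr fine; exact: (@integral_cst _ _ _ P setT measurableT a%:E).
Qed.

Let Ex_sum (n : nat) (h : nat -> Omega -> R) :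
  (forall t, (t < n)%N -> P.-integrable setT (EFin \o h t)) ->
  Ex (fun w => \sum_(t < n) h t w)%R = (\sum_(t < n) Ex (h t))%R.
Proof.
elim: n => [_|n IH ih].
  by rewrite big_ord0 -[RHS]Ex_cst; congr Ex; apply/funext => w; rewrite big_ord0.
rewrite big_ord_recr /= -IH => [|t tn]; last by apply: ih; exact: ltnW.
rewrite -Ex_add; last exact: ih; last by apply: int_sum => t tn; apply: ih; exact: ltnW.
by congr Ex; apply/funext => w; rewrite big_ord_recr.
Qed.

Let ge0_integrable (h : Omega -> R) : (forall w, (0 <= h w)%R) -> measurable_fun setT h ->
  \int[P]_w (h w)%:E < +oo -> P.-integrable setT (EFin \o h).
Proof.
move=> h0 mh hoo; apply/integrableP; split; first exact/measurable_EFinP.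
by under eq_integral do rewrite /= ger0_norm//.
Qed.

Variables (ep dz g : nat -> Omega -> R) (b0 : Omega -> R).
Variables (C0 C1 K l s eps : R) (S2 q : nat).
Hypotheses (q0 : (0 < q)%N) (qS2 : (q <= S2)%N).
Hypotheses (ep_ge0 : forall t w, (0 <= ep t w)%R) (dz_ge0 : forall t w, (0 <= dz t w)%R).
Hypotheses (g_ge0 : forall t w, (0 <= g t w)%R) (b_ge0 : forall w, (0 <= b0 w)%R).
Hypotheses (mep : forall t, measurable_fun setT (ep t)) (mdz : forall t, measurable_fun setT (dz t)).
Hypotheses (mb : measurable_fun setT b0) (b_fin : \int[P]_w (b0 w)%:E < +oo).
Hypotheses (C00 : (0 <= C0)%R) (C10 : (0 <= C1)%R) (K0 : (0 < K)%R) (l0 : (0 < l)%R).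
Hypothesis eps0 : (0 < eps)%R.
Hypothesis pathwise : forall w T,
  (\sum_(t < T) g t w ^+ 2 + 2 * K * l * \sum_(t < T) dz t w <=
    C0 + C1 * b0 w + K * \sum_(t < T) ep t w)%R.
Hypothesis ep_init : \int[P]_w (ep 0%N w)%:E <= s%:E.
Hypothesis ep_full : forall t, (t %% q = 0)%N -> \int[P]_w (ep t.+1 w)%:E <= s%:E.
Hypothesis ep_vr : forall t, (t %% q <> 0)%N ->
  \int[P]_w (ep t.+1 w)%:E <= \int[P]_w (ep t w)%:E +
    (l / S2%:R)%:E * \int[P]_w (dz t w)%:E.

Let ib : P.-integrable setT (EFin \o b0). Proof. exact: ge0_integrable. Qed.

(** Integrability propagates alternately: the minibatch estimate gives [ep T] from [ep] and [dz] at
    the preceding time, or from s at a full batch; the pathwise inequality with T + 1 terms then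
    bounds [dz T] by integrable quantities. *)
Let moments T : forall t, (t < T)%N ->
  P.-integrable setT (EFin \o ep t) /\ P.-integrable setT (EFin \o dz t).
Proof.
elim: T => [//|T IH].
have iep : P.-integrable setT (EFin \o ep T).
  apply: ge0_integrable => //; case: T IH => [_|T IH].
    by apply: le_lt_trans ep_init _; exact: ltry.
  have [tq|tq] := eqVneq (T %% q)%N 0%N.
    by apply: le_lt_trans (ep_full tq) _; exact: ltry.
  apply: le_lt_trans (ep_vr (elimN eqP tq)) _.
  by have [i1 i2] := IH T (ltnSn T); rewrite !ExE// -EFinM -EFinD ltry.
have iep' t : (t < T.+1)%N -> P.-integrable setT (EFin \o ep t).
  by rewrite ltnS leq_eqVlt => /orP[/eqP -> //|/IH[]].
have idz : P.-integrable setT (EFin \o dz T).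
  apply: ge0_integrable => //.
  pose h := ((fun=> C0) \+ ((fun w => C1 * b0 w) \+ (fun w => K * \sum_(t < T.+1) ep t w)))%R.
  pose h' := (fun w => (2 * K * l)^-1 * h w)%R.
  have ih' : P.-integrable setT (EFin \o h').
    apply: int_scale; apply: int_add; first exact: int_cst.
    by apply: int_add; apply: int_scale => //; exact: int_sum.
  apply: (@le_lt_trans _ _ (\int[P]_w (h' w)%:E)); last by rewrite ExE// ltry.
  apply: le_integral_ge0 => w; first by rewrite lee_fin.
  have Kl : (0 < 2 * K * l)%R by rewrite !mulr_gt0.
  rewrite lee_fin /h' ler_pdivlMl//; have := pathwise w T.+1.
  have : (0 <= \sum_(t < T.+1) g t w ^+ 2)%R by apply: sumr_ge0 => t _; exact: sqr_ge0.
  have : (dz T w <= \sum_(t < T.+1) dz t w)%R.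
    by rewrite big_ord_recr /= lerDr; apply: sumr_ge0.
  move=> /(ler_wpM2l (ltW Kl)); rewrite /h /=; move: (2 * K * l * dz T w)%R => x; lra.
move=> t; rewrite ltnS leq_eqVlt => /orP[/eqP -> //|]; exact: IH.
Qed.

Let iep t : P.-integrable setT (EFin \o ep t). Proof. by have [] := moments (ltnSn t). Qed.
Let idz t : P.-integrable setT (EFin \o dz t). Proof. by have [] := moments (ltnSn t). Qed.

Lemma expected_average_bound T :
  \sum_(t < T) \int[P]_w (g t w)%:E <=
    (T%:R * eps / 2 + (C0 + C1 * fine (\int[P]_w (b0 w)%:E) + K * (T%:R * s)) / (2 * eps))%:E.
Proof.
have Sz : (S2%:R != 0 :> R)%R by rewrite pnatr_eq0 -lt0n; exact: leq_trans qS2.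
have vs : (\sum_(t < T) Ex (ep t) <= T%:R * s + l * \sum_(t < T) Ex (dz t))%R.
  have dz0 t : (0 <= Ex (dz t))%R by apply: fine_ge0; apply: integral_ge0 => w _; rewrite lee_fin.
  have lS : (0 <= l / S2%:R)%R by rewrite divr_ge0// ltW.
  apply: (@le_trans _ _ (T%:R * s + q%:R * (l / S2%:R) * \sum_(t < T) Ex (dz t))%R).
    apply: (@variance_sum R s (l / S2%:R)%R q (fun t => Ex (ep t)) (fun t => Ex (dz t)) T) => //.
    - by rewrite -lee_fin -ExE.
    - by move=> t tq; rewrite -lee_fin -ExE//; exact: ep_full.
    - by move=> t tq; rewrite -lee_fin EFinD EFinM -!ExE//; exact: ep_vr.
  rewrite lerD2l ler_wpM2r ?sumr_ge0// mulrCA ler_piMr ?(ltW l0)//.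
  by rewrite ler_pdivrMr ?mul1r ?ler_nat// lt_neqAle eq_sym Sz ler0n.
pose k := ((2 * K * l) / (2 * eps))%R.
have k0 : (0 <= k)%R by rewrite divr_ge0// ?mulr_ge0// ltW.
pose A w := (\sum_(t < T) g t w)%R.
pose B w := (k * \sum_(t < T) dz t w)%R.
pose h := ((fun=> T%:R * eps / 2 + C0 / (2 * eps)) \+ ((fun w => C1 / (2 * eps) * b0 w) \+
  (fun w => K / (2 * eps) * \sum_(t < T) ep t w)))%R.
have e2 : (0 < 2 * eps)%R by rewrite mulr_gt0.
have AB w : (A w + B w <= h w)%R.
  have hg : (A w <= T%:R * eps / 2 + (\sum_(t < T) g t w ^+ 2) / (2 * eps))%R.
    rewrite /A mulr_suml.
    have -> : (T%:R * eps / 2 = \sum_(t < T) (eps / 2))%R.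
      by rewrite sumr_const card_ord -[RHS]mulr_natl mulrA.
    rewrite -big_split; apply: ler_sum => t _ /=.
    rewrite -(ler_pM2r e2); have -> : ((eps / 2 + g t w ^+ 2 / (2 * eps)) * (2 * eps) = eps ^+ 2 + g t w ^+ 2)%R.
      by field; rewrite gt_eqF.
    have := sqr_ge0 (eps - g t w); rewrite sqrrB; lra.
  have := pathwise w T; rewrite -(ler_pM2r (x := (2 * eps)^-1)) ?invr_gt0// => hp.
  have -> : (h w = T%:R * eps / 2 + (C0 + C1 * b0 w + K * \sum_(t < T) ep t w) / (2 * eps))%R.
    by rewrite /h /=; ring.
  have -> : (B w = (2 * K * l * \sum_(t < T) dz t w) / (2 * eps))%R by rewrite /B /k; ring.
  by rewrite mulrDl in hp; lra.
have A0 w : (0 <= A w)%R by apply: sumr_ge0.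
have B0 w : (0 <= B w)%R by rewrite mulr_ge0// sumr_ge0.
have iB : P.-integrable setT (EFin \o B) by apply: int_scale; apply: int_sum.
have ih : P.-integrable setT (EFin \o h).
  apply: int_add; first exact: int_cst.
  by apply: int_add; apply: int_scale => //; exact: int_sum.
(* The functions g carry only lower integrals, so they stay on the small side with B; the integrable
   majorant h is then computed exactly. *)
have H1 : \sum_(t < T) \int[P]_w (g t w)%:E + \int[P]_w (B w)%:E <= \int[P]_w (h w)%:E.
  apply: (@le_trans _ _ (\int[P]_w (A w)%:E + \int[P]_w (B w)%:E)).
    rewrite leeD2r//; apply: le_trans (le_integral_sum _ _) _ => [i w|]; first by rewrite lee_fin.
    by under eq_integral do rewrite sumEFin.
  apply: le_trans (le_integralD _ _ _) _ => [w|w|]; rewrite ?lee_fin//.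
  by apply: le_integral_ge0 => w; rewrite -EFinD lee_fin// addr_ge0.
have hE : Ex h = (T%:R * eps / 2 + C0 / (2 * eps) + (C1 / (2 * eps) * Ex b0 +
   K / (2 * eps) * \sum_(t < T) Ex (ep t)))%R.
  have i1 : P.-integrable setT (EFin \o (fun w => C1 / (2 * eps) * b0 w)%R) by exact: int_scale.
  have i2 : P.-integrable setT (EFin \o (fun w => K / (2 * eps) * \sum_(t < T) ep t w)%R).
    by apply: int_scale; exact: int_sum.
  rewrite /h Ex_add//; [|exact: int_cst|exact: int_add].
  by rewrite Ex_cst Ex_add// !Ex_scale// ?Ex_sum//; exact: int_sum.
have BE : Ex B = (k * \sum_(t < T) Ex (dz t))%R.
  by rewrite /B Ex_scale ?Ex_sum//; exact: int_sum.
move: H1; rewrite !ExE// -leeBrDr// -EFinB => /le_trans; apply.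
rewrite lee_fin hE BE -/(Ex b0).
have := ler_wpM2l (ltW (divr_gt0 K0 e2)) vs; rewrite /k.
set x := (\sum_(t < T) Ex (ep t))%R; set y := (\sum_(t < T) Ex (dz t))%R.
have y0 : (0 <= y)%R by apply: sumr_ge0 => t _; apply: fine_ge0; apply: integral_ge0 => w _; rewrite lee_fin.
(* Half of the [dz] term on the left pays for the growth of [ep]; this other half is dropped. *)
have ky : (0 <= K / (2 * eps) * (l * y))%R by rewrite mulr_ge0 ?divr_ge0 ?mulr_ge0// ltW.
have -> : (2 * K * l / (2 * eps) * y = 2 * (K / (2 * eps) * (l * y)))%R by ring.
have -> : ((C0 + C1 * Ex b0 + K * (T%:R * s)) / (2 * eps) =
    C0 / (2 * eps) + C1 / (2 * eps) * Ex b0 + K / (2 * eps) * (T%:R * s))%R by ring.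
rewrite mulrDr; move: (K / (2 * eps) * (l * y))%R (K / (2 * eps) * x)%R (K / (2 * eps) * (T%:R * s))%R ky.
move: (C1 / (2 * eps) * Ex b0)%R (C0 / (2 * eps))%R => z1 z2 z3 z4 z5; lra.
Qed.

End ExpectedAverage.

(** * Choice of constants and conclusion *)

Lemma path_sum_bound (R : realType) (M d m : nat) (L mu rho eta_x eta_y : R)
    (f : 'I_M -> 'rV[R]_(d + m) -> R) (e : rel 'I_M) (W : 'M[R]_M)
    (X : nat -> 'M[R]_(M, d)) (Y : nat -> 'M[R]_(M, m))
    (V D : nat -> 'M[R]_(M, d + m)) (T : nat) :
  let kappa := L / mu in
  (0 < M)%N -> (0 < m)%N -> 0 < L -> 0 < mu ->
  (forall i z, differentiable (f i) z) -> (forall i, smooth L (f i)) ->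
  (forall i x, strongly_concave mu (fun y : 'rV[R]_m => f i (row_mx x y))) ->
  mixing_matrix e rho W -> 0 < eta_y -> 0 < eta_x ->
  L * eta_y <= 1000^-1 * (1 - rho) ^+ 2 -> L * kappa * eta_y <= 1000^-1 ->
  kappa ^+ 2 * eta_x <= 1000^-1 * eta_y ->
  avg_mx R M *m D 0%N = avg_mx R M *m V 0%N ->
  (forall t, X t.+1 = W *m X t - eta_x *: lsubmx (D t)) ->
  (forall t, Y t.+1 = W *m Y t + eta_y *: rsubmx (D t)) ->
  (forall t, D t.+1 = W *m (D t + V t.+1 - V t)) ->
  \sum_(t < T) path_g f X t + 130 * kappa ^+ 2 * L ^+ 2 * \sum_(t < T) path_dz X Y t <=
    2 * ((path_ph f X 0 - path_ph f X T) / eta_x) +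
    2000 * (L ^+ 2 / (mu * eta_y) * path_dl f X Y 0 +
      kappa ^+ 2 * L ^+ 2 / (1 - rho) * path_a X Y 0 + kappa ^+ 2 * path_b D 0) +
    65 * kappa ^+ 2 * \sum_(t < T) path_ep f X Y V t.
Proof.
have c1 : 1000^-1 <= 1 :> R by lra.
have c100 : 1000^-1 <= 1 / 100 :> R by lra.
move=> kappa M0 m0 L0 mu0 df sf cf mW ey0 ex0 er ek ex mD XS YS DS.
have muL : mu <= L.
  apply: (smooth_ge_strongly_concave L0 mu0 (differentiable_avg_fun df) _ _ m0).
    exact: smooth_avg_fun.
  by move=> x; exact: strongly_concave_avg_fun.
have exy : eta_x <= eta_y.
  have k1 : 1 <= kappa ^+ 2 by rewrite expr_ge1 ?divr_ge0 ?ler_pdivlMr ?mul1r// ltW.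
  apply: (@le_trans _ _ (kappa ^+ 2 * eta_x)); first by rewrite ler_peMl// ltW.
  by apply: le_trans ex _; rewrite ler_piMl ?(ltW ey0).
have /andP[r0 r1] := mixing_rho01 mW.
have M0' : 0 <= M%:R^-1 :> R by rewrite invr_ge0.
have ek' : L * (L / mu) * eta_y <= 1 / 100 by exact: le_trans ek c100.
apply: (@pathwise_inequality R (1 - rho) L mu eta_y eta_x (path_a X Y) (path_b D)
  (path_ep f X Y V) (path_dz X Y) (path_gx V) (path_gy V) (path_dl f X Y) (path_g f X)
  (path_ph f X) 1000^-1) => //.
- by rewrite subr_gt0 r1 gerBl.
- by move=> t; rewrite mulr_ge0 ?sqr_ge0.
- by move=> t; rewrite mulr_ge0 ?sqr_ge0.
- by move=> t; rewrite mulr_ge0 ?sqr_ge0.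
- by move=> t; rewrite mulr_ge0 ?sqr_ge0.
- by move=> t; exact: sqr_ge0.
- by move=> t; exact: sqr_ge0.
- by move=> t; exact: sqr_ge0.
- exact: (path_step_b X Y M0 L0 sf mW DS).
- exact: (path_step_a M0 mW ey0 ex0 exy XS YS).
- exact: (path_bound_dz M0 mW ey0 ex0 exy mD XS YS DS).
- exact: (path_bound_gy X Y V M0 L0 mu0 df sf cf).
- exact: (path_step_ph Y M0 m0 L0 mu0 df sf cf mW ex0 mD XS DS).
- exact: (path_step_dl M0 m0 L0 mu0 df sf cf mW ey0 ex0 mD XS YS DS ek').
Qed.

(** Being positive and within 1 of s', the integer S exceeds s'/2. The lower constant 260 = 2 * 130
    therefore leaves 130 kappa^2 sigma^2 / eps^2, exactly what 65 kappa^2 sigma^2 / S <= eps^2 / 2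
    asks for. *)
Lemma batch_variance (R : realType) (k s eps : R) (S : nat) : 0 < eps -> (0 < S)%N ->
  theta_rounded 260 520 (k ^+ 2 * s ^+ 2 / eps ^+ 2) S ->
  65 * k ^+ 2 * (s ^+ 2 / S%:R) <= eps ^+ 2 / 2.
Proof.
move=> e0 S0 [s' [/andP[s1 _]]]; rewrite ltr_norml => /andP[s2 _].
have S1 : 1 <= S%:R :> R by rewrite ler1n.
have e2 : 0 < eps ^+ 2 by rewrite exprn_gt0.
rewrite mulrA ler_pdivrMr ?ltr0n//.
have -> : 65 * k ^+ 2 * s ^+ 2 = eps ^+ 2 / 2 * (130 * (k ^+ 2 * s ^+ 2 / eps ^+ 2)).
  by field; rewrite gt_eqF.
rewrite ler_pM2l ?divr_gt0//; move: (_ / eps ^+ 2) s1 => x s1; lra.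
Qed.

(** Rounding up would add 1 to a bound that may be arbitrarily small. For x < 1 the threshold is 0
    instead, with T = 0 left as a separate case; for x >= 1 the 1 is absorbed in 2x. *)
Lemma nat_threshold (R : realType) (x : R) : exists N : nat,
  (0 <= x -> N%:R <= 2 * x) /\ forall T : nat, (N <= T)%N -> T = 0%N \/ x <= T%:R.
Proof.
have [x1|x1] := ltP x 1.
  exists 0%N; split=> [x0|[|T] _]; [by rewrite mulr_ge0|by left|right].
  by apply: le_trans (ltW x1) _; rewrite ler1n.
exists (Num.truncn x).+1; split=> [x0|T xT].
  by have : (Num.truncn x)%:R <= x by [rewrite truncn_le]; rewrite -natr1; lra.
right; apply: ltW; apply: lt_le_trans (truncnS_gt x) _; by rewrite ler_nat.
Qed.

(** Each initial quantity is charged to one entry of the maximum: g to 1/eta_x, dl to L kappa /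
    eta_y, a and b to the third. The coefficient of b lacks the factor L^2 of that entry, hence the
    division by the minimum. *)
Lemma complexity_bound (R : realType) (M : nat) (L mu r eta_x eta_y g dl a b : R) :
  let kappa := L / mu in
  let cost := Num.max eta_x^-1 (Num.max (L * kappa / eta_y)
    (L ^+ 2 * kappa ^+ 2 / (r * M%:R))) in
  (0 < M)%N -> 0 < L -> 0 < mu -> 0 < r <= 1 -> 0 < eta_x -> 0 < eta_y ->
  0 <= g -> 0 <= dl -> 0 <= a -> 0 <= b ->
  2 * (g / eta_x) + 2000 * (L ^+ 2 / (mu * eta_y) * dl +
    kappa ^+ 2 * L ^+ 2 / r * (M%:R^-1 * a)) + 2000 * (kappa ^+ 2 / M%:R) * b <=
  2000 * (g + dl + a + b / Num.min 1 (L ^+ 2)) * cost.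
Proof.
move=> kappa cost M0 L0 mu0 /andP[r0 r1] ex0 ey0 g0 dl0 a0 b0.
have MR : 0 < M%:R :> R by rewrite ltr0n.
have c1 : eta_x^-1 <= cost by rewrite /cost le_max lexx.
have c2 : L * kappa / eta_y <= cost by rewrite /cost !le_max lexx orbT.
have c3 : L ^+ 2 * kappa ^+ 2 / (r * M%:R) <= cost by rewrite /cost !le_max lexx !orbT.
have n0 : 0 < Num.min 1 (L ^+ 2) by rewrite lt_min ltr01 exprn_gt0.
have nL : Num.min 1 (L ^+ 2) <= L ^+ 2 by rewrite ge_min lexx orbT.
set b' := b / _; have b'0 : 0 <= b' by rewrite divr_ge0// ltW.
have e1 : 2 * (g / eta_x) <= 2000 * (g * cost).
  have := ler_wpM2l g0 c1; have : 0 <= g / eta_x by rewrite divr_ge0// ltW.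
  by move: (g / eta_x) (g * cost) => x y; lra.
have e2 : L ^+ 2 / (mu * eta_y) * dl <= dl * cost.
  rewrite mulrC; apply: ler_wpM2l => //; apply: le_trans c2.
  by rewrite le_eqVlt; apply/orP; left; apply/eqP; rewrite /kappa; field; rewrite !gt_eqF.
have e3 : kappa ^+ 2 * L ^+ 2 / r * (M%:R^-1 * a) <= a * cost.
  have -> : kappa ^+ 2 * L ^+ 2 / r * (M%:R^-1 * a) = a * (L ^+ 2 * kappa ^+ 2 / (r * M%:R)).
    by field; rewrite !gt_eqF.
  exact: ler_wpM2l.
have e4 : kappa ^+ 2 / M%:R * b <= b' * cost.
  have -> : b = b' * Num.min 1 (L ^+ 2) by rewrite /b' divfK// gt_eqF.
  rewrite mulrC -mulrA; apply: ler_wpM2l => //; apply: le_trans c3.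
  have -> : L ^+ 2 * kappa ^+ 2 / (r * M%:R) = L ^+ 2 / r * (kappa ^+ 2 / M%:R).
    by field; rewrite !gt_eqF.
  apply: ler_wpM2r; first by rewrite divr_ge0 ?sqr_ge0.
  by apply: le_trans nL _; rewrite ler_pdivlMr// ler_piMr// sqr_ge0.
have -> : 2000 * (g + dl + a + b') * cost =
    2000 * (g * cost + dl * cost + a * cost + b' * cost) by ring.
have -> : 2000 * (kappa ^+ 2 / M%:R) * b = 2000 * (kappa ^+ 2 / M%:R * b) by ring.
move: e1 e2 e3 e4; clear.
move: (2 * (g / eta_x)) (L ^+ 2 / (mu * eta_y) * dl) (kappa ^+ 2 * L ^+ 2 / r * _) => x1 x2 x3.
move: (kappa ^+ 2 / M%:R * b) (g * cost) (dl * cost) (a * cost) (b' * cost) => x4 y1 y2 y3 y4.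
clear; lra.
Qed.

Lemma eta_y_bounds (R : realType) (l c L kappa r eta : R) : 0 < l -> 0 < c -> 0 < L -> 0 < kappa -> 0 < r ->
  theta l c (L^-1 * Num.min (r ^+ 2) kappa^-1) eta ->
  [/\ 0 < eta, L * eta <= c * r ^+ 2 & L * kappa * eta <= c].
Proof.
move=> l0 c0 L0 k0 r0; rewrite /theta; set mn := Num.min _ _ => /andP[h1 h2].
have mn0 : 0 < mn by rewrite lt_min exprn_gt0//= invr_gt0.
have mr : mn <= r ^+ 2 by rewrite ge_min lexx.
have mk : mn <= kappa^-1 by rewrite ge_min lexx orbT.
have Le : L * eta <= c * mn.
  have := ler_wpM2l (ltW L0) h2; have -> // : L * (c * (L^-1 * mn)) = c * mn.
  by rewrite mulrCA mulVKf// gt_eqF.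
split; first by apply: lt_le_trans h1; rewrite mulr_gt0// mulr_gt0 ?invr_gt0.
  by apply: le_trans Le _; exact: (ler_wpM2l (ltW c0)).
rewrite mulrAC -ler_pdivlMr//; apply: le_trans Le _; exact: (ler_wpM2l (ltW c0)).
Qed.

Lemma eta_x_bounds (R : realType) (l c kappa eta eta_x : R) : 0 < l -> 0 < kappa -> 0 < eta ->
  theta l c (eta / kappa ^+ 2) eta_x ->
  0 < eta_x /\ kappa ^+ 2 * eta_x <= c * eta.
Proof.
move=> l0 k0 e0 /andP[h1 h2]; have k2 : 0 < kappa ^+ 2 by rewrite exprn_gt0.
split; first by apply: lt_le_trans h1; rewrite mulr_gt0// divr_gt0.
by rewrite mulrC -ler_pdivlMr// -mulrA.
Qed.

(* For T = 0 the left-hand side is 0, since 0^-1 = 0. *)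
Lemma average_le (R : realType) (T : nat) (eps C K v : R) : 0 < eps ->
  T = 0%N \/ 2 * C / eps ^+ 2 <= T%:R -> K * v <= eps ^+ 2 / 2 ->
  T%:R^-1 * (T%:R * eps / 2 + (C + K * (T%:R * v)) / (2 * eps)) <= eps.
Proof.
move=> e0 [->|hT] Kv; first by rewrite invr0 mul0r ltW.
have e2 : 0 < eps ^+ 2 by rewrite exprn_gt0.
case: T hT => [_|T]; first by rewrite invr0 mul0r ltW.
set t : R := T.+1%:R => hT; have t0 : 0 < t by rewrite ltr0n.
rewrite mulrC ler_pdivrMr// -(ler_pM2r (x := 2 * eps)) ?mulr_gt0//.
have -> : (t * eps / 2 + (C + K * (t * v)) / (2 * eps)) * (2 * eps) =
    t * eps ^+ 2 + C + t * (K * v) by field; rewrite gt_eqF.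
rewrite ler_pdivrMr// in hT; have := ler_wpM2l (ltW t0) Kv.
have -> : eps * t * (2 * eps) = 2 * (t * eps ^+ 2) by ring.
have -> : t * (eps ^+ 2 / 2) = t * eps ^+ 2 / 2 by rewrite mulrA.
move: hT; clear.
by move: (t * eps ^+ 2) (t * (K * v)) => x y; lra.
Qed.

(* The constants of the order notation are quantified before everything else.
   The gradient-tracking error enters the hidden constant [C] as
   ||D^0 - Pi D^0||^2 when L >= 1 and as ||D^0 - Pi D^0||^2 / L^2 when L < 1. *)
Theorem theorem1 (R : realType) :
  exists (ay by_ ax bx aS bS : R) (C : R -> R -> R -> R -> R),
  [/\ 0 < ay < by_, 0 < ax < bx & 0 < aS < bS] /\
  forall (M d m : nat) (L mu sigma eps rho eta_x eta_y : R) (S1 S2 q : nat)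
    (f : 'I_M -> 'rV[R]_(d + m) -> R)
    (e : rel 'I_M) (W : 'M[R]_M)
    (dX : measure_display) (Xi : measurableType dX)
    (Q : 'I_M -> probability Xi R)
    (G : 'I_M -> 'rV[R]_(d + m) -> Xi -> 'rV[R]_(d + m))
    (dO : measure_display) (Omega : measurableType dO)
    (P : probability Omega R)
    (xi : nat -> 'I_M -> nat -> Omega -> Xi)
    (X0 : 'M[R]_(M, d)) (Y0 : 'M[R]_(M, m))
    (X : nat -> Omega -> 'M[R]_(M, d)) (Y : nat -> Omega -> 'M[R]_(M, m))
    (V D : nat -> Omega -> 'M[R]_(M, d + m)),
  let kappa := L / mu in
  let F := avg_fun f in
  let Z0 := row_mx X0 Y0 in
  let Pi := avg_mx R M in
  (0 < M)%N -> (0 < d)%N -> (0 < m)%N ->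
  0 < L -> 0 < mu -> 0 < sigma -> 0 < eps ->
  (forall i z, differentiable (f i) z) ->
  (forall i, smooth L (f i)) ->
  (forall i x, strongly_concave mu (fun y : 'rV[R]_m => f i (row_mx x y))) ->
  has_lbound (range (Phi F)) ->
  measurable_oracle G ->
  unbiased_oracle Q f G ->
  oracle_variance_le Q sigma f G ->
  mean_squared_lipschitz Q L G ->
  connected_network e ->
  mixing_matrix e rho W ->
  theta ay by_ (L^-1 * Num.min ((1 - rho) ^+ 2) kappa^-1) eta_y ->
  theta ax bx (eta_y / kappa ^+ 2) eta_x ->
  (0 < S1)%N ->
  theta_rounded aS bS (kappa ^+ 2 * sigma ^+ 2 / eps ^+ 2) S1 ->
  (q <= S2)%N -> (1 <= q)%N ->
  dgda_vr_sampling P Q S1 S2 q xi (D 0%N) ->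
  dgda_vr_iterates G W eta_x eta_y S1 S2 q X0 Y0 xi X Y V D ->
  ('E_P[fun w => (fnorm (D 0%N w - Pi *m D 0%N w) ^+ 2)%R] < +oo)%E ->
  exists T_eps : nat,
    T_eps%:R <=
      C (Phi F (row_mean X0) - inf (range (Phi F)))
        (fnorm (ystar F (row_mean X0) - row_mean Y0) ^+ 2)
        (fnorm (Z0 - Pi *m Z0) ^+ 2)
        (fine 'E_P[fun w => (fnorm (D 0%N w - Pi *m D 0%N w) ^+ 2)%R]%E
           / Num.min 1 (L ^+ 2))
      * Num.max (eta_x^-1)
          (Num.max (L * kappa / eta_y)
                   (L ^+ 2 * kappa ^+ 2 / ((1 - rho) * M%:R)))
      * eps ^- 2 /\
    forall T : nat, (T_eps <= T)%N ->
      ((T%:R^-1)%:E *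
        \sum_(0 <= t < T) 'E_P[fun w => fnorm (grad (Phi F) (row_mean (X t w)))]
       <= eps%:E)%E.
Proof.
have path_aux (p p' u v k i b : R) : p <= p' ->
    2 * p + 2000 * (u + v + k * (i * b)) <= 2 * p' + 2000 * (u + v) + 2000 * (k * i) * b.
  by move=> pp'; have -> : k * (i * b) = k * i * b by [ring]; lra.
have four_le (x y z : R) : x <= 2000 * y * z -> 2 * (2 * x) <= 8000 * y * z.
  by rewrite -!mulrA; move: (y * z) => w; lra.
have c1 : 0 < 1000^-1 :> R by lra.
have c2 : 0 < 2000^-1 :> R by lra.
(* The upper stepsize constants are the c of [pathwise_inequality]; the lower ones make the
   stepsizes positive. 8000 is 2000 times 2 for the threshold 2C / eps^2 and 2 for its rounding. *)
exists 2000^-1, 1000^-1, 2000^-1, 1000^-1, 260, 520, (fun a b c d => 8000 * (a + b + c + d)).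
split; first by split; lra.
move=> M d m L mu sigma eps rho eta_x eta_y S1 S2 q f e W dX Xi Q G dO Omega P xi X0 Y0 X Y V D.
move=> kappa F Z0 Pi M0 d0 m0 L0 mu0 s0 eps0 df sf cf lbPhi mG uG vG lG _ mW ty tx S10 tS qS2 q1.
move=> samp iter Dfin.
have S20 : (0 < S2)%N by exact: leq_trans qS2.
have /andP[r0 r1] := mixing_rho01 mW.
have r01 : 0 < 1 - rho <= 1 by rewrite subr_gt0 r1 gerBl.
have /andP[r0' _] := r01.
have k0 : 0 < kappa by rewrite divr_gt0.
have [ey0 er ek] := eta_y_bounds c2 c1 L0 k0 r0' ty.
have [ex0 ex] := eta_x_bounds c2 k0 ey0 tx.
set cost := Num.max _ _.
pose gap := Phi F (row_mean X0) - inf (range (Phi F)).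
pose dl := fnorm (ystar F (row_mean X0) - row_mean Y0) ^+ 2.
pose a := fnorm (Z0 - Pi *m Z0) ^+ 2.
pose b0 w := fnorm (D 0%N w - Pi *m D 0%N w) ^+ 2.
pose b := fine (\int[P]_w (b0 w)%:E).
rewrite expectation.unlock -/gap -/dl -/a -/(b0 _) -/b.
have gap0 : 0 <= gap by rewrite subr_ge0; apply: ge_inf => //; exists (row_mean X0).
have bge0 : 0 <= b by apply: fine_ge0; apply: integral_ge0 => w _; rewrite lee_fin sqr_ge0.
pose C0 := 2 * (gap / eta_x) + 2000 * (L ^+ 2 / (mu * eta_y) * dl +
  kappa ^+ 2 * L ^+ 2 / (1 - rho) * (M%:R^-1 * a)).
pose C1 := 2000 * (kappa ^+ 2 / M%:R).
have C10 : 0 <= C1 by apply: (mulr_ge0 (ler0n _ _)); rewrite divr_ge0 ?sqr_ge0.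
have C00 : 0 <= C0.
  apply: addr_ge0; apply: (mulr_ge0 (ler0n _ _)); first by rewrite divr_ge0 ?(ltW ex0).
  apply: addr_ge0; first by rewrite mulr_ge0 ?sqr_ge0// divr_ge0 ?sqr_ge0// mulr_ge0 ?ltW.
  apply: (mulr_ge0 (divr_ge0 (mulr_ge0 (sqr_ge0 _) (sqr_ge0 _)) (ltW r0'))).
  by apply: (mulr_ge0 _ (sqr_ge0 _)); rewrite invr_ge0.
have cb : C0 + C1 * b <= 2000 * (gap + dl + a + b / Num.min 1 (L ^+ 2)) * cost.
  have dl0 : 0 <= dl by exact: sqr_ge0.
  have a0 : 0 <= a by exact: sqr_ge0.
  exact (complexity_bound M0 L0 mu0 r01 ex0 ey0 gap0 dl0 a0 bge0).
have pathwise w T : \sum_(t < T) fnorm (grad (Phi F) (row_mean (X t w))) ^+ 2 +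
    2 * (65 * kappa ^+ 2) * L ^+ 2 *
      \sum_(t < T) (M%:R^-1 * fnorm (zmx X Y t.+1 w - zmx X Y t w) ^+ 2) <=
    C0 + C1 * b0 w + 65 * kappa ^+ 2 *
      \sum_(t < T) (M%:R^-1 * fnorm (grad_err f X Y V t w) ^+ 2).
  have := path_sum_bound T M0 m0 L0 mu0 df sf cf mW ey0 ex0 er ek ex
    (iter_D0 iter w) (fun t => iter_X iter t w) (fun t => iter_Y iter t w)
    (fun t => iter_D iter t w).
  have -> : 2 * (65 * kappa ^+ 2) * L ^+ 2 = 130 * kappa ^+ 2 * L ^+ 2 by ring.
  move=> /le_trans; apply; rewrite lerD2r /path_ph /path_dl /path_a /path_b.
  rewrite (iter_X0 iter) (iter_Y0 iter); apply: path_aux.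
  (* The final value of [Phi] is replaced by its infimum, which makes the bound independent of T and
     of the trajectory. *)
  rewrite ler_pM2r ?invr_gt0// lerD2l lerN2.
  by apply: ge_inf => //; exists (row_mean (X T w)).
have mz t : measurable_fun setT (fun w => M%:R^-1 * fnorm (zmx X Y t.+1 w - zmx X Y t w) ^+ 2).
  apply: measurable_funM => //; apply: measurable_mx_fnorm.
  by apply: measurable_mxB; exact: (zmx_measurable mG samp iter).
have me t : measurable_fun setT (fun w => M%:R^-1 * fnorm (grad_err f X Y V t w) ^+ 2).
  apply: measurable_funM => //; apply: measurable_mx_fnorm.
  exact: (grad_err_measurable mG uG samp iter).
have mb : measurable_fun setT b0.
  apply: measurable_mx_fnorm; apply: measurable_mxB.
    exact: (D_measurable mG samp iter).
  by apply: measurable_mulmx; exact: (D_measurable mG samp iter).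
have main T : (\sum_(t < T) \int[P]_w (fnorm (grad (Phi F) (row_mean (X t w))))%:E <=
    (T%:R * eps / 2 + (C0 + C1 * b + 65 * kappa ^+ 2 * (T%:R * (sigma ^+ 2 / S1%:R))) /
      (2 * eps))%:E)%E.
  apply: (@expected_average_bound R _ _ P
    (fun t w => M%:R^-1 * fnorm (grad_err f X Y V t w) ^+ 2)
    (fun t w => M%:R^-1 * fnorm (zmx X Y t.+1 w - zmx X Y t w) ^+ 2)
    (fun t w => fnorm (grad (Phi F) (row_mean (X t w)))) b0 C0 C1 (65 * kappa ^+ 2)
    (L ^+ 2) (sigma ^+ 2 / S1%:R) eps S2 q) => //.
  - by move=> t w; rewrite mulr_ge0 ?sqr_ge0 ?invr_ge0.
  - by move=> t w; rewrite mulr_ge0 ?sqr_ge0 ?invr_ge0.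
  - by move=> t w; exact: fnorm_ge0.
  - by move=> w; exact: sqr_ge0.
  - by move: Dfin; rewrite expectation.unlock.
  - by apply: (mulr_gt0 (ltr0Sn _ _)); rewrite exprn_gt0.
  - by rewrite exprn_gt0.
  - exact: (mean_grad_err_init mG uG vG S10 samp iter M0).
  - by move=> t; exact: (mean_grad_err_full mG uG vG S10 samp iter M0).
  - by move=> t; exact: (mean_grad_err_vr mG uG lG S20 samp iter).
(* Beyond this threshold the initial terms contribute at most eps/4 to the average, as does the
   batch variance, beside the eps/2 of the passage to norms. *)
have [N [N1 N2]] := nat_threshold (2 * (C0 + C1 * b) / eps ^+ 2).
exists N; split.
  have Cb0 := addr_ge0 C00 (mulr_ge0 C10 bge0).
  apply: le_trans (N1 (divr_ge0 (mulr_ge0 (ler0n _ 2) Cb0) (sqr_ge0 _))) _.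
  have e2 : 0 < eps ^- 2 by rewrite invr_gt0 exprn_gt0.
  rewrite mulrA (ler_pM2r e2); exact: four_le cb.
move=> T /N2 hT; rewrite big_mkord.
apply: (@le_trans _ _ ((T%:R^-1)%:E * (T%:R * eps / 2 + (C0 + C1 * b +
    65 * kappa ^+ 2 * (T%:R * (sigma ^+ 2 / S1%:R))) / (2 * eps))%:E)%E).
  by apply: lee_wpmul2l; [rewrite lee_fin invr_ge0|exact: main].
rewrite -EFinM lee_fin; apply: average_le => //.
exact: batch_variance.
Qed.
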